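(* The polynomial $R$ of twisted graph diagrams is invariant under Reidemeister moves II, III and IV, and it is invariant up to multiplication with some $(-a)^{n}$, $n\in\mathbb{Z}$, under Reidemeister moves I and V. That is, if twisted graph diagrams $E,E'$ differ by one move of type II, III or IV then $R(E)=R(E')$, and if they differ by one move of type I or V then $R(E)=(-a)^nR(E')$ for some $n\in\mathbb{Z}$.
   Context: Graphs are finite, may be disconnected, may have loops and multiple edges, and may have circle components (components homeomorphic to a circle and without vertices). A twisted graph diagram is a diagram of a graph in $\mathbb{R}^2$ whose multiple points are transverse double points away from vertices, each being either a classical crossing (with over/under information) or a virtual crossing (no such information), with finitely many bars (short transverse marks) on edges or circle components. It is pure if it has no classical crossings. Surface of a pure diagram. For a pure twisted graph diagram $E$ without circle components let $S$ be the compact surface with a disk for each vertex and a band for each edge, the bands attached to the vertex disks in the cyclic order in which the edges leave the vertex in the plane, a band having a half twist for each bar on its edge (relative to the planar orientation of the disks); virtual crossings are ignored (bands pass each other without meeting). Let $k(S)$ be the number of connected components, $n(S)$ the first Betti number, $b(S)$ the number of boundary components, and $t(S)=0$ if $S$ is orientable, $t(S)=1$ otherwise. Put $M(\emptyset)=1$ and $$M(E)=(-1)^{k(S)}y^{n(S)}z^{k(S)-b(S)+n(S)}w^{t(S)}\in\mathbb{Z}[y,z,w]/(w^2-w).$$ For a pure twisted graph diagram $F$ let $o(F)$, resp. $e(F)$, be the number of circle components with an odd, resp. even (possibly zero), number of bars. Put $Q(\emptyset)=1$ and $$Q(F)(y,z,w)=(-1-y)^{e(F)}(-1-yzw)^{o(F)}\sum_{E\subset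 F}M(E),$$ the sum being over all subdiagrams $E$ given by spanning subgraphs (all vertices, any subset of edges) of $F$ with its circle components removed. States. At a classical crossing whose over-strand joins the ends SW and NE and whose under-strand joins NW and SE: spin $+1$ replaces it by two disjoint arcs joining SW to NW and SE to NE; spin $-1$ by two disjoint arcs joining SW to SE and NW to NE; spin $0$ by a vertex of degree 4. A state $S$ of a twisted graph diagram $E$ is the pure twisted graph diagram obtained by choosing a spin at every classical crossing; $\mathcal{S}(E)$ is the set of states, and $\{E\mid S\}:=a^{p-q}$ where $p,q$ are the numbers of crossings with spin $+1$, $-1$. Define $$R(E)(a,z,w)=\sum_{S\in\mathcal{S}(E)}\{E\mid S\}\,Q(S)(-a-2-a^{-1},z,w)\in\mathbb{Z}[a^{\pm1},z,w]/(w^2-w).$$ Moves (inside a disk, diagram unchanged outside): I adds/removes a classical kink; II adds/removes a classical bigon with one strand over the other; III is the classical triangle move; IV moves a strand entirely over, or entirely under, a vertex; V rotates a vertex rigidly by $\pi$ about an axis in the plane of projection: the cyclic order of the edge-ends at the vertex is reversed, and the edge-ends leaving on each side of the vertex along the axis acquire a half-twist of classical crossings in the sense determined by the rotation, each pair on the same side crossing exactly once. *)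

(* Defs.v *)
From mathcomp Require Import all_boot all_order all_algebra.

Set Implicit Arguments.
Unset Strict Implicit.
Unset Printing Implicit Defensive.

Import GRing.Theory.

(******************************************************************************)
(* Planar diagram codes.                                                      *)
(*                                                                            *)
(* The image of a diagram is cut into arcs at its vertices, crossings, bars   *)
(* and, if needed, at further regular points; the arcs are labelled by L, and *)
(* each node is recorded by the labels of the arc-ends at it.  Every circle   *)
(* component is cut at least once, so that a circle without crossings and     *)
(* bars is one regular point (a, a).                                          *)
(*   - a vertex is the list of its arc-ends, counterclockwise, starting       *)
(*     anywhere; an isolated vertex is [::];                                  *)
(*   - a crossing is (SW, SE, NE, NW), i.e. counterclockwise; at a classical  *)
(*     crossing SW-NE is the over-strand and NW-SE the under-strand.          *)
(******************************************************************************)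

Definition quad (L : Type) : Type := (L * L * L * L)%type.

Record code (L : Type) : Type := Code {
  vertices  : seq (seq L);
  crossings : seq (quad L);
  virtuals  : seq (quad L);
  bars      : seq (L * L);
  points    : seq (L * L)
}.

Definition quad_seq (L : Type) (q : quad L) : seq L :=
  let: (sw, se, ne, nw) := q in [:: sw; se; ne; nw].

Definition pair_seq (L : Type) (p : L * L) : seq L := [:: p.1; p.2].

Definition nodes (L : Type) (E : code L) : seq (seq L) :=
  vertices E ++ map (@quad_seq L) (crossings E)
    ++ map (@quad_seq L) (virtuals E) ++ map (@pair_seq L) (bars E)
    ++ map (@pair_seq L) (points E).

Definition quad_map (L L' : Type) (f : L -> L') (q : quad L) : quad L' :=
  let: (sw, se, ne, nw) := q in (f sw, f se, f ne, f nw).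

Definition pair_map (L L' : Type) (f : L -> L') (p : L * L) : L' * L' :=
  (f p.1, f p.2).

Definition relabel (L L' : Type) (f : L -> L') (E : code L) : code L' :=
  Code (map (map f) (vertices E)) (map (quad_map f) (crossings E))
    (map (quad_map f) (virtuals E)) (map (pair_map f) (bars E))
    (map (pair_map f) (points E)).

Definition join_codes (L : Type) (E F : code L) : code L :=
  Code (vertices E ++ vertices F) (crossings E ++ crossings F)
    (virtuals E ++ virtuals F) (bars E ++ bars F) (points E ++ points F).

(******************************************************************************)
(* The surface of a pure diagram.  The functions of this section ignore the   *)
(* component [crossings F]; they are meant for F without classical crossings. *)
(******************************************************************************)

Section Surface.

Variables (L : finType) (F : code L).

(* The two arcs of each pair continue each other: through a bar, a regular
   point, or straight through a virtual crossing. *)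
Definition links : seq (L * L) :=
  bars F ++ points F
    ++ flatten [seq (let: (sw, se, ne, nw) := q in [:: (sw, ne); (se, nw)])
               | q <- virtuals F].

Definition linked : rel L := fun a b =>
  ((a, b) \in links) || ((b, a) \in links).

(* The edge or circle component through the arc a, as the set of its arcs. *)
Definition strand (a : L) : {set L} := [set b | connect linked a b].

Definition vertex_at (x : 'I_(size (vertices F))) : seq L :=
  tnth (in_tuple (vertices F)) x.

(* Edge-ends: pairs of a vertex and a position in its cyclic list. *)
Definition edge_end : finType :=
  {x : 'I_(size (vertices F)) & 'I_(size (vertex_at x))}.

Definition foot (d : edge_end) : 'I_(size (vertices F)) := tag d.

(* The next edge-end counterclockwise at the same vertex. *)
Definition next_end (d : edge_end) : edge_end :=
  Tagged (fun x => 'I_(size (vertex_at x))) (ordS (tagged d)).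

Definition edge_of (d : edge_end) : {set L} :=
  strand (tnth (in_tuple (vertex_at (tag d))) (tagged d)).

Definition edges : {set {set L}} := [set edge_of d | d : edge_end].

Definition circles : {set {set L}} := [set strand a | a : L] :\: edges.

Definition odd_bars (e : {set L}) : bool :=
  odd (count (fun b : L * L => b.1 \in e) (bars F)).

(* The spanning subgraph with edge set A, for A \subset edges, and its
   surface S: one disk per vertex of F and one band per edge in A. *)
Variable A : {set {set L}}.

(* d and d' are the two ends of a band. *)
Definition band (d d' : edge_end) : bool :=
  [&& d != d', edge_of d == edge_of d' & edge_of d \in A].

Definition surf_components : nat :=
  n_comp (fun x y => [exists d, exists d', [&& foot d == x, foot d' == y
                                             & band d d']])
    (mem 'I_(size (vertices F))).

(* S has the homology of its handle decomposition, with the disks as 0-handles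
   and the bands as 1-handles: H_1(S; Q) is the kernel of the boundary map from
   bands to disks.  Each band is directed away from the end first_end. *)
Definition first_end (e : {set L}) : option edge_end :=
  [pick d | edge_of d == e].

Definition handle_boundary : 'M[rat]_(#|A|, size (vertices F)) :=
  (\matrix_(i, x)
     \sum_(d | (edge_of d == enum_val i) && (foot d == x))
        if first_end (enum_val i) == Some d then -1 else 1)%R.

Definition surf_betti1 : nat := \rank (kermx handle_boundary).

(* A flag (d, s) is a corner of the place where the edge-end d meets its vertex
   disk: seen from the vertex, the left (counterclockwise) corner if s = true,
   the right one if s = false.  The boundary of S runs between flags
   - along the disk, from the left of d to the right of the next end;
   - along the two sides of each band, from left to right if it has no half
     twist and from left to left if it has one (mod 2 bars);
   - along the disk, from left to right of d, if the edge of d is not in A. *)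
Definition boundary_step : rel (edge_end * bool) := fun f f' =>
  let: (d, s) := f in let: (d', s') := f' in
  [|| [&& s, ~~ s' & d' == next_end d],
      [&& ~~ s, s' & d == next_end d'],
      band d d' && (s' == (if odd_bars (edge_of d) then s else ~~ s))
    | [&& d == d', s' != s & edge_of d \notin A]].

(* A vertex without edge-ends is a disk with one boundary component. *)
Definition surf_boundaries : nat :=
  n_comp boundary_step (mem {: edge_end * bool}) + count (@nilp L) (vertices F).

(* S is orientable iff the disks can be oriented (o x says whether the planar
   orientation of the disk x is reversed) compatibly with all bands. *)
Definition surf_orientable : bool :=
  [exists o : {ffun 'I_(size (vertices F)) -> bool},
    forall d, forall d', band d d' ==>
      (o (foot d) (+) o (foot d') == odd_bars (edge_of d))].

End Surface.

(******************************************************************************)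
(* The polynomials M, Q and R, as functions of their variables in a           *)
(* commutative ring.                                                          *)
(******************************************************************************)

Section Polynomials.

Local Open Scope ring_scope.

(* The natural number k + n - b is not truncated: k - b + n is the sum over the
   components of S of 2 - (Euler characteristic of the closed-up component). *)
Definition Mpoly (L : finType) (F : code L) (A : {set {set L}})
    (R : comNzRingType) (y z w : R) : R :=
  let k := surf_components F A in
  let n := surf_betti1 F A in
  let b := surf_boundaries F A in
  (-1) ^+ k * y ^+ n * z ^+ (k + n - b)%N * w ^+ (~~ surf_orientable F A).

Definition Qpoly (L : finType) (F : code L)
    (R : comNzRingType) (y z w : R) : R :=
  (-1 - y) ^+ #|[set c in circles F | ~~ odd_bars F c]|
  * (-1 - y * z * w) ^+ #|[set c in circles F | odd_bars F c]|
  * \sum_(A : {set {set L}} | A \subset edges F) Mpoly F A y z w.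

(* A spin is Some true for +1, Some false for -1, None for 0. *)
Definition spin : Type := option bool.

Definition spin_vertices (L : Type) (p : spin * quad L) : seq (seq L) :=
  let: (s, q) := p in if s is None then [:: quad_seq q] else [::].

(* The two arcs replacing a crossing of spin +1 or -1. *)
Definition spin_arcs (L : Type) (p : spin * quad L) : seq (L * L) :=
  let: (s, (sw, se, ne, nw)) := p in
  match s with
  | Some true  => [:: (sw, nw); (se, ne)]
  | Some false => [:: (sw, se); (nw, ne)]
  | None       => [::]
  end.

Definition state (L : Type) (E : code L)
    (s : (size (crossings E)).-tuple (option bool)) : code L :=
  let sq := zip s (crossings E) in
  Code (vertices E ++ flatten (map (@spin_vertices L) sq)) [::]
    (virtuals E) (bars E) (points E ++ flatten (map (@spin_arcs L) sq)).

Definition Rpoly (L : finType) (E : code L)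
    (R : comUnitRingType) (a z w : R) : R :=
  \sum_(s : (size (crossings E)).-tuple (option bool))
    a ^ ((count_mem (Some true) s)%:Z - (count_mem (Some false) s)%:Z)
    * Qpoly (state s) (- a - 2 - a^-1) z w.

End Polynomials.

(******************************************************************************)
(* The coefficient ring: Z[a, a^-1, z, w]/(w^2 - w) is the subring generated  *)
(* by a, a^-1, z, w in K[w]/(w^2 - w), K being the field of fractions of      *)
(* Z[a, z].  Here {poly {poly int}} is Z[z][a].                               *)
(******************************************************************************)

Notation ratfun_az := {fraction {poly {poly int}}}.

Notation idempotent_poly := ('X^2 - 'X : {poly ratfun_az})%R.

Notation Rring := {poly %/ idempotent_poly}.

Definition var_a : Rring := qpolyC idempotent_poly (tofrac 'X%R).
Definition var_z : Rring := qpolyC idempotent_poly (tofrac ('X%:P)%R).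
Definition var_w : Rring := in_qpoly idempotent_poly 'X%R.

(******************************************************************************)
(* Twisted graph diagrams.                                                    *)
(******************************************************************************)

(* All nodes of E turned into vertices, so that its edges are the arcs of E. *)
Definition shadow (L : Type) (E : code L) : code L :=
  Code (nodes E) [::] [::] [::] [::].

(* Planarity: k - b + n = 0 for the neighbourhood of the image of E, i.e. all
   components of the surface obtained by capping it off with disks are
   spheres. *)
Definition planar_code (L : finType) (E : code L) : bool :=
  let S := shadow E in
  let A := edges S in
  (surf_components S A + surf_betti1 S A == surf_boundaries S A)%N.

Definition two_ends (L : finType) (E : code L) : bool :=
  [forall a : L, count_mem a (flatten (nodes E)) == 2].

Record twisted_diagram : Type := TwistedDiagram {
  arc : finType;
  dcode :> code arc;
  arc_two_ends : two_ends dcode;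
  dcode_planar : planar_code dcode
}.

Definition R_of (E : twisted_diagram) : Rring := Rpoly E var_a var_z var_w.

(* Two codes of the same diagram: they differ in the labels of the arcs, the
   order in which the nodes are listed, the starting points of the cyclic
   lists, and the use of regular points.  In the last clause a regular point
   between two distinct arcs, None and Some a, is forgotten.  Codes do not
   record how the connected components of the image are placed with respect to
   each other. *)
Inductive same_diagram : forall L L' : finType, code L -> code L' -> Prop :=
| same_refl (L : finType) (E : code L) : same_diagram E E
| same_sym (L L' : finType) (E : code L) (E' : code L') :
    same_diagram E E' -> same_diagram E' E
| same_trans (L L' L'' : finType) (E : code L) (E' : code L') (E'' : code L'') :
    same_diagram E E' -> same_diagram E' E'' -> same_diagram E E''
| same_relabel (L L' : finType) (f : L -> L') (E : code L) :
    bijective f -> same_diagram E (relabel f E)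
| same_order (L : finType) (E E' : code L) :
    perm_eq (vertices E) (vertices E') ->
    perm_eq (crossings E) (crossings E') ->
    perm_eq (virtuals E) (virtuals E') ->
    perm_eq (bars E) (bars E') ->
    perm_eq (points E) (points E') -> same_diagram E E'
| same_vertex (L : finType) (v : seq L) vs cs rs bs ps :
    same_diagram (Code (v :: vs) cs rs bs ps) (Code (rot 1 v :: vs) cs rs bs ps)
| same_crossing (L : finType) (sw se ne nw : L) vs cs rs bs ps :
    same_diagram (Code vs ((sw, se, ne, nw) :: cs) rs bs ps)
                 (Code vs ((ne, nw, sw, se) :: cs) rs bs ps)
| same_virtual (L : finType) (sw se ne nw : L) vs cs rs bs ps :
    same_diagram (Code vs cs ((sw, se, ne, nw) :: rs) bs ps)
                 (Code vs cs ((se, ne, nw, sw) :: rs) bs ps)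
| same_bar (L : finType) (a b : L) vs cs rs bs ps :
    same_diagram (Code vs cs rs ((a, b) :: bs) ps)
                 (Code vs cs rs ((b, a) :: bs) ps)
| same_point (L : finType) (a b : L) vs cs rs bs ps :
    same_diagram (Code vs cs rs bs ((a, b) :: ps))
                 (Code vs cs rs bs ((b, a) :: ps))
| same_forget (L : finType) (a : L) (vs : seq (seq (option L))) cs rs bs ps :
    same_diagram (Code vs cs rs bs ((None, Some a) :: ps))
                 (relabel (odflt a) (Code vs cs rs bs ps)).

(******************************************************************************)
(* Tangles and moves.                                                         *)
(******************************************************************************)

(* The part of a diagram inside (or outside) a disk.  [ends] lists the arcs
   meeting the boundary circle, counterclockwise with respect to the disk. *)
Record tangle (L : Type) : Type := Tangle {
  tcode :> code L;
  ends : seq L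
}.

(* The boundary points of the disk become regular points. *)
Definition glue (L L' : Type) (O : tangle L) (T : tangle L') : code (L + L') :=
  join_codes (join_codes (relabel inl O) (relabel inr T))
    (Code [::] [::] [::] [::] (zip (map inl (ends O)) (map inr (ends T)))).

Definition replaced (LT LT' : finType) (T : tangle LT) (T' : tangle LT')
    (E E' : twisted_diagram) : Prop :=
  exists (L : finType) (O : tangle L),
    [/\ size (ends O) = size (ends T), size (ends O) = size (ends T'),
        same_diagram E (glue O T) & same_diagram E' (glue O T')].

Definition move_by (LT LT' : finType) (T : tangle LT) (T' : tangle LT')
    (E E' : twisted_diagram) : Prop :=
  replaced T T' E E' \/ replaced T T' E' E.

(* The crossing with ends p, q, r, s counterclockwise, the strand p-r passing
   over q-s iff over = true. *)
Definition crossing (L : Type) (over : bool) (p q r s : L) : quad L :=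
  if over then (p, q, r, s) else (q, r, s, p).

(* A tangle whose arcs are numbered 0, ..., n. *)
Definition numbered (n : nat) (T : tangle nat) : tangle 'I_n.+1 :=
  Tangle (relabel inord T) (map inord (ends T)).

Definition crossing_tangle (L : Type) (cs : seq (quad L)) (es : seq L)
    : tangle L := Tangle (Code [::] cs [::] [::] [::]) es.

(* Move I: up to a rotation there are two kinks, one the mirror image of the
   other. *)
Definition straight_tangle := numbered 0 (crossing_tangle [::] [:: 0; 0]).

Definition kink_tangle (over : bool) :=
  numbered 2 (crossing_tangle [:: crossing over 0 0 1 2] [:: 1; 2]).

Definition move_I (E E' : twisted_diagram) : Prop :=
  exists over : bool, move_by straight_tangle (kink_tangle over) E E'.

(* Move II: the strand with ends 0 and 3 passes over the strand with ends 1 and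
   2; arc 4 of the former and arc 5 of the latter bound the bigon. *)
Definition parallel_tangle :=
  numbered 1 (crossing_tangle [::] [:: 0; 1; 1; 0]).

Definition bigon_tangle :=
  numbered 5 (crossing_tangle [:: crossing true 0 1 4 5; crossing true 4 2 3 5]
                [:: 0; 1; 2; 3]).

Definition move_II (E E' : twisted_diagram) : Prop :=
  move_by parallel_tangle bigon_tangle E E'.

(* Move III: three strands, joining the ends i and i + 3 for i = 0, 1, 2; the
   strand i has height h_i, and its middle arc is i + 6.  The strand 0 passes
   the crossing of the strands 1 and 2 on one side or on the other. *)
Definition triangle_tangle (h0 h1 h2 : nat) :=
  numbered 8 (crossing_tangle
    [:: crossing (h1 < h0) 0 1 6 7;
        crossing (h2 < h0) 6 2 3 8;
        crossing (h2 < h1) 7 8 4 5]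
    [:: 0; 1; 2; 3; 4; 5]).

Definition triangle_tangle' (h0 h1 h2 : nat) :=
  numbered 8 (crossing_tangle
    [:: crossing (h1 < h0) 6 7 3 4;
        crossing (h2 < h0) 0 8 6 5;
        crossing (h2 < h1) 1 2 7 8]
    [:: 0; 1; 2; 3; 4; 5]).

Definition move_III (E E' : twisted_diagram) : Prop :=
  exists h0 h1 h2 : nat, uniq [:: h0; h1; h2] /\
    move_by (triangle_tangle h0 h1 h2) (triangle_tangle' h0 h1 h2) E E'.

(* Move IV: a vertex with k edge-ends going up and m going down, and a
   horizontal strand above it, crossing the k ends, over or under all of them.
   From right to left the strand has arcs q 0, ..., q k; the j-th edge-end from
   the right is cut into p j (at the vertex) and u j (at the boundary).  The
   ends are, counterclockwise: the right end of the strand, the upper ends, the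
   left end of the strand, the lower ends. *)
Definition strand_above (over : bool) (k m : nat) :
    tangle ('I_k.+1 + ('I_k + 'I_k) + 'I_m) :=
  let q (j : nat) := inl (inl (inord j : 'I_k.+1)) in
  let u (j : 'I_k) := inl (inr (inl j)) in
  let p (j : 'I_k) := inl (inr (inr j)) in
  let l (j : 'I_m) := inr j in
  Tangle
    (Code [:: map p (enum 'I_k) ++ map l (enum 'I_m)]
       [seq crossing over (q j) (u j) (q j.+1) (p j) | j : 'I_k <- enum 'I_k]
       [::] [::] [::])
    (q 0 :: map u (enum 'I_k) ++ q k :: map l (enum 'I_m)).

(* The strand below a vertex with k ends going up and m going down: the above
   picture rotated by a half turn, with the roles of k and m exchanged; the
   list of the ends again begins with the right end of the strand. *)
Definition strand_below (over : bool) (k m : nat) :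
    tangle ('I_m.+1 + ('I_m + 'I_m) + 'I_k) :=
  let T := strand_above over m k in Tangle T (rot m.+1 (ends T)).

Definition move_IV (E E' : twisted_diagram) : Prop :=
  exists (over : bool) (k m : nat),
    move_by (strand_above over k m) (strand_below over k m) E E'.

(* A half twist of k parallel horizontal strands, numbered from bottom to top on
   the right (or from top to bottom on the left).  Coming from that side, the
   strand i meets the others in increasing order and is cut into the arcs
   (i, 0), ..., (i, k - 1).  For i < j, in the right-hand version, the strand j
   passes from NE to SW and the strand i from SE to NW at their crossing; the
   left-hand version is the same picture rotated by a half turn. *)
Definition half_twist (over : bool) (k : nat) : seq (quad ('I_k * 'I_k)) :=
  [seq crossing over (ij.2, ordS ij.1) (ij.1, ord_pred ij.2)
         (ij.2, ij.1) (ij.1, ij.2)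
  | ij : 'I_k * 'I_k <- enum {: 'I_k * 'I_k} & ij.1 < ij.2].

Definition outer_arc (k : nat) (i : 'I_k) : 'I_k * 'I_k := (i, insubd i 0).
Definition inner_arc (k : nat) (i : 'I_k) : 'I_k * 'I_k := (i, insubd i k.-1).

(* Move V: a vertex with k ends on the right and m ends on the left, rotated by
   pi about the horizontal axis.  The end of the vertex that was on top passes
   in front (dir = true) or behind (dir = false) on its way to the bottom: then
   the strands of slope SW-NE are over (under) on the right, and those of slope
   NW-SE on the left. *)
Definition vertex_tangle (k m : nat) : tangle ('I_k + 'I_m) :=
  let es := map inl (enum 'I_k) ++ map inr (enum 'I_m) in
  Tangle (Code [:: es] [::] [::] [::] [::]) es.

Definition rotated_vertex_tangle (dir : bool) (k m : nat) :
    tangle ('I_k * 'I_k + 'I_m * 'I_m) :=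
  Tangle
    (Code [:: map inl (rev (map (@inner_arc k) (enum 'I_k)))
              ++ map inr (rev (map (@inner_arc m) (enum 'I_m)))]
       (map (quad_map inl) (half_twist dir k)
        ++ map (quad_map inr) (half_twist (~~ dir) m))
       [::] [::] [::])
    (map inl (map (@outer_arc k) (enum 'I_k))
     ++ map inr (map (@outer_arc m) (enum 'I_m))).

Definition move_V (E E' : twisted_diagram) : Prop :=
  exists (dir : bool) (k m : nat),
    move_by (vertex_tangle k m) (rotated_vertex_tangle dir k m) E E'.

(* Main.v *)
(**
R is compared with a vertex model.  For z = 1/N, y = - q N^2 and w in {0, 1},
where q and N are powers of 2, let A be the algebra of q-tuples of N x N
matrices, with the trace normalised by tr 1 = -1.  Colour every arc by an
orthonormal basis of the traceless part of A, give a vertex the trace of the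
product of the colours around it, and give a bar the sign by which transposition
(combined, if w = 0, with a fixed-point free involution of the q components)
acts on the colour.  For a pure diagram, summing over the colours of an edge
yields the projection to the traceless part, that is a band plus the absence of
a band; the matrix indices are then constant along the boundary components of
the surface and the index of the tuple along its components, so the state sum
counts q^k N^b colourings and, with its normalising factors, is Q.  Hence R is
the state sum in which a crossing has weight a, a^-1 and 1 times the three
smoothings.

A strand passing over an edge coloured x acts by an operator Theta that is
multiplicative in x.  This gives moves II, III (the Yang-Baxter equation) and IV;
in the same way a half twist acts on words by an invertible operator, which gives
move V.  Since the values of (a, z) obtained in this way are Zariski dense, and w
is idempotent, the identities hold in the coefficient ring.
*)

Require Import Defs.
From HB Require Import structures.
From mathcomp Require Import all_boot all_order all_algebra all_field ring zify.

Set Implicit Arguments.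
Unset Strict Implicit.
Unset Printing Implicit Defensive.

Import Order.TTheory GRing.Theory Num.Theory.

(** * Strands and edge-ends *)

(** The relation y = - a - 2 - a^-1 is what makes Theta multiplicative. With tr 1 = -1 the
    projection to the traceless part is u + tr u, so the term of an absent band gets the coefficient
    1, as in Q. Three points lie outside the algebra. The code of a diagram only lists labels, so
    that an edge has exactly two ends must be derived by counting labels. The exponent k + n - b is
    a truncated difference, hence b <= k + n must be known; it follows by comparing numbers of
    two-valued colourings with the mod 2 cycle space. Finally the model lives over the algebraic
    numbers, at special values only: R is written, uniformly in the ring, as a Laurent polynomial in
    a over Z[z], so that an identity at enough special values passes to the field of fractions. The
    sizes q and N are powers of 2 because the colours are then Pauli matrices indexed by characters
    with values 1 and -1, on which transposition acts by signs; q > 1 leaves room for an involution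
    without fixed points. *)

Section Counting.

Variable T : finType.

(** Such a function is a free choice of values at the roots of the components. Through this lemma
    the numbers k and b of a surface become exponents of counts of colourings. *)
Lemma card_invariant_ffun (I : finType) (e : rel T) : connect_sym e ->
  #|[set h : {ffun T -> I} | [forall x, forall x', e x x' ==> (h x == h x')]]|
  = (#|I| ^ n_comp e (mem T))%N.
Proof.
move=> se.
have hroot (h : {ffun T -> I}) x :
    (forall x x', e x x' -> h x = h x') -> h (fingraph.root e x) = h x.
  move=> he; have /connectP[p ep ->] := connect_root e x.
  by elim: p x ep => //= x' p IH x /andP[/he->]; exact: IH.
pose R := {x | x \in [predI roots e & mem T]}.
have rootR x : fingraph.root e x \in [predI roots e & mem T].
  by rewrite !inE /= roots_root.
pose f (g : {ffun R -> I}) : {ffun T -> I} :=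
  [ffun x => g (Sub (fingraph.root e x) (rootR x))].
have rootK (r : R) : Sub (fingraph.root e (val r)) (rootR (val r)) = r.
  apply: val_inj; case: r => r /= /andP[]; by rewrite inE => /eqP.
have fI : injective f.
  move=> g g' /ffunP fg; apply/ffunP => r.
  by have := fg (val r); rewrite !ffunE rootK.
have -> : n_comp e (mem T) = #|{: R}|.
  by rewrite card_sig; apply: eq_card => x; rewrite !inE.
rewrite -card_ffun -(card_imset _ fI); apply: eq_card => h.
rewrite inE; apply/idP/imsetP => [he|[g _ ->]].
  have {}he x x' : e x x' -> h x = h x'.
    by move=> exx; have /forallP/(_ x)/forallP/(_ x')/implyP/(_ exx)/eqP := he.
  exists [ffun r => h (val r)] => //.
  by apply/ffunP => x; rewrite !ffunE /= hroot.
apply/forallP => x; apply/forallP => x'; apply/implyP => exx; rewrite !ffunE.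
have E : fingraph.root e x = fingraph.root e x' by apply/(fingraph.rootP se)/connect1.
by apply/eqP; congr (g _); apply: val_inj.
Qed.

Definition pair_rel (ls : seq (T * T)) : rel T := fun a b =>
  ((a, b) \in ls) || ((b, a) \in ls).

Lemma pair_rel_sym ls : symmetric (pair_rel ls).
Proof. by move=> a b; rewrite /pair_rel orbC. Qed.

(** A path through the new link can be shortened so that it uses the link once, in one of the two
    directions. *)
Lemma connect_pair_cons u v ls a b : connect (pair_rel ((u, v) :: ls)) a b ->
  [\/ connect (pair_rel ls) a b,
      connect (pair_rel ls) a u /\ connect (pair_rel ls) v b |
      connect (pair_rel ls) a v /\ connect (pair_rel ls) u b].
Proof.
set e := pair_rel ls; have sc : connect_sym e := sym_connect_sym (pair_rel_sym ls).
move=> /connectP[p]; elim: p a => [|c p IH] a /=.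
  by move=> _ ->; constructor 1.
case/andP=> eac /IH{}IH /IH{}IH.
have : e a c \/ (a, c) = (u, v) \/ (c, a) = (u, v).
  move: eac; rewrite /e /pair_rel !inE -orbA.
  by case/or4P => [/eqP|->|/eqP|->]; rewrite ?orbT; auto.
case=> [/connect1 ac|[[au cv]|[cu av]]].
- case: IH => [H|[H ?]|[H ?]].
  + by constructor 1; apply: connect_trans ac H.
  + by constructor 2; split=> //; apply: connect_trans ac H.
  + by constructor 3; split=> //; apply: connect_trans ac H.
- subst a c; case: IH => [H|[_ H]|[_ H]].
  + by constructor 2; split.
  + by constructor 2; split.
  + by constructor 1.
subst a c; case: IH => [H|[_ H]|[_ H]].
- by constructor 3; split.
- by constructor 1.
by constructor 3; split.
Qed.

(** A connected graph has at most one more vertex than edges. A new link either leaves the component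
    of a unchanged or joins it to one other component, and then the link itself pays for the second
    extra 1. *)
Lemma card_component ls a :
  (#|[set b | connect (pair_rel ls) a b]|
   <= (count (fun l => connect (pair_rel ls) a l.1) ls).+1)%N.
Proof.
elim: ls a => [|[u v] ls IH] a.
  rewrite /= -(cards1 a); apply: subset_leq_card; apply/subsetP => b.
  rewrite !inE => /connectP[[|c p]] //= _ ->; exact: eqxx.
set e := pair_rel ls; set e' := pair_rel _.
have sc : connect_sym e := sym_connect_sym (pair_rel_sym ls).
have sub x z : connect e x z -> connect e' x z.
  apply: connect_sub => {}x {}z exz; apply: connect1; move: exz.
  by rewrite /e /e' /pair_rel !inE => /orP[] ->; rewrite ?orbT.
have uv : connect e' u v by apply: connect1; rewrite /e' /pair_rel inE eqxx.
have sc' : connect_sym e' := sym_connect_sym (pair_rel_sym _).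
have old : #|[set b | connect e' a b]| <= #|[set b | connect e a b]| ->
    #|[set b | connect e' a b]|
    <= (count (fun l => connect e' a l.1) ((u, v) :: ls)).+1.
  move=> /leq_trans; apply; apply: leq_trans (IH a) _; rewrite ltnS /=.
  by rewrite -[leqLHS]add0n leq_add //; apply: sub_count => l /=; apply: sub.
(* Merging with the component of c: no old link is counted twice, since c is not connected to a
   without the new link. *)
have new c : connect e' a u -> connect e' a c -> ~~ connect e a c ->
    [set b | connect e' a b] \subset [set b | connect e a b] :|: [set b | connect e c b] ->
    #|[set b | connect e' a b]|
    <= (count (fun l => connect e' a l.1) ((u, v) :: ls)).+1.
  move=> au ac nac /subset_leq_card/leq_trans; apply.
  rewrite cardsU; apply: leq_trans (leq_subr _ _) _.
  apply: leq_trans (leq_add (IH a) (IH c)) _.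
  rewrite /= au addSn addnS -[nat_of_bool true]/1 add1n !ltnS.
  rewrite -count_predUI [X in _ + X](_ : _ = 0) ?addn0 ?ltnS.
    by apply: sub_count => l /= /orP[/sub//|/sub]; apply: connect_trans.
  apply/eqP; rewrite -leqn0 leqNgt -has_count; apply/hasPn => l _ /=.
  by apply/negP => /andP[al]; rewrite sc => /(connect_trans al); apply/negP.
case au: (connect e a u); case av: (connect e a v).
- apply: old; apply/subset_leq_card/subsetP => b; rewrite !inE.
  by case/connect_pair_cons => [//|[_]|[_]]; apply: connect_trans.
- apply: (new v) => //; [exact: sub|exact: connect_trans (sub _ _ au) uv|by rewrite av|].
  apply/subsetP => b; rewrite !inE.
  by case/connect_pair_cons => [->//|[_ ->]|[]]; rewrite ?orbT // -/e av.
- have a'u : connect e' a u by rewrite sc' in uv; apply: connect_trans (sub _ _ av) uv.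
  apply: (new u) => //; first by rewrite au.
  apply/subsetP => b; rewrite !inE.
  by case/connect_pair_cons => [->//|[]|[_ ->]]; rewrite ?orbT // -/e au.
apply: old; apply/subset_leq_card/subsetP => b; rewrite !inE.
by case/connect_pair_cons => [//|[]|[]]; rewrite -/e ?au ?av.
Qed.

End Counting.

Section Strands.

Variables (L : finType) (F : code L).

Definition label (d : edge_end F) : L :=
  tnth (in_tuple (vertex_at (tag d))) (tagged d).

Lemma edge_ofE d : edge_of d = strand F (label d).
Proof. by []. Qed.

Lemma linked_sym : connect_sym (linked F).
Proof. exact: sym_connect_sym (pair_rel_sym _). Qed.

Lemma mem_strand a b : (b \in strand F a) = connect (linked F) a b.
Proof. by rewrite inE. Qed.

Lemma strand_refl a : a \in strand F a.
Proof. by rewrite inE. Qed.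

Lemma eq_strand a b : (strand F a == strand F b) = (b \in strand F a).
Proof.
apply/eqP/idP => [->|]; first exact: strand_refl.
rewrite inE => ab; apply/setP => c; rewrite !inE.
exact: same_connect linked_sym _ _ ab c.
Qed.

Lemma links_strand a l : l \in links F -> (l.1 \in strand F a) = (l.2 \in strand F a).
Proof.
case: l => b c lF; rewrite !inE /=; apply: same_connect_r; first exact: linked_sym.
by apply: connect1; rewrite /linked lF.
Qed.

Lemma count_ends (P : pred L) :
  count P (flatten (vertices F)) = #|[set d : edge_end F | P (label d)]|.
Proof.
rewrite count_flatten sumnE big_map big_tnth -sum1dep_card.
have E := @sig_big_dep nat 0 addn _ (fun x => 'I_(size (vertex_at x))) xpredT
  (fun x j => P (tnth (in_tuple (vertex_at x)) j)) (fun _ _ => 1).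
transitivity (\sum_(x < size (vertices F)) \sum_(j < size (vertex_at x)
    | P (tnth (in_tuple (vertex_at x)) j)) 1); last by rewrite E; apply: eq_bigl.
by apply: eq_bigr => x _; rewrite -sum1_count big_tnth.
Qed.

Lemma sum_count_mem (e : {set L}) (s : seq L) :
  \sum_(b in e) count_mem b s = count [in e] s.
Proof.
elim: s => [|x s IH] /=; first by rewrite big1.
rewrite big_split IH /=; congr addn.
have [xe|xe] := boolP (x \in e).
  rewrite (bigD1 x) //= eqxx big1 => [|b /andP[_ /negPf]]; first by [].
  by rewrite eq_sym => ->.
by rewrite big1 // => b be; case: eqP xe => // ->; rewrite be.
Qed.

Hypothesis two_endsF : two_ends F.
Hypothesis pureF : crossings F = [::].

(** Double counting of the labels of the strand over all nodes: each label occurs twice, an edge-end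
    is one occurrence, and a link has both of its arcs in the strand or none. *)
Lemma card_strand_ends a :
  #|[set d : edge_end F | label d \in strand F a]|
  + (count (fun l => l.1 \in strand F a) (links F)).*2 = #|strand F a|.*2.
Proof.
set e := strand F a.
have <- : count [in e] (flatten (nodes F)) = #|e|.*2.
  rewrite -sum_count_mem -muln2 -sum_nat_const; apply: eq_bigr => b _.
  by have /forallP/(_ b)/eqP := two_endsF.
rewrite /nodes pureF /= flatten_cat count_cat; congr addn.
  by rewrite count_ends.
have cE l : l \in links F -> (l.1 \in e) + (l.2 \in e) = (l.1 \in e).*2.
  by move=> /links_strand->; rewrite addnn.
rewrite !flatten_cat !count_cat.
have cp ls : {subset ls <= links F} -> count [in e] (flatten (map (@pair_seq L) ls))
    = (count (fun l => l.1 \in e) ls).*2.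
  elim: ls => //= l ls IH sub; rewrite IH ?addn0 => [|l' l'ls].
    by rewrite doubleD -cE ?addnA // sub ?mem_head.
  by apply: sub; rewrite inE l'ls orbT.
have -> := cp (bars F) _; last by move=> l lF; rewrite /links mem_cat lF.
have -> := cp (points F) _; last by move=> l lF; rewrite /links !mem_cat lF orbT.
have lE : links F = bars F ++ points F ++ flatten [seq
  (let: (sw, se, ne, nw) := q in [:: (sw, ne); (se, nw)]) | q <- virtuals F] by [].
have vl q : q \in virtuals F -> let: (sw, se, ne, nw) := q in
    (sw, ne) \in links F /\ (se, nw) \in links F.
  case: q => [[[sw se] ne] nw] qF.
  have sub l : l \in [:: (sw, ne); (se, nw)] -> l \in links F.
    move=> lq; rewrite lE !mem_cat; apply/orP; right; apply/orP; right.
    by apply/flatten_mapP; exists (sw, se, ne, nw).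
  by split; apply: sub; rewrite !inE eqxx ?orbT.
rewrite !doubleD [RHS]addnC -addnA; congr (_ + (_ + _)).
elim: (virtuals F) vl => //= [[[[sw se] ne] nw]] qs IH vl.
have [/cE + /cE] := vl _ (mem_head _ _); rewrite /= => E1 E2.
rewrite !doubleD IH => [|q qqs]; last by apply: vl; rewrite inE qqs orbT.
by lia.
Qed.

(** With n ends, m arcs and k links, n + 2k = 2m and m <= k + 1, so n is even and at most 2; it is
    positive because an edge has an end. *)
Lemma edge_two_ends a : strand F a \in edges F ->
  #|[set d : edge_end F | label d \in strand F a]| = 2.
Proof.
move=> /imsetP[d _ da].
have d0 : 0 < #|[set d : edge_end F | label d \in strand F a]|.
  by apply/card_gt0P; exists d; rewrite inE da edge_ofE strand_refl.
have := card_strand_ends a; have := card_component (links F) a.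
rewrite -/(linked F) -/(strand F a).
have -> : count (fun l => connect (linked F) a l.1) (links F)
    = count (fun l => l.1 \in strand F a) (links F).
  by apply: eq_count => l; rewrite mem_strand.
move: d0; set n := #|_|; set m := #|_|; set k := count _ _ => n0.
by rewrite -!muln2; lia.
Qed.

Lemma edge_ends (e : {set L}) : e \in edges F ->
  exists d1 d2 : edge_end F, d1 != d2 /\
    forall d, (edge_of d == e) = (d == d1) || (d == d2).
Proof.
move=> eF; have /imsetP[d0 _ e0] := eF.
have /edge_two_ends/eqP/cards2P[d1 [d2 [d12 E]]] : strand F (label d0) \in edges F.
  by rewrite -edge_ofE -e0.
exists d1, d2; split=> // d; move/setP/(_ d): E; rewrite in_set in_set2 => <-.
by rewrite e0 !edge_ofE [LHS]eq_sym eq_strand.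
Qed.

Lemma compatP (X : finType) (c : L -> X) :
  reflect (forall a b, b \in strand F a -> c a = c b)
    (all (fun l => c l.1 == c l.2) (links F)).
Proof.
apply: (iffP allP) => [cl a b|cs l lF]; last first.
  by apply/eqP/cs; rewrite -(links_strand _ lF) strand_refl.
rewrite inE => /connectP[p]; elim: p a => [|a' p IH] a /=; first by move=> _ ->.
case/andP => aa' /IH{}IH /IH <-.
by move: aa' => /orP[]/cl/eqP.
Qed.

End Strands.

Local Open Scope ring_scope.

(** With F the weight of a band and G that of its absence, this produces the sum over spanning
    subgraphs. *)
Lemma prodD_subset (R : comPzSemiRingType) (S : finType) (E : {set S}) (F G : S -> R) :
  \prod_(s in E) (F s + G s)
  = \sum_(B : {set S} | B \subset E) (\prod_(s in B) F s * \prod_(s in E :\: B) G s).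
Proof.
transitivity (\prod_(s in E) \sum_(c : bool) (if c then F s else G s)).
  by apply: eq_bigr => s _; rewrite big_bool.
rewrite (big_distr_big false) (reindex (fun B : {set S} => [ffun s => s \in B])) /=;
  last first.
  exists (fun f : {ffun S -> bool} => [set s | f s]) => [B|f] _.
    by apply/setP => s; rewrite inE ffunE.
  by apply/ffunP => s; rewrite ffunE inE.
apply: eq_big => [B|B BE].
  apply/pffun_onP/subsetP => [[] /subsetP BE _ s sB|BE].
    by apply: BE; rewrite inE ffunE sB.
  by split=> //; apply/subsetP => s; rewrite inE ffunE; case sB: (s \in B) => // _; apply: BE.
move: BE => /pffun_onP[/subsetP BE _].
have {}BE : B \subset E by apply/subsetP => s sB; apply: BE; rewrite inE ffunE sB.
rewrite (big_setID B) /= (setIidPr BE); congr (_ * _).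
  by apply: eq_bigr => s sB; rewrite ffunE sB.
by apply: eq_bigr => s; rewrite inE ffunE => /andP[/negPf->].
Qed.

(** Distributivity with index types that vary with x: one colouring at each vertex is the same as
    one colouring of all edge-ends. *)
Lemma prod_sum_tagged (R : pzSemiRingType) (V I : finType) (n : V -> nat)
    (F : forall x, {ffun 'I_(n x) -> I} -> R) :
  \prod_x \sum_(f : {ffun 'I_(n x) -> I}) F x f
  = \sum_(g : {ffun {x : V & 'I_(n x)} -> I})
      \prod_x F x [ffun j => g (Tagged (fun x => 'I_(n x)) j)].
Proof.
pose T_ x : finType := {ffun 'I_(n x) -> I}.
pose P_ x : {ffun T_ x -> R} := finfun (F x).
transitivity (\sum_(t : fprod T_) \prod_x P_ x (t x)).
  transitivity (\sum_(g in family (tagged_with T_)) \prod_x untag 0 (P_ x) (g x)).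
    rewrite -(bigA_distr_big_dep (fun x => tagged_with T_ x)
                (fun x g => untag 0 (P_ x) g)).
    apply: eq_bigr => x _.
    by rewrite -(big_tag P_); apply: eq_bigr => f _; rewrite ffunE.
  exact/esym/big_fprod.
rewrite (reindex (fun g : {ffun {x : V & 'I_(n x)} -> I} =>
   fprod_of_fun (fun x => [ffun j => g (Tagged (fun x => 'I_(n x)) j)] : T_ x))) /=.
  by apply: eq_bigr => g _; apply: eq_bigr => x _; rewrite fprodE ffunE.
exists (fun t : fprod T_ => [ffun d : {x : V & 'I_(n x)} => t (tag d) (tagged d)]) => [g|t] _.
  by apply/ffunP => -[x j]; rewrite ffunE fprodE ffunE.
by apply/fprodP => x; rewrite fprodE; apply/ffunP => j; rewrite !ffunE.
Qed.

(** * The vertex model *)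

(* A Frobenius algebra with an orthonormal basis [fbasis] of its traceless part;
   [fsign x] is the weight of a bar on an arc coloured x. *)
Record frobenius (K : fieldType) (X : finType) (y : K) := Frobenius {
  falg :> pzRingType;
  iota : {rmorphism K -> falg};
  ftr : {additive falg -> K};
  fbasis : X -> falg;
  fsign : X -> K;
  iotaC : forall k u, iota k * u = u * iota k;
  ftrZ : forall k u, ftr (iota k * u) = k * ftr u;
  ftrC : forall u v, ftr (u * v) = ftr (v * u);
  ftr1 : ftr 1 = -1;
  fbasis_tr : forall x, ftr (fbasis x) = 0;
  fbasis_on : forall x x', ftr (fbasis x * fbasis x') = (x == x')%:R;
  fbasis_proj : forall u,
    \sum_x iota (ftr (fbasis x * u)) * fbasis x = u + iota (ftr u);
  fbasis_sq : \sum_x fbasis x * fbasis x = iota (y + 1)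
}.

Section Algebra.

Variables (K : fieldType) (X : finType) (y : K) (A : frobenius X y).

Local Notation tr := (ftr A).
Local Notation b := (@fbasis _ _ _ A).
Local Notation i := (iota A).

Lemma ftr_iota k : tr (i k) = - k.
Proof. by rewrite -[i k]mulr1 ftrZ ftr1 mulrN1. Qed.

(** This and the next two lemmas are the contraction rules for a repeated basis element: one factor
    under a trace, both under traces, both adjacent in a word. *)
Lemma sum_tr_mul (u p s : A) :
  \sum_x i (tr (u * b x)) * (p * b x * s) = p * (u + i (tr u)) * s.
Proof.
rewrite -fbasis_proj mulr_sumr mulr_suml; apply: eq_bigr => x _.
by rewrite ftrC iotaC -!mulrA iotaC -!mulrA.
Qed.

Lemma sum_tr_tr (u v : A) :
  \sum_x tr (u * b x) * tr (b x * v) = tr (u * v) + tr u * tr v.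
Proof.
have := congr1 tr (sum_tr_mul u 1 v).
rewrite raddf_sum !mul1r mulrDl raddfD ftrZ => <-.
by apply: eq_bigr => x _; rewrite mul1r ftrZ.
Qed.

Lemma sum_mul_mul (p s : A) :
  \sum_x p * b x * b x * s = i (y + 1) * (p * s).
Proof.
rewrite mulrA iotaC -fbasis_sq mulr_sumr mulr_suml.
by apply: eq_bigr => x _; rewrite !mulrA.
Qed.

(* The strand coloured q before and q' after the crossing; e is a or a^-1, see
   [over_wt_Theta]. *)
Definition Theta (e : K) (x q q' : A) : A :=
  i (e * tr (x * q')) * q + i (e^-1 * tr (q * x)) * q' + q * x * q'
  + i (tr (q * x * q')) + i (tr x) * (q * q').

Definition scal (k : K) (u : A) : A := i k * u.

Lemma scal_mull k u v : scal k u * v = scal k (u * v).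
Proof. by rewrite /scal mulrA. Qed.

Lemma scal_mulr k u v : u * scal k v = scal k (u * v).
Proof. by rewrite /scal !mulrA iotaC. Qed.

Lemma scal_scal k l u : scal k (scal l u) = scal (k * l) u.
Proof. by rewrite /scal mulrA rmorphM. Qed.

Lemma scalD k u v : scal k (u + v) = scal k u + scal k v.
Proof. exact: mulrDr. Qed.

Lemma scal_iota k : i k = scal k 1.
Proof. by rewrite /scal mulr1. Qed.

(* Identities in the noncommutative ring A are checked by comparing, with [field],
   the coefficients of a list of words. *)
Definition lincomb (w : seq A) (c : nat -> K) : A :=
  \sum_(j < size w) scal (c j) w`_j.

Lemma lincombD w c d :
  lincomb w c + lincomb w d = lincomb w (fun j => c j + d j).
Proof.
by rewrite -big_split; apply: eq_bigr => j _; rewrite /scal rmorphD mulrDl.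
Qed.

Lemma lincomb_at w n k : (n < size w)%N ->
  scal k w`_n = lincomb w (fun j => if j == n then k else 0).
Proof.
move=> nw; rewrite /lincomb (bigD1 (Ordinal nw)) //= eqxx big1 ?addr0 // => j.
by rewrite -val_eqE /= => /negbTE->; rewrite /scal rmorph0 mul0r.
Qed.

(** The left factor is the general shape of an expression linear in its last letter [b r], the right
    one of an expression linear in its first letter; two consecutive [Theta] have these shapes. The
    nine products are contracted one by one. *)
Lemma sum_contract (u u' P1 P2 S1 S2 v v' : A) :
  \sum_r (i (tr (u * b r)) * P1 + P2 * b r + i (tr (u' * b r)))
         * (b r * S1 + i (tr (b r * v)) * S2 + i (tr (b r * v')))
  = P1 * (u + i (tr u)) * S1 + i (tr (u * v) + tr u * tr v) * (P1 * S2)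
    + i (tr (u * v') + tr u * tr v') * P1
    + (i (y + 1) * (P2 * S1) + P2 * (v + i (tr v)) * S2
       + P2 * (v' + i (tr v')))
    + ((u' + i (tr u')) * S1 + i (tr (u' * v) + tr u' * tr v) * S2
       + i (tr (u' * v') + tr u' * tr v')).
Proof.
under eq_bigr => r _ do rewrite !mulrDl !mulrDr !addrA.
rewrite !big_split /= -!addrA.
have E1 w P S : \sum_r i (tr (w * b r)) * P * (b r * S) = P * (w + i (tr w)) * S.
  by rewrite -sum_tr_mul; apply: eq_bigr => r _; rewrite !mulrA.
have E2 w P S : \sum_r P * b r * (i (tr (b r * w)) * S) = P * (w + i (tr w)) * S.
  rewrite -sum_tr_mul; apply: eq_bigr => r _.
  by rewrite mulrA -iotaC ftrC !mulrA.
have E3 w w' P S : \sum_r i (tr (w * b r)) * P * (i (tr (b r * w')) * S)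
    = i (tr (w * w') + tr w * tr w') * (P * S).
  rewrite -sum_tr_tr rmorph_sum mulr_suml; apply: eq_bigr => r _.
  by rewrite rmorphM /= !mulrA -(mulrA _ P) -(iotaC _ P) !mulrA.
have E4 (P S : A) : \sum_r P * b r * (b r * S) = i (y + 1) * (P * S).
  by rewrite -sum_mul_mul; apply: eq_bigr => r _; rewrite !mulrA.
congr (_ + (_ + (_ + (_ + (_ + (_ + (_ + (_ + _)))))))).
- exact: E1.
- exact: E3.
- by have := E3 u v' P1 1; rewrite mulr1 => <-; under [RHS]eq_bigr do rewrite mulr1.
- exact: E4.
- exact: E2.
- by have := E2 v' P2 1; rewrite mulr1 => <-; under [RHS]eq_bigr do rewrite mulr1.
- by have := E1 u' 1 S1; rewrite mul1r => <-; under [RHS]eq_bigr do rewrite mulr1.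
- by have := E3 u' v 1 S2; rewrite mul1r => <-; under [RHS]eq_bigr do rewrite mulr1.
- have := E3 u' v' 1 1; rewrite !mulr1 => <-.
  by under [RHS]eq_bigr do rewrite !mulr1.
Qed.

Lemma sum_mul_contract (S1 S2 v v' : A) :
  \sum_r b r * (b r * S1 + i (tr (b r * v)) * S2 + i (tr (b r * v')))
  = i (y + 1) * S1 + (v + i (tr v)) * S2 + (v' + i (tr v')).
Proof.
have := sum_contract 0 0 0 1 S1 S2 v v'.
rewrite !(mul0r, raddf0, add0r, mul1r, mulr0, addr0) => <-.
by apply: eq_bigr => r _; rewrite !(mul0r, raddf0, add0r, mul1r, addr0).
Qed.

(** Brings [Theta] into the shape of the right factor of [sum_contract]. *)
Lemma Theta_linr e v r q' :
  Theta e v (b r) q'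
  = b r * (i (e * tr (v * q')) + v * q' + i (tr v) * q')
    + i (tr (b r * v)) * (i e^-1 * q') + i (tr (b r * (v * q'))).
Proof.
have -> : i (tr (b r * v)) * (i e^-1 * q') = i (e^-1 * tr (b r * v)) * q'.
  by rewrite mulrA -rmorphM [e^-1 * _]mulrC.
have -> : b r * (i (e * tr (v * q')) + v * q' + i (tr v) * q')
    = i (e * tr (v * q')) * b r + b r * v * q' + i (tr v) * (b r * q').
  by rewrite !mulrDr -iotaC mulrA (mulrA (b r) (i _)) -(iotaC (tr v)) -(mulrA (i _)).
by rewrite /Theta !(mulrA (b r)) [LHS](ACl (1*3*5*2*4)).
Qed.

(** A strand that passes x and then v passes the product x v. After contraction both sides are
    combinations of eight words; for instance q x v q' gets the coefficient e + e^-1 + y + 3, which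
    is 1 by the relation between y and e. *)
Lemma Theta_mul e x v q q' : e != 0 -> y = - e - 2 - e^-1 -> tr x = 0 ->
  \sum_r Theta e x q (b r) * Theta e v (b r) q' = Theta e (x * v) q q'.
Proof.
move=> e0 ye x0.
pose P1 := i e * q; pose P2 := i (e^-1 * tr (q * x)) + q * x.
under eq_bigr => r _.
  have -> : Theta e x q (b r)
      = i (tr (x * b r)) * P1 + P2 * b r + i (tr (q * x * b r)).
    rewrite /Theta x0 rmorph0 mul0r addr0 /P1 /P2 mulrDl !addrA.
    by rewrite mulrA -rmorphM [e * _]mulrC.
  rewrite (Theta_linr e v r q').
  over.
rewrite sum_contract x0 rmorph0 addr0 mul0r addr0 mul0r addr0.
rewrite /Theta /P1 /P2.
rewrite !scal_iota.
do ![rewrite ?(mulrDl, mulrDr, scal_mull, scal_mulr, scal_scal, mul1r, mulr1, scalD)].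
rewrite -!mulrA.
(* The traces now become independent scalars, and coefficients of words are compared. *)
move: (tr (v * q')) (tr v) (tr (x * v)) (tr (x * (v * q'))) (tr (q * x))
  (tr (q * (x * v))) (tr (q * (x * (v * q')))) => t1 t2 t3 t4 t5 t6 t7.
pose w := [:: q * (x * (v * q')); q * x; v * q'; 1; q * q'; q; q'; q * (x * q')].
have W n k := @lincomb_at w n k.
rewrite !(W 0, W 1, W 2, W 3, W 4, W 5, W 6, W 7)%N //.
(* The leading word also occurs bare and has to be given the coefficient 1 by hand. *)
have W0 : q * (x * (v * q')) = lincomb w (fun j => (j == 0%N)%:R).
  rewrite -[LHS]mul1r -(rmorph1 i) -/(scal _ _) (W 0%N) //.
  by apply: eq_bigr => j _; case: eqP.
rewrite W0 !lincombD; apply: eq_bigr => j _; congr (scal _ _).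
by case: j; do 8?[case] => //= _; rewrite ?ye; field.
Qed.

(** A strand that passes nothing keeps its colour: the terms q x q' and tr x * (q q') cancel because
    tr 1 = -1. *)
Lemma Theta1 e (x x' : X) : Theta e 1 (b x) (b x') = i (x == x')%:R.
Proof.
rewrite /Theta !mul1r !mulr1 !fbasis_tr !mulr0 !rmorph0 !mul0r !add0r ftr1.
by rewrite rmorphN rmorph1 mulN1r addrC addKr fbasis_on.
Qed.

(** Cyclicity of the trace. In a picture U lies on one side of the strand and L on the other, and
    the strand may be pushed from U across to L; this symmetry is move IV. *)
Lemma tr_Theta e U L q q' :
  tr (Theta e U q q' * L) = tr (Theta e L q' q * U).
Proof.
rewrite /Theta !mulrDl !raddfD /= -!mulrA !ftrZ.
rewrite (ftrC L q) (ftrC q' U) (ftrC q' (L * (q * U))) -!mulrA.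
rewrite (ftrC L (q * _)) (ftrC q' (L * q)) -!mulrA (ftrC L (q * _)).
by rewrite (ftrC q' (q * U)) -!mulrA; ring.
Qed.

(** The transfer matrix of a strand passing the edges us: its colours between consecutive edges are
    summed over, those at its ends are x and x'. *)
Fixpoint tpath (e : K) (us : seq X) (x x' : X) : A :=
  if us is u :: us' then \sum_r Theta e (b u) (b x) (b r) * tpath e us' r x'
  else i (x == x')%:R.

Definition word (us : seq X) : A := \prod_(u <- us) b u.

Lemma tpathE e us x x' : e != 0 -> y = - e - 2 - e^-1 ->
  tpath e us x x' = Theta e (word us) (b x) (b x').
Proof.
move=> e0 ye; elim: us x => [|u us IH] x /=; first by rewrite /word big_nil Theta1.
rewrite /word big_cons -Theta_mul ?fbasis_tr //.
by apply: eq_bigr => r _; rewrite IH.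
Qed.

(* A half twist of k strands acts on words of length k as (- e) ^+ k times this
   map, see [half_twist_sumE]. *)
Definition twist (e : K) (U : A) : A :=
  i (- e^-1) * (U + i (tr U)) + i (- tr U).

(** The effect of one more strand, which passes the strands already twisted. The shape of [twist] is
    the one that this step reproduces up to the factor - e. *)
Lemma twist_step e U (x : X) : e != 0 -> y = - e - 2 - e^-1 ->
  \sum_r b r * Theta e (twist e U) (b r) (b x) = i (- e) * twist e (U * b x).
Proof.
move=> e0 ye; set q' := b x.
have tw : tr (twist e U) = tr U.
  by rewrite /twist !raddfD /= ftrZ raddfD /= !ftr_iota subrr mulr0 add0r opprK.
under eq_bigr do rewrite Theta_linr.
rewrite sum_mul_contract tw /twist !scal_iota.
do ![rewrite ?(mulrDl, mulrDr, scal_mull, scal_mulr, scal_scal, mul1r, mulr1, scalD)].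
rewrite !raddfD /= /scal !ftrZ fbasis_tr -![i _ * _]/(scal _ _).
move: (tr (U * q')) (tr U) => t1 t2.
pose w := [:: U * q'; q'; 1].
have W n k := @lincomb_at w n k.
rewrite !(W 0, W 1, W 2)%N // !lincombD.
by apply: eq_bigr => -[[|[|[]]] //=] _ _; congr (scal _ _); rewrite ye; field.
Qed.

(** On the traceless part [twist e] is multiplication by - e^-1, and on scalars it is the identity.
    These two parts are orthogonal under the trace, so parameters e and e^-1 cancel. *)
Lemma tr_twist e U L : e != 0 -> tr (twist e U * twist e^-1 L) = tr (U * L).
Proof.
move=> e0; rewrite /twist !scal_iota invrK.
do ![rewrite ?(mulrDl, mulrDr, scal_mull, scal_mulr, scal_scal, mul1r, mulr1, scalD)].
rewrite !raddfD /= /scal !ftrZ ftr1.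
by field.
Qed.

End Algebra.

Lemma relabel_comp (L L' L'' : Type) (f : L -> L') (g : L' -> L'') (E : code L) :
  relabel g (relabel f E) = relabel (g \o f) E.
Proof.
have Q : quad_map g \o quad_map f =1 quad_map (g \o f) by case=> [[[]]].
have P : pair_map g \o pair_map f =1 pair_map (g \o f) by case.
rewrite /relabel /= -!map_comp !(eq_map Q) !(eq_map P); congr Code.
by apply: eq_map => v /=; rewrite map_comp.
Qed.

Lemma eq_relabel (L L' : Type) (f g : L -> L') (E : code L) :
  f =1 g -> relabel f E = relabel g E.
Proof.
move=> fg.
have Q : quad_map f =1 quad_map g by case=> [[[? ?] ?] ?]; rewrite /= !fg.
have P : pair_map f =1 pair_map g by case=> ? ?; rewrite /pair_map /= !fg.
rewrite /relabel /= !(eq_map Q) !(eq_map P); congr Code.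
by apply: eq_map => v; exact: eq_map.
Qed.

Lemma relabel_join (L L' : Type) (f : L -> L') (E F : code L) :
  relabel f (join_codes E F) = join_codes (relabel f E) (relabel f F).
Proof. by rewrite /relabel /join_codes /= !map_cat. Qed.

Lemma sum_ffun_sum (V : nmodType) (X L L' : finType) (F : {ffun L + L' -> X} -> V) :
  \sum_f F f = \sum_(g : {ffun L -> X}) \sum_(h : {ffun L' -> X})
    F [ffun s => match s with inl l => g l | inr l => h l end].
Proof.
rewrite pair_big /=.
rewrite (reindex_onto (fun p : {ffun L -> X} * {ffun L' -> X} =>
   [ffun s => match s with inl l => p.1 l | inr l => p.2 l end])
  (fun f => ([ffun l => f (inl l)], [ffun l => f (inr l)]))) /=; last first.
  by move=> f _; apply/ffunP => -[l|l]; rewrite !ffunE.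
apply: eq_bigl => -[g h] /=; apply/eqP; congr pair.
  by apply/ffunP => l; rewrite !ffunE.
by apply/ffunP => l; rewrite !ffunE.
Qed.

Section Model.

Variables (K : fieldType) (X : finType) (y : K) (A : frobenius X y) (a : K).

Local Notation tr := (ftr A).
Local Notation b := (@fbasis _ _ _ A).

Definition delta (x x' : X) : K := (x == x')%:R.

Definition vertex_wt (v : seq X) : K := tr (word A v).

Definition crossing_wt (q : quad X) : K :=
  let: (sw, se, ne, nw) := q in
  a * (delta sw nw * delta se ne) + a^-1 * (delta sw se * delta nw ne)
  + vertex_wt [:: sw; se; ne; nw].

Definition virtual_wt (q : quad X) : K :=
  let: (sw, se, ne, nw) := q in delta sw ne * delta se nw.

Definition point_wt (p : X * X) : K := delta p.1 p.2.

Definition bar_wt (p : X * X) : K := fsign A p.1 * point_wt p.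

Definition wt (F : code X) : K :=
  \prod_(v <- vertices F) vertex_wt v * \prod_(q <- crossings F) crossing_wt q
  * \prod_(q <- virtuals F) virtual_wt q * \prod_(p <- bars F) bar_wt p
  * \prod_(p <- points F) point_wt p.

Definition Zsum (L : finType) (E : code L) : K :=
  \sum_(c : {ffun L -> X}) wt (relabel c E).

Lemma deltaC x x' : delta x x' = delta x' x.
Proof. by rewrite /delta eq_sym. Qed.

Lemma wt_join E F : wt (join_codes E F) = wt E * wt F.
Proof. by rewrite /wt /= !big_cat /=; ring. Qed.

Lemma vertex_wt_rot v : vertex_wt (rot 1 v) = vertex_wt v.
Proof.
case: v => // x v; rewrite rot1_cons -cats1 /vertex_wt /word big_cat big_seq1.
by rewrite big_cons ftrC.
Qed.

Lemma crossing_wt_rot2 sw se ne nw :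
  crossing_wt (ne, nw, sw, se) = crossing_wt (sw, se, ne, nw).
Proof.
rewrite /crossing_wt -(vertex_wt_rot [:: sw; _; _; _]) -(vertex_wt_rot (rot _ _)).
by rewrite (deltaC ne se) (deltaC nw sw) (deltaC ne nw) (deltaC se sw); ring.
Qed.

Lemma Zsum_reindex (L L' : finType) (f : L -> L') (E : code L) : bijective f ->
  Zsum (relabel f E) = Zsum E.
Proof.
case=> g fK gK; rewrite /Zsum.
rewrite (reindex_onto (fun c : {ffun L -> X} => [ffun l => c (g l)])
   (fun c => [ffun l => c (f l)])) /=; last first.
  by move=> c _; apply/ffunP => l; rewrite !ffunE gK.
apply: eq_big => [c|c _].
  by apply/eqP/ffunP => l; rewrite !ffunE fK.
by rewrite relabel_comp; congr wt; apply: eq_relabel => l /=; rewrite ffunE fK.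
Qed.

Lemma Zsum_same (L L' : finType) (E : code L) (E' : code L') :
  same_diagram E E' -> Zsum E = Zsum E'.
Proof.
elim=> {L L' E E'}.
- by [].
- by move=> L L' E E' _ ->.
- by move=> L L' L'' E E' E'' _ -> _ ->.
- by move=> L L' f E /Zsum_reindex->.
- move=> L [vs cs rs bs ps] [vs' cs' rs' bs' ps'] /= Ev Ec Er Eb Ep.
  apply: eq_bigr => c _; rewrite /wt /=.
  by congr (_ * _ * _ * _ * _); apply: perm_big; apply: perm_map.
- move=> L v vs cs rs bs ps; apply: eq_bigr => c _; rewrite /wt /= !big_cons.
  by rewrite map_rot vertex_wt_rot.
- move=> L sw se ne nw vs cs rs bs ps; apply: eq_bigr => c _.
  by rewrite /wt /= !big_cons crossing_wt_rot2.
- move=> L sw se ne nw vs cs rs bs ps; apply: eq_bigr => c _.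
  by rewrite /wt /= !big_cons /virtual_wt (deltaC (c sw)) (mulrC (delta (c se) _)).
- move=> L x x' vs cs rs bs ps; apply: eq_bigr => c _; rewrite /wt /= !big_cons.
  congr (_ * (_ * _) * _); rewrite /bar_wt /point_wt /= deltaC /delta.
  by case: eqP => [->|]; rewrite ?mulr0.
- move=> L x x' vs cs rs bs ps; apply: eq_bigr => c _; rewrite /wt /= !big_cons.
  by rewrite /point_wt /= deltaC.
(* The forgotten point forces None and Some x to have equal colours, so the colourings that
   contribute factor through [odflt x]. *)
move=> L x vs cs rs bs ps; set E := Code vs cs rs bs ps.
transitivity (\sum_(c : {ffun option L -> X} | c None == c (Some x))
                wt (relabel c E)).
  rewrite big_mkcond; apply: eq_bigr => c _; rewrite /wt /= big_cons.
  rewrite /point_wt /delta /=; case: eqP => _; rewrite ?mul1r //.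
  by rewrite mul0r !mulr0.
rewrite (reindex_onto (fun c : {ffun L -> X} => [ffun o => c (odflt x o)])
   (fun c => [ffun l => c (Some l)])) /=; last first.
  move=> c /eqP cx; apply/ffunP => -[l|]; rewrite !ffunE //=.
apply: eq_big => [c|c _].
  by rewrite !ffunE eqxx; apply/eqP/ffunP => l; rewrite !ffunE.
by rewrite relabel_comp; congr wt; apply: eq_relabel => l /=; rewrite ffunE.
Qed.

Definition Ztangle (L : finType) (T : tangle L) (s : seq X) : K :=
  \sum_(c : {ffun L -> X} | map c (ends T) == s) wt (relabel c T).

Lemma prod_delta_zip (s s' : seq X) : size s = size s' ->
  \prod_(p <- zip s s') point_wt p = (s == s')%:R.
Proof.
elim: s s' => [|x s IH] [|x' s'] //=; first by rewrite big_nil.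
move=> [/IH E]; rewrite big_cons E eqseq_cons /point_wt /delta /=.
by case: eqP; rewrite ?mul1r ?mul0r.
Qed.

(** Locality: the regular points created by [glue] force equal colours on both sides of the circle,
    so the disk enters only through the colours on its boundary. *)
Lemma Zsum_glue (L L' : finType) (O : tangle L) (T : tangle L') :
  size (ends O) = size (ends T) ->
  Zsum (glue O T) = \sum_(c : {ffun L -> X})
                       wt (relabel c O) * Ztangle T (map c (ends O)).
Proof.
move=> sOT; rewrite /Zsum sum_ffun_sum; apply: eq_bigr => c _.
rewrite big_distrr [RHS]big_mkcond /=; apply: eq_bigr => d _.
rewrite !relabel_join !wt_join !relabel_comp.
set f := finfun _.
have -> : relabel (f \o inl) O = relabel c O.
  by apply: eq_relabel => l; rewrite /= ffunE.
have -> : relabel (f \o inr) T = relabel d T.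
  by apply: eq_relabel => l; rewrite /= ffunE.
rewrite /wt /= !big_nil !mul1r; set P := map (pair_map _) (zip _ _).
have -> : P = zip (map c (ends O)) (map d (ends T)).
  rewrite /P; elim: (ends O) (ends T) {sOT P} => [|l s IH] [|l' s'] //=.
  by rewrite IH /pair_map /= !ffunE.
rewrite prod_delta_zip ?size_map // eq_sym.
by case: eqP; rewrite ?mulr1 ?mulr0.
Qed.

Lemma Zsum_replaced (LT LT' : finType) (T : tangle LT) (T' : tangle LT')
    (E E' : twisted_diagram) (k : K) :
  (forall s, size s = size (ends T) -> Ztangle T s = k * Ztangle T' s) ->
  replaced T T' E E' -> Zsum E = k * Zsum E'.
Proof.
move=> TT' [L [O [sT sT' /Zsum_same-> /Zsum_same->]]].
rewrite !Zsum_glue // big_distrr; apply: eq_bigr => c _ /=.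
by rewrite TT' ?size_map // mulrCA.
Qed.

End Model.

(** Colourings as plain sequences: the arcs of a tangle can be summed one at a time, and words split
    or reversed, without dependent types. *)
Fixpoint nsum (V : nmodType) (X : finType) (n : nat) (H : seq X -> V) : V :=
  if n is n'.+1 then \sum_x nsum n' (fun t => H (x :: t)) else H [::].

Lemma nsumS (V : nmodType) (X : finType) n (H : seq X -> V) :
  nsum n.+1 H = \sum_x nsum n (fun t => H (x :: t)).
Proof. by []. Qed.

Lemma eq_nsum (V : nmodType) (X : finType) n (H H' : seq X -> V) :
  (forall t, size t = n -> H t = H' t) -> nsum n H = nsum n H'.
Proof.
elim: n H H' => [|n IH] H H' HH' /=; first exact: HH'.
by apply: eq_bigr => x _; apply: IH => t st; apply: HH'; rewrite /= st.
Qed.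

Lemma sum_ffun_nsum (V : nmodType) (X : finType) n (H : seq X -> V) :
  \sum_(c : {ffun 'I_n -> X}) H (codom c) = nsum n H.
Proof.
elim: n H => [|n IH] H /=.
  have c0 (c c' : {ffun 'I_0 -> X}) : c = c' by apply/ffunP => -[].
  have c1 : {ffun 'I_0 -> X} by apply: finfun => -[].
  rewrite (big_pred1 c1) => [|c]; last by rewrite (c0 c c1) /= eqxx.
  by congr H; apply: size0nil; rewrite size_codom card_ord.
under [RHS]eq_bigr do rewrite -IH.
rewrite pair_big /= (reindex_onto
  (fun p : X * {ffun 'I_n -> X} => [ffun j => oapp p.2 p.1 (unlift ord0 j)])
  (fun c : {ffun 'I_n.+1 -> X} => (c ord0, [ffun j => c (lift ord0 j)]))) /=.
  apply: eq_big => [[x c]|[x c] _] /=.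
    rewrite ffunE unlift_none /=; apply/eqP; congr pair.
    by apply/ffunP => j; rewrite !ffunE liftK.
  congr H; rewrite /codom /image_mem enum_ordSl /= ffunE unlift_none /=.
  by congr cons; rewrite -map_comp; apply: eq_map => j; rewrite /= ffunE liftK.
move=> c _; apply/ffunP => j; rewrite !ffunE.
by case: unliftP => [k|] -> /=; rewrite ?ffunE.
Qed.

Lemma nsum0 (V : nmodType) (X : finType) n :
  nsum n (fun _ : seq X => 0 : V) = 0.
Proof. by elim: n => //= n IH; rewrite big1. Qed.

(** Boundary arcs with prescribed colours s drop out, which leaves the sum over the m remaining
    arcs. *)
Lemma nsum_fix (V : nmodType) (X : finType) k m (s : seq X) (H : seq X -> V) :
  size s = k ->
  nsum (k + m) (fun t => if take k t == s then H t else 0)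
  = nsum m (fun t => H (s ++ t)).
Proof.
move<-; elim: s H => [|x s IH] H /=.
  by apply: eq_nsum => t _; rewrite take0 eqxx.
rewrite (bigD1 x) //= big1 ?addr0 => [|x' xx'].
  rewrite -(IH (fun t => H (x :: t))); apply: eq_nsum => t _.
  by rewrite eqseq_cons eqxx.
rewrite -[RHS](nsum0 _ X (size s + m)); apply: eq_nsum => t _.
by rewrite eqseq_cons (negPf xx').
Qed.

(** * Invariance of the state sum *)

Section Moves.

#[local] Arguments crossing_wt : simpl never.

Variables (K : fieldType) (X : finType) (y : K) (A : frobenius X y) (a : K).
Hypothesis a0 : a != 0.
Hypothesis ya : y = - a - 2 - a^-1.

Local Notation tr := (ftr A).
Local Notation b := (@fbasis _ _ _ A).
Local Notation i := (iota A).

Definition over_coef (over : bool) : K := if over then a else a^-1.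

Definition over_wt (over : bool) (p q r s : X) : K :=
  crossing_wt A a (crossing over p q r s).

Lemma over_coef0 over : over_coef over != 0.
Proof. by case: over; rewrite ?invr_eq0. Qed.

Lemma y_over_coef over : y = - over_coef over - 2 - (over_coef over)^-1.
Proof. by case: over; rewrite //= invrK ya; ring. Qed.

(** Seen from the strand p-r, passing under instead of over exchanges the two smoothings, hence a
    and a^-1; one parameter covers both cases. *)
Lemma over_wtE over p q r s :
  over_wt over p q r s = over_coef over * (delta K p s * delta K q r)
    + (over_coef over)^-1 * (delta K p q * delta K s r)
    + vertex_wt A [:: p; q; r; s].
Proof.
case: over => //=; rewrite /over_wt /crossing /crossing_wt invrK.
rewrite -(vertex_wt_rot A [:: p; _; _; _]) /= (deltaC _ p q) (deltaC _ r s).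
by ring.
Qed.

(** The last two terms of [Theta] vanish here, since [b s] and [b q] are traceless; they matter only
    when a strand passes a longer word. *)
Lemma over_wt_Theta over p q r s :
  over_wt over p q r s = tr (Theta (over_coef over) (b q) (b p) (b r) * b s).
Proof.
rewrite over_wtE /Theta !mulrDl !raddfD /= -!mulrA !ftrZ !fbasis_on !fbasis_tr.
rewrite /vertex_wt /word !big_cons big_nil mulr1 !mulr0 mul0r !addr0.
by rewrite -!/(delta K _ _) (deltaC _ r s); ring.
Qed.

Lemma over_wtN over p q r s : over_wt (~~ over) p q r s = over_wt over q r s p.
Proof.
rewrite !over_wtE -(vertex_wt_rot A [:: p; _; _; _]) /=.
have -> : over_coef (~~ over) = (over_coef over)^-1.
  by case: over; rewrite /= ?invrK.
by rewrite invrK (deltaC _ p q) (deltaC _ r s); ring.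
Qed.

Lemma over_wt_rot2 over p q r s : over_wt over r s p q = over_wt over p q r s.
Proof. by rewrite -over_wtN -over_wtN negbK. Qed.

(** In particular [Theta] of a traceless v is traceless, which is the condition under which
    [tr_proj] sums over the colour of an edge. *)
Lemma tr_Theta0 e v x x' : tr (Theta e v (b x) (b x')) = tr v * delta K x x'.
Proof.
rewrite -[Theta _ _ _ _]mulr1 tr_Theta Theta1 ftrZ /delta eq_sym mulrC.
by rewrite eq_sym.
Qed.

Lemma tr_proj (u v : A) : tr u = 0 ->
  \sum_x tr (u * b x) * tr (v * b x) = tr (u * v).
Proof.
move=> u0; transitivity (\sum_x tr (u * b x) * tr (b x * v)).
  by apply: eq_bigr => x _; rewrite (ftrC v).
by rewrite sum_tr_tr u0 mul0r addr0.
Qed.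

(** The sum over the edge colour s is [tr_proj], the sum over the strand colour r is [Theta_mul],
    and what remains is orthonormality. *)
Lemma bigon_sum over p q q' p' :
  \sum_r \sum_s over_wt over p q r s * over_wt over r q' p' s
  = delta K p p' * delta K q q'.
Proof.
set e := over_coef over.
transitivity (\sum_r tr (Theta e (b q) (b p) (b r) * Theta e (b q') (b r) (b p'))).
  apply: eq_bigr => r _; rewrite -tr_proj ?tr_Theta0 ?fbasis_tr ?mul0r //.
  by apply: eq_bigr => s _; rewrite !over_wt_Theta.
rewrite -raddf_sum Theta_mul ?over_coef0 ?fbasis_tr //; last exact: y_over_coef.
by rewrite tr_Theta0 fbasis_on mulrC.
Qed.

(** The three terms contribute e, then - (y + 1) e^-1, where a free loop counts the colours, and y +
    1 by [fbasis_sq]; their sum is e^-2. *)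
Lemma kink_sum over q r :
  \sum_p over_wt over p p q r = (over_coef over)^-1 ^+ 2 * delta K q r.
Proof.
have e0 := over_coef0 over; set e := over_coef over in e0 *.
have sq : \sum_(p : X) 1 = - (y + 1).
  have := congr1 tr (fbasis_sq A); rewrite raddf_sum /= ftr_iota => <-.
  by apply: eq_bigr => p _; rewrite fbasis_on eqxx.
under eq_bigr do rewrite over_wtE.
rewrite !big_split -/e /=.
have -> : \sum_p e * (delta K p r * delta K p q) = e * delta K q r.
  rewrite -big_distrr (bigD1 q) //= big1 => [|p /negPf pq].
    by rewrite /delta eqxx mulr1 addr0.
  by rewrite /delta pq mulr0.
have -> : \sum_(p : X) e^-1 * (delta K p p * delta K r q)
    = - (y + 1) * e^-1 * delta K q r.
  rewrite -sq !big_distrl /=; apply: eq_bigr => p _.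
  have -> : delta K p p = 1 by rewrite /delta eqxx.
  by rewrite (deltaC _ r) mulrA !mul1r mulr1.
have -> : \sum_p vertex_wt A [:: p; p; q; r] = (y + 1) * delta K q r.
  transitivity (tr (\sum_p b p * b p * (b q * b r))).
    rewrite (raddf_sum tr) /=; apply: eq_bigr => p _.
    by rewrite /vertex_wt /word !big_cons big_nil mulr1 !mulrA.
  by rewrite -mulr_suml fbasis_sq ftrZ fbasis_on.
by rewrite (y_over_coef over) -/e; field.
Qed.

Lemma sum_delta (x : X) (F : X -> K) :
  \sum_z delta K z x * F z = F x.
Proof.
rewrite (bigD1 x) //= big1 => [|z /negPf zx]; rewrite /delta.
  by rewrite eqxx mul1r addr0.
by rewrite zx mul0r.
Qed.

(** The strand passes the ends u and v of a four-valent vertex: [tr_proj] for u and v, [Theta_mul]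
    for t. *)
Lemma vertex_pass over p q q' p' r s :
  \sum_t \sum_u \sum_v
    over_wt over p q t u * over_wt over t q' p' v * vertex_wt A [:: u; v; r; s]
  = tr (Theta (over_coef over) (b q * b q') (b p) (b p') * (b r * b s)).
Proof.
set e := over_coef over.
rewrite -Theta_mul ?over_coef0 ?fbasis_tr //; last exact: y_over_coef.
rewrite mulr_suml (raddf_sum tr); apply: eq_bigr => t _ /=.
rewrite -!mulrA -tr_proj ?tr_Theta0 ?fbasis_tr ?mul0r //.
apply: eq_bigr => u _.
rewrite -!mulrA -[X in _ = _ * X]tr_proj ?tr_Theta0 ?fbasis_tr ?mul0r // big_distrr /=.
apply: eq_bigr => v _; rewrite !over_wt_Theta -/e -mulrA; congr (_ * (_ * _)).
by rewrite /vertex_wt /word !big_cons big_nil mulr1 mulrA ftrC -!mulrA.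
Qed.

(** Only the crossing of the other two strands is expanded. The resulting expression is invariant
    under the half turn of the hexagon of ends, by [tr_Theta] in the vertex term, and the half turn
    carries one side of the move to the other. *)
Lemma yang_baxter over over' p1 p2 p3 p4 p5 p6 :
  \sum_t \sum_u \sum_v
    over_wt over p1 p2 t u * over_wt over t p3 p4 v * over_wt over' u v p5 p6
  = \sum_t \sum_u \sum_v
    over_wt over p1 v t p6 * over_wt over t u p4 p5 * over_wt over' u v p2 p3.
Proof.
set e := over_coef over'.
(* The first smoothing is kept as it stands, the second is undone by move II, the third is a strand
   passing a vertex. *)
have split q1 q2 q3 q4 q5 q6 :
    \sum_t \sum_u \sum_v
      over_wt over q1 q2 t u * over_wt over t q3 q4 v * over_wt over' u v q5 q6
    = e * (\sum_t over_wt over q1 q2 t q6 * over_wt over t q3 q4 q5)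
      + e^-1 * (delta K q1 q4 * delta K q2 q3 * delta K q6 q5)
      + tr (Theta (over_coef over) (b q2 * b q3) (b q1) (b q4) * (b q5 * b q6)).
  under eq_bigr do under eq_bigr do under eq_bigr do rewrite (over_wtE over') -/e !mulrDr.
  under eq_bigr do under eq_bigr do rewrite !big_split.
  under eq_bigr do rewrite !big_split.
  rewrite !big_split /= vertex_pass; congr (_ + _ + _).
    rewrite big_distrr; apply: eq_bigr => t _ /=.
    rewrite -(sum_delta q6 (fun u => over_wt over q1 q2 t u)) mulr_suml.
    rewrite big_distrr; apply: eq_bigr => u _ /=.
    rewrite -(sum_delta q5 (fun v => over_wt over t q3 q4 v)) !big_distrr.
    by apply: eq_bigr => v _ /=; rewrite -/e; ring.
  rewrite -(bigon_sum over) mulr_suml big_distrr; apply: eq_bigr => t _ /=.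
  rewrite mulr_suml big_distrr; apply: eq_bigr => u _ /=.
  rewrite (bigD1 u) //= big1 => [|v /negPf vu].
    by have -> : delta K u u = 1; [rewrite /delta eqxx | ring].
  by have -> : delta K u v = 0; [rewrite /delta eq_sym vu | ring].
rewrite split.
transitivity (\sum_t \sum_u \sum_v
    over_wt over p4 p5 t u * over_wt over t p6 p1 v * over_wt over' u v p2 p3).
  rewrite split tr_Theta; congr (_ + _ + _); last first.
    by rewrite (deltaC _ p4) (deltaC _ p5) (deltaC _ p3); ring.
  congr (_ * _); apply: eq_bigr => t _.
  by rewrite (over_wt_rot2 _ p4) (over_wt_rot2 _ t) mulrC.
apply: eq_bigr => t _; apply: eq_bigr => u _; apply: eq_bigr => v _.
by rewrite (over_wt_rot2 over t p6 p1 v) (over_wt_rot2 over p4 p5 t u); ring.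
Qed.

(** The colour of arc 0 serves as the default of [nth], because [inord] sends labels out of range to
    0. *)
Lemma Ztangle_numbered n (T : tangle nat) s :
  Ztangle A a (numbered n T) s
  = nsum n.+1 (fun t => if t is x :: _ then
      if [seq nth x t j | j <- ends T] == s then wt A a (relabel (nth x t) T)
      else 0 else 0).
Proof.
rewrite -sum_ffun_nsum /Ztangle big_mkcond; apply: eq_bigr => c _.
have cE j : c (inord j) = nth (c ord0) (codom c) j.
  have [jn|nj] := ltnP j n.+1.
    rewrite /codom /image_mem (nth_map ord0) ?size_enum_ord //.
    by congr (c _); apply: val_inj; rewrite /= inordK // nth_enum_ord.
  rewrite nth_default ?size_codom ?card_ord //; congr (c _); apply: val_inj.
  by rewrite /inord /insubd insubF // ltnNge nj.
have {cE} cE j : c (inord j) = (if codom c is x :: _ then nth x (codom c) else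
    fun=> c ord0) j.
  by rewrite cE /codom /image_mem enum_ordSl.
rewrite /numbered /= relabel_comp -map_comp (eq_map cE) (eq_relabel _ cE).
by rewrite /codom /image_mem enum_ordSl.
Qed.

Lemma Ztangle_bigon s : size s = 4 ->
  Ztangle A a parallel_tangle s = Ztangle A a bigon_tangle s.
Proof.
case: s => [|p [|q [|q' [|p' []]]]] // _; rewrite !Ztangle_numbered.
transitivity (delta K p p' * delta K q q'); last first.
  rewrite -(bigon_sum true).
  transitivity (nsum (4 + 2) (fun t : seq X => if take 4 t == [:: p; q; q'; p']
    then over_wt true (nth p t 0) (nth p t 1) (nth p t 4) (nth p t 5)
         * over_wt true (nth p t 4) (nth p t 2) (nth p t 3) (nth p t 5) else 0)).
    by rewrite nsum_fix.
  apply: eq_nsum => -[|? [|? [|? [|? [|? [|? []]]]]]] //= _.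
  by rewrite /wt /= !big_cons !big_nil !mulr1 mul1r.
rewrite /= /wt /= !big_nil !mulr1.
transitivity (nsum (2 + 0) (fun t : seq X => if take 2 t == [:: p; q]
    then delta K (nth p t 0) p' * delta K (nth p t 1) q' else 0)); last first.
  by rewrite nsum_fix.
apply: eq_bigr => x _; apply: eq_bigr => x' _.
by rewrite /= !eqseq_cons !eqxx !andbT /delta;
  case: (x =P p) => [->|] //=; case: (x' =P q) => [->|] //=;
  do 2![case: eqP => _]; rewrite /= ?mulr1 ?mulr0.
Qed.

Lemma Ztangle_kink over s : size s = 2 ->
  Ztangle A a (kink_tangle over) s
  = (over_coef over)^-1 ^+ 2 * Ztangle A a straight_tangle s.
Proof.
case: s => [|q [|r []]] // _; rewrite !Ztangle_numbered.
transitivity ((over_coef over)^-1 ^+ 2 * delta K q r).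
  rewrite -kink_sum nsumS; apply: eq_bigr => x _.
  transitivity (nsum (2 + 0) (fun t : seq X => if take 2 t == [:: q; r]
    then over_wt over x x (nth x t 0) (nth x t 1) else 0)); last first.
    by rewrite nsum_fix.
  apply: eq_nsum => -[|? [|? []]] //= _.
  by rewrite /over_wt; case: over; rewrite /wt /= !big_cons !big_nil !mulr1 mul1r.
congr (_ * _).
transitivity (nsum (1 + 0) (fun t : seq X => if take 1 t == [:: q]
    then delta K (nth q t 0) r else 0)).
  by rewrite nsum_fix.
rewrite /= /wt /= !big_nil !mulr1; apply: eq_bigr => x _.
by rewrite !eqseq_cons !eqxx !andbT /delta; case: eqP => //= _; case: eqP.
Qed.

Lemma Ztangle_triangle h0 h1 h2 s : uniq [:: h0; h1; h2] -> size s = 6 ->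
  Ztangle A a (triangle_tangle h0 h1 h2) s
  = Ztangle A a (triangle_tangle' h0 h1 h2) s.
Proof.
move=> hu; case: s => [|p1 [|p2 [|p3 [|p4 [|p5 [|p6 []]]]]]] // _.
rewrite !Ztangle_numbered.
set o1 := (h1 < h0)%N; set o2 := (h2 < h0)%N; set o3 := (h2 < h1)%N.
transitivity (\sum_t \sum_u \sum_v
    over_wt o1 p1 p2 t u * over_wt o2 t p3 p4 v * over_wt o3 u v p5 p6).
  transitivity (nsum (6 + 3) (fun t : seq X =>
    if take 6 t == [:: p1; p2; p3; p4; p5; p6]
    then over_wt o1 (nth p1 t 0) (nth p1 t 1) (nth p1 t 6) (nth p1 t 7)
         * over_wt o2 (nth p1 t 6) (nth p1 t 2) (nth p1 t 3) (nth p1 t 8)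
         * over_wt o3 (nth p1 t 7) (nth p1 t 8) (nth p1 t 4) (nth p1 t 5)
    else 0)).
    apply: eq_nsum => -[|? [|? [|? [|? [|? [|? [|? [|? [|? []]]]]]]]]] //= _.
    rewrite -/o1 -/o2 -/o3 /over_wt.
    by case: o1; case: o2; case: o3;
      rewrite /wt /= !big_cons !big_nil !mulr1 mul1r !mulrA.
  by rewrite nsum_fix.
transitivity (\sum_t \sum_u \sum_v
    over_wt o1 t u p4 p5 * over_wt o2 p1 v t p6 * over_wt o3 p2 p3 u v); last first.
  transitivity (nsum (6 + 3) (fun t : seq X =>
    if take 6 t == [:: p1; p2; p3; p4; p5; p6]
    then over_wt o1 (nth p1 t 6) (nth p1 t 7) (nth p1 t 3) (nth p1 t 4)
         * over_wt o2 (nth p1 t 0) (nth p1 t 8) (nth p1 t 6) (nth p1 t 5)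
         * over_wt o3 (nth p1 t 1) (nth p1 t 2) (nth p1 t 7) (nth p1 t 8)
    else 0)).
    by rewrite nsum_fix.
  apply: eq_nsum => -[|? [|? [|? [|? [|? [|? [|? [|? [|? []]]]]]]]]] //= _.
  rewrite -/o1 -/o2 -/o3 /over_wt.
  by case: o1; case: o2; case: o3;
    rewrite /wt /= !big_cons !big_nil !mulr1 mul1r !mulrA.
(* If o1 = o2, strand 0 is the highest or the lowest one and [yang_baxter] applies directly. *)
have [o12|o12] := eqVneq o1 o2.
  rewrite -o12 yang_baxter; apply: eq_bigr => t _; apply: eq_bigr => u _.
  apply: eq_bigr => v _; rewrite (over_wt_rot2 o3 p2 p3 u v); ring.
(* Now strand 0 has the middle height, so strand 1 is extreme; quarter turns of the crossings let
   strand 1 play the role of strand 0. *)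
have o13 : o3 = ~~ o1.
  by move: hu o12; rewrite /o1 /o2 /o3 /=; clear; lia.
have o2E : o2 = ~~ o1 by case: (o1) (o2) o12 => -[].
rewrite o13 o2E.
have N p q r t : over_wt o1 p q r t = over_wt (~~ o1) q r t p.
  by rewrite -{1}[o1]negbK over_wtN.
have rot3 (F : X -> X -> X -> K) :
    \sum_t \sum_u \sum_v F u v t = \sum_t \sum_u \sum_v F t u v.
  by rewrite exchange_big; apply: eq_bigr => t _; exact: exchange_big.
transitivity (\sum_t \sum_u \sum_v over_wt (~~ o1) p2 v t p1
    * over_wt (~~ o1) t u p5 p6 * over_wt o1 u v p3 p4).
  rewrite -[RHS]rot3; do 3![apply: eq_bigr => ? _].
  by rewrite (N p1) (N _ _ p3); ring.
rewrite -yang_baxter -[LHS]rot3; do 3![apply: eq_bigr => ? _].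
by rewrite (N _ _ p6) (N _ _ p4) (over_wt_rot2 _ p1); ring.
Qed.

End Moves.

(** * Move IV: a strand passing the ends of a vertex *)

Lemma exchange_nsum (V : nmodType) (X : finType) n (H : X -> seq X -> V) :
  \sum_x nsum n (H x) = nsum n (fun t => \sum_x H x t).
Proof.
elim: n H => [|n IH] H //=; rewrite exchange_big; apply: eq_bigr => x _.
exact: IH.
Qed.

Lemma mulr_nsumr (R : pzRingType) (X : finType) n (k : R) (H : seq X -> R) :
  k * nsum n H = nsum n (fun t => k * H t).
Proof.
elim: n H => //= n IH H; rewrite mulr_sumr; apply: eq_bigr => x _; exact: IH.
Qed.

Lemma quad_map_crossing (L L' : Type) (f : L -> L') over p q r s :
  quad_map f (crossing over p q r s) = crossing over (f p) (f q) (f r) (f s).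
Proof. by case: over. Qed.

Lemma nth_codom (T : Type) n (x0 : T) (f : 'I_n -> T) (j : 'I_n) :
  nth x0 (codom f) j = f j.
Proof.
by rewrite /codom /image_mem (nth_map j) ?size_enum_ord // nth_ord_enum.
Qed.

Lemma nsum_eq (V : nmodType) (X : finType) n (s : seq X) (H : seq X -> V) :
  size s = n -> nsum n (fun t => if t == s then H t else 0) = H s.
Proof.
move=> ss; have := @nsum_fix V X n 0 s H ss; rewrite addn0 /= cats0 => <-.
by apply: eq_nsum => t st; rewrite take_oversize ?st.
Qed.

Section MoveIV.

Variables (K : fieldType) (X : finType) (y : K) (A : frobenius X y) (a : K).
Hypothesis a0 : a != 0.
Hypothesis ya : y = - a - 2 - a^-1.

Local Notation tr := (ftr A).
Local Notation b := (@fbasis _ _ _ A).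
Local Notation over_wt := (over_wt A a).
Local Notation over_coef := (over_coef a).

#[local] Arguments crossing_wt : simpl never.

Fixpoint strand_wt over (q : X) (qs us ps : seq X) : K :=
  match qs, us, ps with
  | r :: qs', u :: us', p :: ps' => over_wt over q u r p * strand_wt over r qs' us' ps'
  | _, _, _ => 1
  end.

Lemma strand_wtE over x0 q qs us ps k :
  size qs = k -> size us = k -> size ps = k ->
  \prod_(j < k) over_wt over (nth x0 (q :: qs) j) (nth x0 us j) (nth x0 qs j)
                  (nth x0 ps j)
  = strand_wt over q qs us ps.
Proof.
elim: k q qs us ps => [|k IH] q [|r qs] [|u us] [|p ps] //=.
  by rewrite big_ord0.
by move=> [sq] [su] [sp]; rewrite big_ord_recl /= IH.
Qed.

(** Summing over the colours ps at the vertex inserts the transfer matrix of the strand in place of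
    the word ps. In the induction V collects the ends already treated. *)
Lemma strand_sum over q us x (V W : A) :
  nsum (size us) (fun qs => if last q qs == x then
     nsum (size us) (fun ps => strand_wt over q qs us ps * tr (V * word A ps * W))
     else 0)
  = tr (V * tpath A (over_coef over) us q x * W).
Proof.
elim: us q V => [|u us IH] q V.
  rewrite /= /word big_nil mulr1 mul1r; case: eqP => _; rewrite ?mulr1 ?rmorph1 ?mulr1 //.
  by rewrite rmorph0 mulr0 mul0r raddf0.
rewrite /= mulr_sumr mulr_suml (raddf_sum tr); apply: eq_bigr => r _ /=.
transitivity (\sum_p over_wt over q u r p *
  tr (V * b p * tpath A (over_coef over) us r x * W)).
  under [RHS]eq_bigr do rewrite -IH.
  transitivity (\sum_p nsum (size us) (fun qs => if last r qs == x then
     nsum (size us) (fun ps => over_wt over q u r p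
       * (strand_wt over r qs us ps * tr (V * b p * word A ps * W))) else 0)).
    rewrite exchange_nsum; apply: eq_nsum => qs _; case: eqP => _; last by rewrite big1.
    apply: eq_bigr => p _; apply: eq_nsum => ps _.
    by rewrite mulrA /word big_cons !mulrA.
  apply: eq_bigr => p _; rewrite mulr_nsumr; apply: eq_nsum => qs _.
  by case: eqP => _; rewrite ?mulr0 // mulr_nsumr.
rewrite -!mulrA ftrC -!mulrA -tr_proj ?tr_Theta0 ?fbasis_tr ?mul0r //.
apply: eq_bigr => p _; rewrite over_wt_Theta; congr (_ * _).
by rewrite -!mulrA (mulrA V) ftrC -!mulrA.
Qed.

Lemma wt_strand_above over k m (c : 'I_k.+1 + ('I_k + 'I_k) + 'I_m -> X) :
  wt A a (relabel c (strand_above over k m))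
  = \prod_(j < k) over_wt over (c (inl (inl (inord j)))) (c (inl (inr (inl j))))
       (c (inl (inl (inord j.+1)))) (c (inl (inr (inr j))))
    * vertex_wt A ([seq c (inl (inr (inr j))) | j : 'I_k]
                   ++ [seq c (inr j) | j : 'I_m]).
Proof.
rewrite /wt /= big_seq1 !big_nil !mulr1 mulrC map_cat; congr (_ * _).
  rewrite -(map_comp (quad_map c)) big_map big_enum; apply: eq_bigr => j _.
  by rewrite /= quad_map_crossing.
by rewrite -!(map_comp c).
Qed.

(** Upper ends us and lower ends ls now sit on the two sides of one [Theta], ready for
    [tr_Theta]. *)
Lemma Ztangle_above over k m q q' us ls : size us = k -> size ls = m ->
  Ztangle A a (strand_above over k m) (q :: us ++ q' :: ls)
  = tr (Theta (over_coef over) (word A us) (b q) (b q') * word A ls).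
Proof.
move=> su sl; rewrite /Ztangle big_mkcond.
(* Q colours the strand, U and P the outer and inner parts of the upper ends, L the lower ends. *)
pose F Q U P L := if [&& nth q Q 0 == q, U == us, nth q Q k == q' & L == ls]
  then \prod_(j < k) over_wt over (nth q Q j) (nth q U j) (nth q Q j.+1) (nth q P j)
       * vertex_wt A (P ++ L) else 0.
have FE (c : 'I_k.+1 + ('I_k + 'I_k) + 'I_m -> X) :
    (if map c (ends (strand_above over k m)) == q :: us ++ q' :: ls
     then wt A a (relabel c (strand_above over k m)) else 0)
    = F (codom (fun j => c (inl (inl j)))) (codom (fun j => c (inl (inr (inl j)))))
        (codom (fun j => c (inl (inr (inr j))))) (codom (fun j => c (inr j))).
  rewrite wt_strand_above /F /= map_cat -!(map_comp c) /=.
  have nQ j : (j < k.+1)%N ->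
      nth q (codom (fun l => c (inl (inl l)))) j = c (inl (inl (inord j))).
    by move=> jk; rewrite -(nth_codom q (fun l => c (inl (inl l)))) inordK.
  rewrite !nQ // eqseq_cons eqseq_cat; last by rewrite size_map size_enum_ord.
  rewrite eqseq_cons.
  congr (if _ then _ * _ else _).
    by rewrite -(map_comp c).
  apply: eq_bigr => j _.
  by rewrite !nQ ?ltnS // 1?ltnW // !(nth_codom q (fun l => _)).
transitivity (nsum k.+1 (fun Q => nsum k (fun U => nsum k (fun P =>
    nsum m (fun L => F Q U P L))))).
  rewrite !sum_ffun_sum -[RHS]sum_ffun_nsum; apply: eq_bigr => cq _.
  rewrite sum_ffun_sum -[RHS]sum_ffun_nsum; apply: eq_bigr => cu _.
  rewrite -[RHS]sum_ffun_nsum; apply: eq_bigr => cp _.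
  rewrite -[RHS]sum_ffun_nsum; apply: eq_bigr => cl _.
  by rewrite FE /=; congr F; apply: eq_codom => j; rewrite !ffunE.
rewrite -tpathE ?over_coef0 //; last exact: y_over_coef.
rewrite -(mul1r (tpath _ _ _ _ _)) -strand_sum su.
transitivity (nsum (1 + k) (fun Q => if take 1 Q == [:: q] then
  if nth q Q k == q' then nsum k (fun P =>
    \prod_(j < k) over_wt over (nth q Q j) (nth q us j) (nth q Q j.+1) (nth q P j)
       * vertex_wt A (P ++ ls)) else 0 else 0)).
  apply: eq_nsum => -[//|x Q] [sQ]; rewrite /F /= take0 eqseq_cons andbT.
  case: eqP => _ /=; last first.
    by rewrite -[RHS](nsum0 _ X k); apply: eq_nsum => U _;
       rewrite -[RHS](nsum0 _ X k); apply: eq_nsum => P _; rewrite nsum0.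
  transitivity (nsum k (fun U => if U == us then
    if nth q (x :: Q) k == q' then nsum k (fun P => nsum m (fun L => if L == ls then
      \prod_(j < k) over_wt over (nth q (x :: Q) j) (nth q U j) (nth q Q j)
                      (nth q P j) * vertex_wt A (P ++ L) else 0)) else 0 else 0)).
    apply: eq_nsum => U _; case: eqP => _ /=; last first.
      by rewrite -[RHS](nsum0 _ X k); apply: eq_nsum => P _; rewrite nsum0.
    case: eqP => _ //=.
    by rewrite -[RHS](nsum0 _ X k); apply: eq_nsum => P _; rewrite nsum0.
  rewrite nsum_eq //; case: eqP => // _; apply: eq_nsum => P _.
  by rewrite nsum_eq.
rewrite nsum_fix //; apply: eq_nsum => Q sQ /=.
have -> : nth q (q :: Q) k = last q Q.
  by rewrite (last_nth q) sQ.
case: eqP => // _; apply: eq_nsum => P sP.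
by rewrite strand_wtE // mul1r /vertex_wt /word big_cat.
Qed.

(** By [tr_Theta] the strand may pass ls instead of us, with its ends exchanged; that is the half
    turn by which [strand_below] is defined. *)
Lemma Ztangle_IV over k m s : size s = size (ends (strand_above over k m)) ->
  Ztangle A a (strand_above over k m) s = Ztangle A a (strand_below over k m) s.
Proof.
rewrite /= size_cat /= 2!size_map 2!size_enum_ord.
case: s => [//|q s] [ss].
rewrite -(cat_take_drop k s).
case sd : (drop k s) => [|q' ls]; first by have := size_drop k s; rewrite sd ss /=; lia.
have su : size (take k s) = k by rewrite size_takel // ss; lia.
have sl : size ls = m by have := size_drop k s; rewrite sd ss /=; lia.
rewrite Ztangle_above // tr_Theta -(Ztangle_above _ _ _ sl su) /Ztangle.
apply: eq_bigl => c.
rewrite /strand_below /= map_rot.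
have -> : q :: take k s ++ q' :: ls = rot m.+1 (q' :: ls ++ q :: take k s).
  by have := rot_size_cat (q' :: ls) (q :: take k s); rewrite /= sl => ->.
by rewrite (inj_eq (@rot_inj m.+1 X)).
Qed.

End MoveIV.

(** * Move V: half twists *)

Lemma sum_ffun_bij (V : nmodType) (X L L' : finType) (h : L -> L') (g : L' -> L)
    (F : {ffun L' -> X} -> V) : cancel h g -> cancel g h ->
  \sum_c F c = \sum_(c : {ffun L -> X}) F [ffun l => c (g l)].
Proof.
move=> hK gK; rewrite (reindex_onto (fun c : {ffun L -> X} => [ffun l => c (g l)])
   (fun c => [ffun l => c (h l)])) /=; last first.
  by move=> c _; apply/ffunP => l; rewrite !ffunE gK.
by apply: eq_bigl => c; apply/eqP/ffunP => l; rewrite !ffunE hK.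
Qed.

Lemma nsum_rcons (V : nmodType) (X : finType) n (H : seq X -> V) :
  nsum n.+1 H = nsum n (fun t => \sum_x H (rcons t x)).
Proof.
elim: n H => [|n IH] H; first by [].
by rewrite nsumS; under eq_bigr do rewrite IH.
Qed.

Lemma nsum_rev (V : nmodType) (X : finType) n (H : seq X -> V) :
  nsum n H = nsum n (fun t => H (rev t)).
Proof.
elim: n H => [|n IH] H; first by [].
rewrite nsum_rcons nsumS exchange_nsum IH; apply: eq_nsum => t _.
by apply: eq_bigr => x _; rewrite rev_cons.
Qed.

(** The arcs of a half twist of k + 1 strands: those of the half twist of the first k strands, those
    of the last strand, and the final arc of each earlier strand, beyond its crossing with the last
    one. *)
Definition grid_split k (p : 'I_k.+1 * 'I_k.+1) : 'I_k * 'I_k + ('I_k.+1 + 'I_k) :=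
  if unlift ord_max p.1 is Some i then
    if unlift ord_max p.2 is Some j then inl (i, j) else inr (inr i)
  else inr (inl p.2).

Definition grid_join k (s : 'I_k * 'I_k + ('I_k.+1 + 'I_k)) : 'I_k.+1 * 'I_k.+1 :=
  match s with
  | inl (i, j) => (lift ord_max i, lift ord_max j)
  | inr (inl j) => (ord_max, j)
  | inr (inr i) => (lift ord_max i, ord_max)
  end.

Lemma grid_joinK k : cancel (@grid_join k) (@grid_split k).
Proof. by case=> [[i j]|[j|i]]; rewrite /grid_split /= ?liftK ?unlift_none. Qed.

Lemma grid_splitK k : cancel (@grid_split k) (@grid_join k).
Proof.
case=> i j; rewrite /grid_split /=; case: unliftP => [i'|] -> //=.
by case: unliftP => [j'|] -> /=.
Qed.

Lemma codom_ordSr (T : Type) k (f : 'I_k.+1 -> T) :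
  codom f = rcons (codom (fun j => f (lift ord_max j))) (f ord_max).
Proof.
rewrite /codom /image_mem enum_ordSr map_rcons -map_comp; congr rcons.
by apply: eq_map => j /=; congr f; apply: val_inj; rewrite /= /bump leqNgt ltn_ord.
Qed.

Lemma outer_arc_grid k (j : 'I_k) :
  outer_arc (lift ord_max j) = grid_join (inl (outer_arc j)).
Proof.
case: k j => [[]//|k] j; congr pair; apply: val_inj.
by rewrite /= !val_insubd.
Qed.

Lemma inner_arc_grid k (j : 'I_k) :
  inner_arc (lift ord_max j) = grid_join (inr (inr j)).
Proof. by congr pair; apply: val_inj; rewrite /= val_insubd /= ltnS leqnn. Qed.

Section MoveV.

Variables (K : fieldType) (X : finType) (y : K) (A : frobenius X y) (a : K).
Hypothesis a0 : a != 0.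
Hypothesis ya : y = - a - 2 - a^-1.

Local Notation tr := (ftr A).
Local Notation b := (@fbasis _ _ _ A).
Local Notation over_wt := (over_wt A a).
Local Notation over_coef := (over_coef a).

#[local] Arguments crossing_wt : simpl never.

(** The outer ends are coloured us, and the inner ends run, in reverse order, into a vertex whose
    other ends are represented by W. *)
Definition half_twist_sum (over : bool) (k : nat) (us : seq X) (W : A) : K :=
  \sum_(c : {ffun 'I_k * 'I_k -> X} | codom (fun j => c (outer_arc j)) == us)
    (\prod_(ij : 'I_k * 'I_k | (ij.1 < ij.2)%N)
       over_wt over (c (ij.2, ordS ij.1)) (c (ij.1, ord_pred ij.2))
         (c (ij.2, ij.1)) (c (ij.1, ij.2)))
    * tr (word A (rev (codom (fun j => c (inner_arc j)))) * W).

(** The last strand, with outer colour u, crosses the inner ends ps of the smaller half twist. To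
    use [strand_sum], it is followed backwards, from its inner end x to u. *)
Lemma last_strand_sum over u (ps : seq X) (W : A) :
  nsum (size ps).+1 (fun r => if head u r == u then nsum (size ps) (fun d =>
    \prod_(j < size ps) over_wt over (nth u r j.+1) (nth u ps j) (nth u r j)
                          (nth u d j)
    * tr (b (last u r) * word A (rev d) * W)) else 0)
  = \sum_x tr (b x * Theta (over_coef over) (word A (rev ps)) (b x) (b u) * W).
Proof.
rewrite nsum_rev nsumS; apply: eq_bigr => x _.
rewrite -tpathE ?over_coef0 //; last exact: y_over_coef.
rewrite -strand_sum size_rev; apply: eq_nsum => qs sq.
have -> : head u (rev (x :: qs)) = last x qs.
  by case/lastP: qs {sq} => // qs z; rewrite rev_cons rev_rcons last_rcons.
rewrite [in RHS]nsum_rev; case: eqP => // _; apply: eq_nsum => d sd.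
rewrite -(@strand_wtE _ _ _ _ _ _ u _ _ _ _ (size ps)) ?size_rev //.
have -> : last u (rev (x :: qs)) = x by rewrite rev_cons last_rcons.
congr (_ * _).
rewrite (reindex_inj rev_ord_inj) /=; apply: eq_bigr => j _.
rewrite !nth_rev /= ?sq ?sd ?ltnS ?leq_subr //; last first.
  by rewrite subnS; have := ltn_ord j; lia.
have := ltn_ord j => jk.
congr (over_wt over _ _ _ _); last rewrite -[RHS]/(nth u (x :: qs) j.+1);
  by congr nth; lia.
Qed.

(** Induction on the number of strands: the last strand is absorbed into W, the induction hypothesis
    is applied, and the last strand is returned and summed by [twist_step]. *)
Lemma half_twist_sumE over k us W : size us = k ->
  half_twist_sum over k us W
  = (- over_coef over) ^+ k * tr (twist (over_coef over) (word A us) * W).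
Proof.
elim: k us W => [|k IH] us W sus.
  rewrite (size0nil sus) /half_twist_sum expr0 mul1r.
  have c0 (c c' : {ffun 'I_0 * 'I_0 -> X}) : c = c' by apply/ffunP => -[[]].
  have c1 : {ffun 'I_0 * 'I_0 -> X} by apply: finfun => -[[]].
  have cod0 (f : 'I_0 -> X) : codom f = [::].
    by apply: size0nil; rewrite size_codom card_ord.
  rewrite (big_pred1 c1) => [|c]; last by rewrite /= (c0 c c1) cod0 !eqxx.
  rewrite big_pred0 => [|[[]]] //; rewrite cod0 /word big_nil !mul1r.
  by rewrite /twist ftr1 !rmorphN !rmorph1 opprK subrr mulr0 add0r !mul1r.
case/lastP: us sus => [//|us u]; rewrite size_rcons => -[sus].
rewrite /half_twist_sum big_mkcond (sum_ffun_bij _ (@grid_joinK k) (@grid_splitK k)).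
rewrite sum_ffun_sum.
(* The part of the sum that belongs to the last strand, given the inner colours p of the smaller
   half twist. *)
pose G (p : seq X) : K := nsum k.+1 (fun r => if head u r == u then
  nsum k (fun d => \prod_(j < k) over_wt over (nth u r j.+1) (nth u p j) (nth u r j)
                          (nth u d j)
    * tr (b (last u r) * word A (rev d) * W)) else 0).
transitivity (\sum_(c : {ffun 'I_k * 'I_k -> X} | codom (fun j => c (outer_arc j)) == us)
    (\prod_(ij : 'I_k * 'I_k | (ij.1 < ij.2)%N)
       over_wt over (c (ij.2, ordS ij.1)) (c (ij.1, ord_pred ij.2))
         (c (ij.2, ij.1)) (c (ij.1, ij.2)))
    * G (codom (fun j => c (inner_arc j)))).
  rewrite [RHS]big_mkcond; apply: eq_bigr => c _.
  pose P p r d : K := \prod_(j < k)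
    over_wt over (nth u r j.+1) (nth u p j) (nth u r j) (nth u d j).
  have FE (f : 'I_k.+1 * 'I_k.+1 -> X) :
     (forall ij, f (grid_join (inl ij)) = c ij) ->
     (if codom (fun j => f (outer_arc j)) == rcons us u then
      \prod_(ij : 'I_k.+1 * 'I_k.+1 | (ij.1 < ij.2)%N)
       over_wt over (f (ij.2, ordS ij.1)) (f (ij.1, ord_pred ij.2))
         (f (ij.2, ij.1)) (f (ij.1, ij.2))
      * tr (word A (rev (codom (fun j => f (inner_arc j)))) * W) else 0)
     = (fun r d => if codom (fun j => c (outer_arc j)) == us then
          if head u r == u then
          \prod_(ij : 'I_k * 'I_k | (ij.1 < ij.2)%N)
             over_wt over (c (ij.2, ordS ij.1)) (c (ij.1, ord_pred ij.2))
             (c (ij.2, ij.1)) (c (ij.1, ij.2))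
          * (P (codom (fun j => c (inner_arc j))) r d
          * tr (b (last u r) * word A (rev d) * W)) else 0 else 0)
       (codom (fun j => f (grid_join (inr (inl j)))))
       (codom (fun j => f (grid_join (inr (inr j))))).
    move=> fc.
    have -> : codom (fun j => f (outer_arc j))
        = rcons (codom (fun j => c (outer_arc j)))
            (head u (codom (fun j => f (grid_join (inr (inl j)))))).
      rewrite codom_ordSr; congr rcons.
        by apply: eq_codom => j; rewrite outer_arc_grid fc.
      rewrite -nth0 (nth_codom u _ ord0); congr f; congr pair; apply: val_inj.
      by rewrite /= val_insubd.
    have -> : codom (fun j => f (inner_arc j))
        = rcons (codom (fun j => f (grid_join (inr (inr j)))))
            (last u (codom (fun j => f (grid_join (inr (inl j)))))).
      rewrite codom_ordSr; congr rcons.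
        by apply: eq_codom => j; rewrite inner_arc_grid.
      rewrite codom_ordSr last_rcons; congr f; congr pair; apply: val_inj.
      by rewrite /= val_insubd /= leqnn.
    rewrite eqseq_rcons; case: eqP => _ //=; case: eqP => _ //.
    rewrite rev_rcons /word big_cons -/(word A _) mulrA; congr (_ * _).
    rewrite (reindex (@grid_join k)); last first.
      by apply: onW_bij; exists (@grid_split k); [apply: grid_joinK|apply: grid_splitK].
    (* The crossings i < j split into those among the first k strands, those with i the last strand
       (none), and those with j the last strand. *)
    rewrite !big_sumType -[P _ _ _]mul1r; congr (_ * (_ * _)).
    - apply: eq_big => [[i1 i2]|[i1 i2]]; rewrite [X in (X < _)%N]lift_max
        [X in (_ < X)%N]lift_max // => i12.
      (* As i1 < i2, neither the successor of i1 nor the predecessor of i2 wraps around, so they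
         agree in both grids. *)
      have i2k := ltn_ord i2; rewrite -!fc /=.
      congr (over_wt over (f (_, _)) (f (_, _)) _ _);
        apply: val_inj; rewrite /= /bump ![(k <= _)%N]leqNgt ?ltn_ord ?add0n /=.
        by rewrite ltn_mod !modn_small //; lia.
      have E l : ((i2 + l).-1 = i2.-1 + l)%N by lia.
      by rewrite !E !modnDr !modn_small //; lia.
    - by rewrite big_pred0 // => j /=; rewrite ltnNge leq_ord.
    apply: eq_big => [j|j _].
      by rewrite [X in (X < _)%N]lift_max ltn_ord.
    have N (g : 'I_k.+1 -> X) (l : 'I_k.+1) n :
        l = n :> nat -> nth u (codom g) n = g l.
      by move=> <-; rewrite nth_codom.
    have jk := ltn_ord j.
    rewrite (N _ (ordS (lift ord_max j))); last first.
      by rewrite /= /bump leqNgt jk modn_small.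
    rewrite (N _ (lift ord_max j)) ?lift_max // !nth_codom -fc.
    congr (over_wt over _ (f (_, _)) _ _); apply: val_inj.
    rewrite /= val_insubd /bump; have -> : (k.-1 < k)%N by lia.
    have -> : (k <= k.-1)%N = false by lia.
    have -> : ((k + k.+1).-1 = k.-1 + k.+1)%N by lia.
    by rewrite modnDr modn_small //; lia.
  rewrite sum_ffun_sum.
  transitivity (\sum_(r : {ffun 'I_k.+1 -> X}) \sum_(d : {ffun 'I_k -> X})
     if codom (fun j => c (outer_arc j)) == us then
     if head u (codom r) == u then
     \prod_(ij : 'I_k * 'I_k | (ij.1 < ij.2)%N)
             over_wt over (c (ij.2, ordS ij.1)) (c (ij.1, ord_pred ij.2))
             (c (ij.2, ij.1)) (c (ij.1, ij.2))
          * (P (codom (fun j => c (inner_arc j))) (codom r) (codom d)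
          * tr (b (last u (codom r)) * word A (rev (codom d)) * W)) else 0 else 0).
    apply: eq_bigr => r _; apply: eq_bigr => d _.
    rewrite (FE (fun ij => finfun _ ij)); last first.
      by move=> ij; rewrite !ffunE grid_joinK.
    have -> : codom r =
        codom (fun j => [ffun l => [ffun s => match s with inl l0 => c l0
          | inr l0 => [ffun s0 => match s0 with inl l1 => r l1 | inr l1 => d l1 end] l0
          end] (grid_split l)] (grid_join (inr (inl j)))).
      by apply: eq_codom => j; rewrite !ffunE grid_joinK ffunE.
    by have -> : codom d =
        codom (fun j => [ffun l => [ffun s => match s with inl l0 => c l0
          | inr l0 => [ffun s0 => match s0 with inl l1 => r l1 | inr l1 => d l1 end] l0
          end] (grid_split l)] (grid_join (inr (inr j))));
      first by apply: eq_codom => j; rewrite !ffunE grid_joinK ffunE.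
  case: eqP => _; last by rewrite big1 // => r _; rewrite big1.
  rewrite /G -[nsum _ _]sum_ffun_nsum big_distrr; apply: eq_bigr => r _ /=.
  case: eqP => _; last by rewrite big1 // mulr0.
  by rewrite -[nsum _ _]sum_ffun_nsum big_distrr; apply: eq_bigr.
(* By [tr_Theta] the last strand is pushed across to W, so that [G] becomes a trace against a fixed
   element. *)
pose W' := \sum_x Theta (over_coef over) (W * b x) (b u) (b x).
have GE p : size p = k -> G p = tr (word A (rev p) * W').
  move=> sp; have := last_strand_sum over u p W; rewrite sp /G => ->.
  rewrite /W' mulr_sumr (raddf_sum tr); apply: eq_bigr => x _ /=.
  by rewrite -mulrA ftrC -mulrA tr_Theta ftrC.
under eq_bigr do rewrite GE ?size_codom ?card_ord //.
rewrite [LHS](IH us W' sus) exprSr -mulrA; congr (_ * _).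
transitivity (tr ((\sum_x b x *
    Theta (over_coef over) (twist (over_coef over) (word A us)) (b x) (b u)) * W)).
  rewrite /W' mulr_sumr mulr_suml !(raddf_sum tr) /=; apply: eq_bigr => x _.
  by rewrite ftrC tr_Theta mulrA ftrC mulrA.
rewrite twist_step ?over_coef0 //; last exact: y_over_coef.
by rewrite -mulrA ftrZ /word -cats1 big_cat big_seq1.
Qed.

Lemma Ztangle_vertex k m us ls : size us = k -> size ls = m ->
  Ztangle A a (vertex_tangle k m) (us ++ ls) = vertex_wt A (us ++ ls).
Proof.
move=> su sl; rewrite /Ztangle big_mkcond sum_ffun_sum.
transitivity (nsum k (fun U => if U == us then nsum m (fun L => if L == ls then
    vertex_wt A (U ++ L) else 0) else 0)); last first.
  by rewrite nsum_eq // nsum_eq.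
rewrite -[RHS]sum_ffun_nsum; apply: eq_bigr => u _.
transitivity (\sum_(l : {ffun 'I_m -> X}) (if codom u == us then
    if codom l == ls then vertex_wt A (codom u ++ codom l) else 0 else 0)).
  apply: eq_bigr => l _; rewrite /wt /= big_seq1 !big_nil !mulr1.
  set c := finfun _.
  have -> : map c (map inl (enum 'I_k) ++ map inr (enum 'I_m)) = codom u ++ codom l.
    rewrite map_cat -!(map_comp c); congr (_ ++ _).
      by apply: eq_map => j /=; rewrite ffunE.
    by apply: eq_map => j /=; rewrite ffunE.
  rewrite eqseq_cat ?size_codom ?card_ord ?su //.
  by case: eqP; case: eqP.
case: eqP => _; last by rewrite big1.
by rewrite -[RHS]sum_ffun_nsum.
Qed.

Lemma half_twist_wt over k (L : Type) (f : 'I_k * 'I_k -> L) (c : L -> X) :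
  \prod_(q <- map (quad_map c) (map (quad_map f) (half_twist over k)))
    crossing_wt A a q
  = \prod_(ij : 'I_k * 'I_k | (ij.1 < ij.2)%N)
       over_wt over (c (f (ij.2, ordS ij.1))) (c (f (ij.1, ord_pred ij.2)))
         (c (f (ij.2, ij.1))) (c (f (ij.1, ij.2))).
Proof.
rewrite /half_twist -(map_comp (quad_map c)) big_map big_map big_filter big_enum_cond.
by apply: eq_bigr => ij _; rewrite /= !quad_map_crossing.
Qed.

(** The half twists on the two sides have parameters e and e^-1; by [tr_twist] their operators
    cancel under the trace and only the scalar factors remain. *)
Lemma Ztangle_rotated dir k m us ls : size us = k -> size ls = m ->
  Ztangle A a (rotated_vertex_tangle dir k m) (us ++ ls)
  = (- over_coef dir) ^+ k * (- (over_coef dir)^-1) ^+ m * vertex_wt A (us ++ ls).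
Proof.
move=> su sl; rewrite /Ztangle big_mkcond sum_ffun_sum.
transitivity (\sum_(u : {ffun 'I_k * 'I_k -> X})
    (if codom (fun j => u (outer_arc j)) == us then
    (\prod_(ij : 'I_k * 'I_k | (ij.1 < ij.2)%N)
       over_wt dir (u (ij.2, ordS ij.1)) (u (ij.1, ord_pred ij.2))
         (u (ij.2, ij.1)) (u (ij.1, ij.2)))
    * half_twist_sum (~~ dir) m ls (word A (rev (codom (fun j => u (inner_arc j)))))
    else 0)).
  apply: eq_bigr => u _.
  transitivity (\sum_(l : {ffun 'I_m * 'I_m -> X})
      (if codom (fun j => u (outer_arc j)) == us then
      (\prod_(ij : 'I_k * 'I_k | (ij.1 < ij.2)%N)
       over_wt dir (u (ij.2, ordS ij.1)) (u (ij.1, ord_pred ij.2))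
         (u (ij.2, ij.1)) (u (ij.1, ij.2)))
      * (if codom (fun j => l (outer_arc j)) == ls then
      (\prod_(ij : 'I_m * 'I_m | (ij.1 < ij.2)%N)
       over_wt (~~ dir) (l (ij.2, ordS ij.1)) (l (ij.1, ord_pred ij.2))
         (l (ij.2, ij.1)) (l (ij.1, ij.2)))
      * tr (word A (rev (codom (fun j => l (inner_arc j))))
            * word A (rev (codom (fun j => u (inner_arc j))))) else 0) else 0)).
    apply: eq_bigr => l _; set c := finfun _.
    have cl ij : c (inl ij) = u ij by rewrite ffunE.
    have cr ij : c (inr ij) = l ij by rewrite ffunE.
    have codomE n (L : Type) (g : 'I_n * 'I_n -> L) (h : 'I_n -> 'I_n * 'I_n) (d : L -> X)
        (v : {ffun 'I_n * 'I_n -> X}) : (forall ij, d (g ij) = v ij) ->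
        map d (map g (map h (enum 'I_n))) = codom (fun j => v (h j)).
      by move=> dv; rewrite -(map_comp d) -(map_comp (d \o g)); apply: eq_map => j /=.
    have -> : map c (ends (rotated_vertex_tangle dir k m))
        = codom (fun j => u (outer_arc j)) ++ codom (fun j => l (outer_arc j)).
      by rewrite /= map_cat (codomE _ _ _ _ _ _ cl) (codomE _ _ _ _ _ _ cr).
    have -> : wt A a (relabel c (rotated_vertex_tangle dir k m))
      = (\prod_(ij : 'I_k * 'I_k | (ij.1 < ij.2)%N)
       over_wt dir (u (ij.2, ordS ij.1)) (u (ij.1, ord_pred ij.2))
         (u (ij.2, ij.1)) (u (ij.1, ij.2)))
      * ((\prod_(ij : 'I_m * 'I_m | (ij.1 < ij.2)%N)
       over_wt (~~ dir) (l (ij.2, ordS ij.1)) (l (ij.1, ord_pred ij.2))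
         (l (ij.2, ij.1)) (l (ij.1, ij.2)))
      * tr (word A (rev (codom (fun j => l (inner_arc j))))
            * word A (rev (codom (fun j => u (inner_arc j)))))).
      rewrite /wt /= big_seq1 !big_nil !mulr1 !map_cat big_cat /= !half_twist_wt.
      rewrite mulrC -mulrA; congr (_ * (_ * _)).
      - by apply: eq_bigr => ij _; rewrite !cl.
      - by apply: eq_bigr => ij _; rewrite !cr.
      rewrite !map_rev (codomE _ _ _ _ _ _ cl) (codomE _ _ _ _ _ _ cr).
      by rewrite /vertex_wt /word big_cat ftrC.
    by rewrite eqseq_cat ?size_codom ?card_ord ?su //; do 2![case: eqP => _];
      rewrite ?mulr0.
  case: eqP => _; last by rewrite big1.
  by rewrite -big_distrr /= /half_twist_sum [X in _ = _ * X]big_mkcond.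
have -> : (- (over_coef dir)^-1) = - over_coef (~~ dir).
  by case: dir; rewrite /= ?invrK.
under eq_bigr do rewrite half_twist_sumE //.
transitivity ((- over_coef (~~ dir)) ^+ m *
  half_twist_sum dir k us (twist (over_coef (~~ dir)) (word A ls))).
  rewrite /half_twist_sum big_distrr [in RHS]big_mkcond /=.
  by apply: eq_bigr => u _; case: eqP => // _; rewrite mulrCA (ftrC _ (word A _)).
rewrite half_twist_sumE // mulrA (mulrC (_ ^+ m)); congr (_ * _).
have -> : over_coef (~~ dir) = (over_coef dir)^-1.
  by case: dir; rewrite /= ?invrK.
by rewrite tr_twist ?over_coef0 // /vertex_wt /word big_cat.
Qed.

End MoveV.

(** * The moves on closed diagrams *)

Lemma Zsum_invariant (E E' : twisted_diagram) :
  move_II E E' \/ move_III E E' \/ move_IV E E' ->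
  forall (K : fieldType) (X : finType) (a : K) (A : frobenius X (- a - 2 - a^-1)),
  a != 0 -> Zsum A a E = Zsum A a E'.
Proof.
move=> EE' K X a A a0.
have sym (LT LT' : finType) (T : tangle LT) (T' : tangle LT') :
    (forall s, size s = size (ends T) -> Ztangle A a T s = Ztangle A a T' s) ->
    move_by T T' E E' -> Zsum A a E = Zsum A a E'.
  move=> TT' [|] H.
    by rewrite (Zsum_replaced (k := 1) (A := A) (a := a) _ H) ?mul1r // => s ss;
       rewrite mul1r TT'.
  have [L [O [sT sT' _ _]]] := H.
  rewrite (Zsum_replaced (k := 1) (A := A) (a := a) _ H) ?mul1r // => s ss.
  by rewrite mul1r TT' // ss -sT.
case: EE' => [|[[h0 [h1 [h2 [hu]]]]|[over [k [m]]]]].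
- by apply: sym => s ss; apply: Ztangle_bigon.
- by apply: sym => s ss; apply: Ztangle_triangle.
- by apply: sym => s ss; apply: Ztangle_IV.
Qed.

Lemma exprN_over_coef (K : fieldType) (a : K) over (n : nat) :
  (- over_coef a over) ^+ n = (- a) ^ (if over then n%:Z else - n%:Z).
Proof. by case: over; rewrite //= -invrN exprVn -exprnN. Qed.

(** The exponent is chosen before the model: the comparison in the coefficient ring needs one n for
    all special values. *)
Lemma Zsum_unit_invariant (E E' : twisted_diagram) :
  move_I E E' \/ move_V E E' -> exists n : int,
  forall (K : fieldType) (X : finType) (a : K) (A : frobenius X (- a - 2 - a^-1)),
  a != 0 -> Zsum A a E = (- a) ^ n * Zsum A a E'.
Proof.
move=> EE'.
have sym (LT LT' : finType) (T : tangle LT) (T' : tangle LT') (n : int) :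
    (forall (K : fieldType) (X : finType) (a : K)
       (A : frobenius X (- a - 2 - a^-1)) s, a != 0 -> size s = size (ends T) ->
       Ztangle A a T s = (- a) ^ n * Ztangle A a T' s) ->
    move_by T T' E E' -> exists n : int,
    forall (K : fieldType) (X : finType) (a : K) (A : frobenius X (- a - 2 - a^-1)),
    a != 0 -> Zsum A a E = (- a) ^ n * Zsum A a E'.
  move=> TT' [|] H.
    exists n => K X a A a0.
    by apply: Zsum_replaced H => s ss; apply: TT'.
  exists (- n) => K X a A a0.
  have [L [O [sT sT' _ _]]] := H.
  have nz : (- a) ^ n != 0 by rewrite expfz_neq0 // oppr_eq0.
  have -> : Zsum A a E' = (- a) ^ n * Zsum A a E.
    by apply: Zsum_replaced H => s ss; apply: TT'.
  by rewrite mulrA -invr_expz mulVf // mul1r.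
case: EE' => [[over]|[dir [k [m]]]].
  apply: (sym _ _ _ _ (if over then 2 else - 2)) => K X a A s a0 ss.
  rewrite Ztangle_kink // mulrA -[LHS]mul1r; congr (_ * _).
  case: over => /=; last by rewrite invrK -exprnN sqrrN mulVf // expf_neq0.
  by rewrite -exprnP sqrrN exprVn mulfV // expf_neq0.
apply: (sym _ _ _ _ (if dir then m%:Z - k%:Z else k%:Z - m%:Z)) => K X a A s a0 ss.
rewrite -(cat_take_drop k s).
have {ss} ss : size s = (k + m)%N.
  by rewrite ss /= size_cat 2!size_map 2!size_enum_ord.
have su : size (take k s) = k by rewrite size_takel // ss leq_addr.
have sl : size (drop k s) = m by rewrite size_drop ss addKn.
rewrite Ztangle_vertex // Ztangle_rotated // mulrA -[LHS]mul1r; congr (_ * _).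
have -> : - (over_coef a dir)^-1 = - over_coef a (~~ dir).
  by case: dir; rewrite /= ?invrK.
have na : - a != 0 by rewrite oppr_eq0.
rewrite !exprN_over_coef -!expfzDr //.
by case: dir => /=; rewrite (_ : _ + _ = 0) ?expr0z //; lia.
Qed.

(** * The surface of a pure diagram *)

Section Rank.

Variables (K : fieldType) (n : nat) (e : rel 'I_n).
Hypothesis se : connect_sym e.

Let P : 'M[K]_n := \matrix_(i, j) (fingraph.root e j == i)%:R.

Lemma sum_indicator (J : finType) (j : J) (f : J -> K) :
  \sum_i (i == j)%:R * f i = f j.
Proof.
rewrite (bigD1 j) //= eqxx mul1r big1 ?addr0 // => i /negPf->.
by rewrite mul0r.
Qed.

Lemma mul_component_mx (f : 'rV_n) j : (f *m P) 0 j = f 0 (fingraph.root e j).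
Proof.
rewrite mxE -(sum_indicator (fingraph.root e j) (f 0)).
by apply: eq_bigr => i _; rewrite mxE mulrC eq_sym.
Qed.

(** The matrix factors as B C through the roots, with C B the identity. *)
Lemma rank_component_mx : \rank P = n_comp e (mem 'I_n).
Proof.
pose R := [pred x | x \in roots e].
pose B : 'M[K]_(n, #|R|) := \matrix_(i, r) (i == enum_val r)%:R.
pose C : 'M[K]_(#|R|, n) := \matrix_(r, j) (fingraph.root e j == enum_val r)%:R.
have BC : P = B *m C.
  apply/matrixP => i j; rewrite !mxE.
  have rj : fingraph.root e j \in R by rewrite !inE roots_root.
  rewrite (bigD1 (enum_rank_in rj (fingraph.root e j))) //= big1 => [|r rr].
    by rewrite !mxE enum_rankK_in // eqxx mulr1 addr0 eq_sym.
  rewrite !mxE; case: eqP => [_|]; last by rewrite mul0r.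
  case: eqP => [E|]; last by rewrite mulr0.
  by case/eqP: rr; apply: enum_val_inj; rewrite enum_rankK_in.
have CB : C *m B = 1%:M.
  apply/matrixP => r r'; rewrite !mxE.
  transitivity (\sum_j (j == enum_val r')%:R * (fingraph.root e j == enum_val r)%:R : K).
    by apply: eq_bigr => j _; rewrite !mxE mulrC.
  rewrite sum_indicator; congr (nat_of_bool _)%:R.
  have : enum_val r' \in R := enum_valP r'.
  by rewrite !inE => /eqP->; rewrite (inj_eq enum_val_inj) eq_sym.
have -> : n_comp e (mem 'I_n) = #|R|.
  by apply: eq_card => x; rewrite !inE andbT.
apply/eqP; rewrite eqn_leq {1}BC mulmx_max_rank /=.
rewrite -[leqLHS](@mxrank1 K) -CB -[C *m B]mulmx1 -CB mulmxA -(mulmxA C) -BC.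
by apply: leq_trans (mxrankM_maxl _ _) _; apply: mxrankM_maxr.
Qed.

(** The row vectors annihilated by the transpose of M are the functions that are constant on
    components, that is the row space of P. *)
Lemma rank_incidence m (M : 'M[K]_(m, n)) (s t : 'I_m -> 'I_n) :
  (forall i x, M i x = (t i == x)%:R - (s i == x)%:R) ->
  (forall x y, e x y -> exists i, (s i = x /\ t i = y) \/ (s i = y /\ t i = x)) ->
  (forall i, connect e (s i) (t i)) ->
  (\rank M + n_comp e (mem 'I_n) = n)%N.
Proof.
move=> ME eM Me.
have mulM (f : 'rV_n) i : (f *m M^T) 0 i = f 0 (t i) - f 0 (s i).
  rewrite mxE -(sum_indicator (t i) (f 0)) -(sum_indicator (s i) (f 0)) -sumrB.
  by apply: eq_bigr => x _; rewrite mxE ME mulrBr !(mulrC (f 0 x)) !(eq_sym x).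
have -> : n_comp e (mem 'I_n) = \rank (kermx M^T).
  rewrite -rank_component_mx; apply/eqP; rewrite eqn_leq; apply/andP.
  split; apply: mxrankS; last first.
    apply/rV_subP => f /sub_kermxP fM.
    suff -> : f = f *m P by apply: submxMl.
    apply/rowP => x; rewrite mul_component_mx.
    have /connectP[p ep ->] := connect_root e x.
    elim: p x ep => //= x' p IH x /andP[/eM[i xx'] /IH <-].
    have /rowP/(_ i) := fM; rewrite mulM mxE => /eqP; rewrite subr_eq0 => /eqP.
    by case: xx' => -[<- <-].
  apply/row_subP => i; apply/sub_kermxP/rowP => j; rewrite mulM !mxE.
  have /(fingraph.rootP se)-> := Me j; exact: subrr.
by rewrite mxrank_ker mxrank_tr subnKC // rank_leq_col.
Qed.

End Rank.

Section Surface.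

Variables (L : finType) (F : code L) (A : {set {set L}}).
Hypothesis two_endsF : two_ends F.
Hypothesis pureF : crossings F = [::].
Hypothesis AF : A \subset edges F.

Local Notation D := (edge_end F).
Local Notation V := 'I_(size (vertices F)).

Definition band_rel : rel V := fun x x' =>
  [exists d, exists d', [&& foot d == x, foot d' == x' & band A d d']].

Lemma band_sym (d d' : D) : band A d d' = band A d' d.
Proof.
rewrite /band eq_sym (eq_sym (edge_of d)); case: (d' == d) => //=.
by case: eqP => // ->.
Qed.

Lemma band_rel_sym : connect_sym band_rel.
Proof.
apply: sym_connect_sym => x x'; apply/existsP/existsP => -[d /existsP[d' /and3P[dx d'x b]]];
  by exists d'; apply/existsP; exists d; rewrite dx d'x band_sym b.
Qed.

Lemma boundary_sym : connect_sym (@boundary_step L F A).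
Proof.
apply: sym_connect_sym => -[d s] [d' s']; rewrite /boundary_step.
rewrite (band_sym d') (eq_sym d') (eq_sym s').
rewrite orbCA; congr (_ || (_ || (_ || _))).
- by rewrite andbCA.
- by rewrite andbCA.
- have [|] := boolP (band A d d') => //= /and3P[_ /eqP-> _].
  by case: odd_bars; case: s; case: s'.
by have [->|] := eqVneq d d'; case: s; case: s'.
Qed.

Lemma band_ends (e : {set L}) : e \in A -> exists d1 d2 : D,
  [/\ d1 != d2, forall d, (edge_of d == e) = (d == d1) || (d == d2),
      first_end F e = Some d1 & band A d1 d2].
Proof.
move=> eA; have [d1 [d2 [d12 E]]] := edge_ends two_endsF pureF (subsetP AF _ eA).
have b12 : band A d1 d2.
  rewrite /band d12; have := E d1; have := E d2; rewrite !eqxx orbT /= => /eqP-> /eqP->.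
  by rewrite eqxx.
rewrite /first_end; case: pickP => [d|/(_ d1)]; last by rewrite E eqxx.
rewrite E => /orP[]/eqP->; first by exists d1, d2; split.
exists d2, d1; split=> //; [by rewrite eq_sym|by move=> d'; rewrite E orbC|].
by rewrite band_sym.
Qed.

Lemma band_pair (d1 d2 : D) : band A d1 d2 ->
  forall d, (edge_of d == edge_of d1) = (d == d1) || (d == d2).
Proof.
case/and3P=> d12 /eqP e12 eA d.
have [d3 [d4 [d34 E _ _]]] := band_ends eA.
have := E d1; have := E d2; rewrite -e12 !eqxx E.
case/esym/orP=> /eqP E2; case/esym/orP=> /eqP E1; move: d12; rewrite E1 E2 ?eqxx //.
by rewrite orbC.
Qed.

(** The Euler characteristic. As each band has exactly two ends, [handle_boundary] is an incidence
    matrix, with zero rows for loops. *)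
Lemma betti1E :
  (surf_betti1 F A + size (vertices F) = #|A| + surf_components F A)%N.
Proof.
have H i := band_ends (enum_valP i : enum_val i \in A).
have [s {}H] := fin_all_exists H; have [t {}H] := fin_all_exists H.
have rk : (\rank (handle_boundary F A) + n_comp band_rel (mem V)
    = size (vertices F))%N.
  apply: (rank_incidence band_rel_sym (s := fun i => foot (s i))
    (t := fun i => foot (t i))) => [i x|x y|i].
  - have [st E fs _] := H i; rewrite mxE big_mkcondr /= (eq_bigl _ _ E).
    rewrite (bigD1 (s i)) ?eqxx //= (bigD1 (t i)) /=; last first.
      by rewrite eqxx orbT eq_sym.
    rewrite big1 => [|d]; last by case: eqP; case: eqP.
    rewrite fs eqxx eq_sym [Some _ == _](_ : _ = false); last first.
      by apply/eqP => -[/eqP]; apply/negP.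
    rewrite addr0 addrC (eq_sym x); case: eqP => _; case: eqP => _;
      by rewrite ?subr0 ?sub0r ?subrr ?addr0.
  - case/existsP=> d /existsP[d' /and3P[/eqP<- /eqP<- /and3P[dd' /eqP ed dA]]].
    pose i := enum_rank_in dA (edge_of d).
    have ei : enum_val i = edge_of d by rewrite /i enum_rankK_in.
    exists i; have [_ E _ _] := H i.
    have := E d'; rewrite -ed ei eqxx; have := E d; rewrite ei eqxx.
    move: dd' => /eqP dd' /esym/orP[]/eqP e1 /esym/orP[]/eqP e2;
      by [case: dd'; rewrite e1 e2 | left; rewrite -e1 -e2
         | right; rewrite -e1 -e2].
  have [_ _ _ b] := H i; apply: connect1; apply/existsP; exists (s i).
  by apply/existsP; exists (t i); rewrite !eqxx.
have := rank_leq_row (handle_boundary F A); move: rk.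
rewrite /surf_betti1 mxrank_ker -[surf_components F A]/(n_comp band_rel (mem V)).
by move: (\rank _) => r; lia.
Qed.

Definition prev_end (d : D) : D :=
  Tagged (fun x => 'I_(size (vertex_at x))) (ord_pred (tagged d)).

Lemma next_endK : cancel (@next_end L F) prev_end.
Proof. by case=> x j; rewrite /next_end /prev_end /= ordSK. Qed.

Lemma prev_endK : cancel prev_end (@next_end L F).
Proof. by case=> x j; rewrite /next_end /prev_end /= ord_predK. Qed.

(** The value g d belongs to the arc of the disk boundary from d to the next end, so the right flag
    of d has the colour of the previous end. *)
Definition flag_colour (I : Type) (g : D -> I) (f : D * bool) : I :=
  if f.2 then g f.1 else g (prev_end f.1).

Definition boundary_colouring (I : finType) (g : {ffun D -> I}) : bool :=
  [forall f, forall f', boundary_step A f f' ==> (flag_colour g f == flag_colour g f')].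

Lemma boundary_colouringP (I : finType) (g : {ffun D -> I}) :
  reflect ((forall d, edge_of d \notin A -> g (prev_end d) = g d) /\
     (forall d d', band A d d' -> g d = flag_colour g (d', odd_bars F (edge_of d)) /\
        g (prev_end d) = flag_colour g (d', ~~ odd_bars F (edge_of d))))
    (boundary_colouring g).
Proof.
apply: (iffP forallP) => [H|[H1 H2] [d s]].
  have {}H f f' : boundary_step A f f' -> flag_colour g f = flag_colour g f'.
    by have /forallP/(_ f')/implyP := H f => E /E/eqP.
  split=> [d dA|d d' b].
    by apply: (H (d, false) (d, true)); rewrite /= eqxx dA !orbT.
  split.
    apply: (H (d, true) (d', _)); rewrite /boundary_step b /=.
    by case: odd_bars; rewrite ?orbT.
  apply: (H (d, false) (d', _)); rewrite /boundary_step b /=.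
  by case: odd_bars; rewrite ?orbT.
apply/forallP => -[d' s']; apply/implyP; rewrite /boundary_step.
case/or4P.
- by case/and3P => -> /negPf-> /eqP->; rewrite /flag_colour /= next_endK.
- by case/and3P => /negPf-> -> /eqP->; rewrite /flag_colour /= next_endK.
- case/andP => /H2 + /eqP->; rewrite /flag_colour /=.
  by case: odd_bars => -[E1 E2]; case: s; rewrite /= ?E1 ?E2.
case/and3P => /eqP<- ss' /H1; rewrite /flag_colour /=.
by case: s ss'; case: s' => //= _ ->.
Qed.

Lemma card_boundary_colouring (I : finType) :
  #|[set g : {ffun D -> I} | boundary_colouring g]|
  = (#|I| ^ n_comp (@boundary_step L F A) (mem {: D * bool}))%N.
Proof.
rewrite -(card_invariant_ffun I boundary_sym).
pose h (g : {ffun D -> I}) : {ffun D * bool -> I} := [ffun f => flag_colour g f].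
have hI : injective h.
  move=> g g' /ffunP E; apply/ffunP => d; have := E (d, true).
  by rewrite !ffunE.
rewrite -(card_imset _ hI); apply: eq_card => f; rewrite inE.
apply/imsetP/idP => [[g gb ->]|fb].
  apply/forallP => x; apply/forallP => x'; rewrite !ffunE.
  by move: gb; rewrite inE => /forallP/(_ x)/forallP.
have {}fb x x' : boundary_step A x x' -> f x = f x'.
  by have /forallP/(_ x)/forallP/(_ x')/implyP := fb => E /E/eqP.
have fE x : f x = flag_colour [ffun d => f (d, true)] x.
  case: x => [d [|]]; rewrite /flag_colour /= !ffunE //.
  by apply/esym/fb; rewrite /boundary_step /= prev_endK eqxx.
exists [ffun d => f (d, true)]; last by apply/ffunP => x; rewrite ffunE.
rewrite inE; apply/forallP => x; apply/forallP => x'; apply/implyP => /fb E.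
by rewrite -!fE E.
Qed.

(* The truncated exponent k + n - b in [Mpoly] is harmless if b <= k + n.  The jumps
   of a two-valued colouring of the boundary form a mod 2 cycle, and two
   colourings with the same jumps differ by a function on the components. *)
Section Genus.

Implicit Types (g : {ffun D -> bool}) (h : {set {set L}}).

(** Minus one to the number of ends of h at x; thus [cycles] is the mod 2 cycle space of the
    spanning subgraph. *)
Let sign h (x : V) : int := \prod_(d : D | foot d == x) (-1) ^+ (edge_of d \in h).

Let cycles : {set {set {set L}}} :=
  [set h : {set {set L}} | (h \subset A) && [forall x, sign h x == 1]].

Let consts : {set {ffun V -> bool}} :=
  [set f : {ffun V -> bool} | [forall x, forall x', band_rel x x' ==> (f x == f x')]].

Lemma constsP (f : {ffun V -> bool}) :
  reflect (forall d d', band A d d' -> f (foot d) = f (foot d')) (f \in consts).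
Proof.
rewrite inE; apply: (iffP forallP) => [H d d' b|H x].
  have /forallP/(_ (foot d'))/implyP E := H (foot d); apply/eqP/E.
  by apply/existsP; exists d; apply/existsP; exists d'; rewrite !eqxx.
apply/forallP => x'; apply/implyP => /existsP[d /existsP[d' /and3P[/eqP<- /eqP<- b]]].
exact/eqP/H.
Qed.

Lemma sign_pm h x : sign h x = 1 \/ sign h x = -1.
Proof.
rewrite /sign; elim/big_rec: _ => [|d r _ [->|->]]; first by left.
  by case: (_ \in h); rewrite ?mulr1; auto.
by case: (_ \in h); rewrite ?mulr1 ?mulrNN; auto.
Qed.

(** A character sum over pairs of an edge set h and a function f on the vertices, evaluated in both
    orders: for fixed h it detects cycles, for fixed f functions constant along bands. *)
Lemma card_cycles : (2 ^ size (vertices F) * #|cycles| = 2 ^ #|A| * #|consts|)%N.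
Proof.
apply/eqP; rewrite -(eqr_nat int) !natrM !natrX; apply/eqP.
transitivity (\sum_(h : {set {set L}} | h \subset A) \prod_(x : V) (1 + sign h x)).
  rewrite -sum1_card natr_sum mulr_sumr big_mkcond [RHS]big_mkcond.
  apply: eq_bigr => h _; rewrite inE; case: (h \subset A) => //=.
  case: forallP => [H|H].
    rewrite (eq_bigr (fun _ => 2)) ?prodr_const ?card_ord ?mulr1 // => x _.
    by rewrite (eqP (H x)).
  have /existsP[x sx] : [exists x, sign h x != 1].
    by apply: contraPT H; rewrite negb_exists => /forallP H; case=> x;
       have := H x; rewrite negbK.
  rewrite (bigD1 x) //=; case: (sign_pm h x) sx => -> //.
  by rewrite subrr mul0r.
transitivity (\sum_(f : {ffun V -> bool}) \prod_(e in A)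
    (\prod_(d : D | edge_of d == e) (-1) ^+ f (foot d) + 1 : int)).
  under [RHS]eq_bigr do rewrite prodD_subset.
  rewrite exchange_big /=; apply: eq_bigr => h hA.
  transitivity (\prod_(x : V) \sum_(b : bool) sign h x ^+ b).
    by apply: eq_bigr => x _; rewrite big_bool addrC expr0 expr1.
  rewrite bigA_distr_bigA /=; apply: eq_bigr => f _.
  rewrite big1_eq mulr1.
  transitivity (\prod_(d : D) (-1) ^+ ((edge_of d \in h) && f (foot d)) : int).
    rewrite (partition_big (@foot L F) xpredT) //=; apply: eq_bigr => x _.
    rewrite /sign -prodrXl; apply: eq_bigr => d /eqP <-.
    by case: (_ \in h); case: (f _).
  rewrite (bigID (fun d => edge_of d \in h)) /= [X in _ * X]big1 ?mulr1; last first.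
    by move=> d /negPf->.
  rewrite (partition_big (@edge_of L F) (fun e => e \in h)) //=.
  apply: eq_bigr => e eh; apply: eq_big => [d|d /andP[-> _]//].
  by case: eqP => [->|]; rewrite ?andbF ?andbT ?eh.
rewrite -(sum1_card (mem consts)) natr_sum mulr_sumr [RHS]big_mkcond; apply: eq_bigr => f _.
case: constsP => [H|H].
  rewrite (eq_bigr (fun _ => 2)) ?prodr_const ?mulr1 // => e eA.
  have [d1 [d2 [d12 E _ b]]] := band_ends eA; rewrite (eq_bigl _ _ E).
  rewrite (bigD1 d1) ?eqxx //= (bigD1 d2) /=; last by rewrite eqxx orbT eq_sym.
  rewrite (H _ _ b) big1 ?mulr1 => [|d]; last by case: eqP; case: eqP.
  by case: (f _).
have /existsP[d1 /existsP[d2 /andP[b n12]]] :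
    [exists d1, exists d2, band A d1 d2 && (f (foot d1) != f (foot d2))].
  apply: contraPT H; rewrite negb_exists => /forallP H; apply => d d' b.
  have := H d; rewrite negb_exists => /forallP/(_ d').
  by rewrite b /= negbK => /eqP.
have eA : edge_of d1 \in A by case/and3P: b.
rewrite (bigD1 _ eA) /= (eq_bigl _ _ (band_pair b)) (bigD1 d1) ?eqxx //=.
rewrite (bigD1 d2) /=; last by rewrite eqxx orbT; case/and3P: b; rewrite eq_sym.
rewrite big1 ?mulr1 => [|d]; last by case: eqP; case: eqP.
by move: n12; case: (f (foot d1)); case: (f (foot d2)) => //; rewrite mul0r.
Qed.

Let colourings : {set {ffun D -> bool}} := [set g | boundary_colouring g].

(** The edges at which g changes across the end; by [mem_jumps] both ends give the same answer. *)
Let jumps g : {set {set L}} :=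
  [set e in A | [exists d, (edge_of d == e) && (g (prev_end d) (+) g d)]].

Lemma mem_jumps g d : g \in colourings ->
  (edge_of d \in jumps g) = g (prev_end d) (+) g d.
Proof.
rewrite inE => /boundary_colouringP[gA gb]; rewrite inE.
have [eA|/gA->] := boolP (edge_of d \in A); last by rewrite addbb.
apply/existsP/idP => [[d' /andP[/eqP d'd]]|gd]; last by exists d; rewrite eqxx.
have [->//|nd] := eqVneq d' d.
have /gb[-> ->] : band A d' d by rewrite /band nd d'd eqxx eA.
by rewrite /flag_colour /=; case: odd_bars; rewrite //= addbC.
Qed.

Lemma ord_pred_invariant (I : Type) n (f : 'I_n -> I) :
  (forall j, f (ord_pred j) = f j) -> forall j j', f j = f j'.
Proof.
move=> fp; case: n f fp => [|n] f fp j j'; first by case: j.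
suff H k : forall j : 'I_n.+1, val j = k -> f j = f ord0 by rewrite !(H _ _ erefl).
elim: k => [|k IH] {}j jk; first by congr f; apply: val_inj.
rewrite -fp; apply: IH; rewrite /= jk addSn /= modnDr modn_small //.
by rewrite ltnW // -jk ltn_ord.
Qed.

Lemma next_invariant (I : Type) (g : D -> I) : (forall d, g (prev_end d) = g d) ->
  forall d d', foot d = foot d' -> g d = g d'.
Proof.
move=> gp [x j] [x' j']; rewrite /foot /= => E; move: j'; rewrite -E => j'.
by apply: (ord_pred_invariant
  (f := fun j => g (Tagged (fun x => 'I_(size (vertex_at x))) j))) => k;
  exact: (gp (Tagged (fun x => 'I_(size (vertex_at x))) k)).
Qed.

(** Going once around a vertex, g returns to its value, so the number of jumps there is even. *)
Lemma jumps_cycle g : g \in colourings -> jumps g \in cycles.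
Proof.
move=> gc; rewrite inE; apply/andP; split.
  by apply/subsetP => e; rewrite inE => /andP[].
apply/forallP => x; apply/eqP; rewrite /sign.
under eq_bigr do rewrite mem_jumps // signr_addb.
rewrite big_split /= (reindex_inj (can_inj next_endK)) /=.
rewrite -big_split big1 // => d _ /=; rewrite next_endK.
by rewrite -signr_addb addbb.
Qed.

Let nil_vertices : {set V} := [set x | nilp (vertex_at x)].

Lemma nilp_foot (d : D) : foot d \notin nil_vertices.
Proof.
by rewrite inE /nilp; case: d => x j; rewrite /foot /= -lt0n; case: (size _) j => [[]|].
Qed.

(** A fixed colouring for each possible set of jumps; subtracting it, as [shift] does, leaves a
    function without jumps, constant at each vertex. *)
Let repr h : {ffun D -> bool} :=
  if [pick g in colourings | jumps g == h] is Some g then g else [ffun=> false].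

Let shift g d : bool := g d (+) repr (jumps g) d.

Lemma reprP g : g \in colourings ->
  repr (jumps g) \in colourings /\ jumps (repr (jumps g)) = jumps g.
Proof.
rewrite /repr; case: pickP => [g' /andP[gc /eqP]//|/(_ g)].
by rewrite eqxx andbT => ->.
Qed.

Lemma shift_foot g d d' : g \in colourings -> foot d = foot d' -> shift g d = shift g d'.
Proof.
move=> gc; apply: next_invariant => {d'}d; have [rc rj] := reprP gc.
have := mem_jumps d gc; have := mem_jumps d rc; rewrite rj => ->; rewrite /shift.
by case: (g d); case: (g _); case: (repr _ d); case: (repr _ _).
Qed.

Lemma shift_band g d d' : g \in colourings -> band A d d' -> shift g d = shift g d'.
Proof.
move=> gc b; have [rc rj] := reprP gc.
have sp : shift g (prev_end d') = shift g d' by apply: shift_foot.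
have := gc; rewrite inE => /boundary_colouringP[_ /(_ _ _ b)[E _]].
have := rc; rewrite inE => /boundary_colouringP[_ /(_ _ _ b)[E' _]].
by rewrite /shift E E' /flag_colour /=; case: odd_bars => //=.
Qed.

(** A vertex without ends carries no flag; its value is free and is read off from the set in the
    second component. *)
Let disks (p : {ffun D -> bool} * {set V}) : {ffun V -> bool} :=
  [ffun x => if [pick d | foot d == x] is Some d then shift p.1 d else x \in p.2].

Lemma disks_foot g N d : g \in colourings -> disks (g, N) (foot d) = shift g d.
Proof.
move=> gc; rewrite ffunE; case: pickP => [d' /eqP|/(_ d)]; last by rewrite eqxx.
exact: shift_foot.
Qed.

Lemma leq_colourings :
  (#|colourings| * 2 ^ #|nil_vertices| <= #|cycles| * #|consts|)%N.
Proof.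
rewrite -card_powerset -!cardsX.
pose f (p : {ffun D -> bool} * {set V}) := (jumps p.1, disks p).
rewrite -(card_in_imset (f := f)); last first.
  case=> [g N] [g' N']; rewrite !in_setX /= => /andP[gc]; rewrite inE => NN.
  case/andP=> gc'; rewrite inE => NN' [] E /ffunP E'.
  congr pair.
    apply/ffunP => d; have := E' (foot d); rewrite !disks_foot // /shift E.
    by move/addIb.
  apply/setP => x; have [xN|xN] := boolP (x \in nil_vertices); last first.
    by rewrite (negPf (contra (subsetP NN x) xN)) (negPf (contra (subsetP NN' x) xN)).
  have := E' x; rewrite !ffunE; case: pickP => [d /eqP dx|//].
  by move: (nilp_foot d); rewrite dx xN.
apply/subset_leq_card/subsetP => q /imsetP[[g N]]; rewrite in_setX /= => /andP[gc _] ->.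
rewrite in_setX jumps_cycle //=; apply/constsP => d d' b.
by rewrite !disks_foot //; apply: shift_band.
Qed.

(** With v vertices the counts give v + b <= #|A| + 2k, and #|A| + k = n + v. *)
Lemma boundaries_leq :
  (surf_boundaries F A <= surf_components F A + surf_betti1 F A)%N.
Proof.
have cc : (#|consts| = 2 ^ surf_components F A)%N.
  by have := card_invariant_ffun bool band_rel_sym; rewrite card_bool.
have cb := card_boundary_colouring bool; rewrite card_bool in cb.
have cn : count (@nilp L) (vertices F) = #|nil_vertices|.
  rewrite -sum1_count big_tnth -sum1dep_card; exact: eq_bigl.
have := leq_mul (leqnn (2 ^ size (vertices F))) leq_colourings.
rewrite [X in (_ <= X)%N]mulnA card_cycles cc cb -!expnD leq_exp2l //.
rewrite /surf_boundaries cn; have := betti1E.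
set b := n_comp _ _; lia.
Qed.

End Genus.

End Surface.

Lemma prod_nat_bool (R : comPzSemiRingType) (S : finType) (E : {set S}) (P : pred S) :
  \prod_(s in E) (P s)%:R = [forall s in E, P s]%:R :> R.
Proof.
case: forall_inP => [H|H]; first by rewrite big1 // => s /H->.
have /existsP[s /andP[sE Ps]] : [exists s, (s \in E) && ~~ P s].
  apply: contraPT H; rewrite negb_exists => /forallP H; apply => s sE.
  by have := H s; rewrite sE negbK.
by rewrite (bigD1 s) //= (negPf Ps) mul0r.
Qed.

(** Here q is the weight of a vertex and y z that of a band; as q = (y z)^-1, they combine to (y
    z)^(n - k). Each component contributes - y z z and each boundary component N = z^-1. *)
Lemma euler_char_exponents (K : fieldType) (y z N q t : K) (k n b nil v m : nat) :
  q * (y * z) = 1 -> z * N = 1 -> (n + v = m + k)%N -> (b + nil <= k + n)%N ->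
  q ^+ v * N ^+ nil * ((y * z) ^+ m * ((- (y * z * z)) ^+ k * t * N ^+ b))
  = (-1) ^+ k * y ^+ n * z ^+ (k + n - (b + nil)) * t.
Proof.
move=> kz zN mE bl.
have zE : z ^+ (k + n - (b + nil)) = z ^+ (k + n) * N ^+ (b + nil).
  by rewrite -[in RHS](subnK bl) [in RHS]exprD -mulrA -exprMn zN expr1n mulr1.
have qE : q ^+ v * (y * z) ^+ m * (y * z) ^+ k = (y * z) ^+ n.
  by rewrite -mulrA -exprD -mE exprD mulrCA -exprMn kz expr1n mulr1.
have -> : - (y * z * z) = - 1 * (y * z) * z by ring.
rewrite zE !exprD !exprMn; rewrite !exprMn in qE.
transitivity (y ^+ n * z ^+ n * ((-1) ^+ k * z ^+ k * N ^+ b * N ^+ nil * t)).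
  by rewrite -qE; ring.
by ring.
Qed.

(** * Orientability by counting colourings *)

Section Orientation.

Variables (L : finType) (F : code L) (A : {set {set L}}).
Variables (Gamma : finType) (sigma : Gamma -> Gamma).

Local Notation V := 'I_(size (vertices F)).

Definition flip (c : bool) (u : Gamma) : Gamma := if c then sigma u else u.

Definition disk_colouring (f : {ffun V -> Gamma}) : bool :=
  [forall d : edge_end F, forall d', band A d d' ==>
     (f (foot d) == flip (odd_bars F (edge_of d)) (f (foot d')))].

Lemma card_disk_colouring_id : (forall u, sigma u = u) ->
  #|[set f | disk_colouring f]| = (#|Gamma| ^ surf_components F A)%N.
Proof.
move=> sid; rewrite -(card_invariant_ffun Gamma (@band_rel_sym L F A)).
apply: eq_card => f; rewrite !inE; apply/forallP/forallP => [H x|H d].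
  apply/forallP => x'; apply/implyP => /existsP[d /existsP[d' /and3P[/eqP<- /eqP<- b]]].
  have /forallP/(_ d')/implyP/(_ b) := H d.
  by rewrite /flip sid; case: ifP.
apply/forallP => d'; apply/implyP => b; rewrite /flip sid if_same.
have /forallP/(_ (foot d'))/implyP := H (foot d); apply.
by apply/existsP; exists d; apply/existsP; exists d'; rewrite !eqxx.
Qed.

Hypothesis sigmaK : involutive sigma.

(** An orientation o untwists the condition: applying sigma at the reversed disks turns these
    colourings into functions constant on components. Conversely a colouring gives an orientation,
    by choosing one element in each orbit of sigma. *)
Lemma card_disk_colouring_free : (forall u, sigma u != u) ->
  #|[set f | disk_colouring f]|
  = (if surf_orientable F A then #|Gamma| ^ surf_components F A else 0)%N.
Proof.
move=> sfree; case: ifP => [/existsP[o /forallP oA]|nor].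
  have {}oA d d' : band A d d' -> o (foot d) (+) o (foot d') = odd_bars F (edge_of d).
    by have /forallP/(_ d')/implyP := oA d => E /E/eqP.
  pose h (f : {ffun V -> Gamma}) : {ffun V -> Gamma} := [ffun x => flip (o x) (f x)].
  have hK : involutive h.
    by move=> f; apply/ffunP => x; rewrite !ffunE /flip; case: (o x).
  rewrite -(card_invariant_ffun Gamma (@band_rel_sym L F A)).
  rewrite -(card_imset _ (can_inj hK)); apply: eq_card => f.
  have E d d' : band A d d' -> (h f (foot d) == flip (odd_bars F (edge_of d)) (h f (foot d')))
      = (f (foot d) == f (foot d')).
    move=> /oA <-; rewrite !ffunE /flip; case: (o (foot d)); case: (o (foot d')) => //=.
    - by rewrite (inj_eq (can_inj sigmaK)).
    - by rewrite (inj_eq (can_inj sigmaK)).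
    by rewrite sigmaK.
  rewrite inE; apply/imsetP/forallP => [[f' f'c ff'] x|H].
    apply/forallP => x'.
    apply/implyP => /existsP[d /existsP[d' /and3P[/eqP<- /eqP<- b]]].
    rewrite -E // ff' hK.
    by move: f'c; rewrite inE => /forallP/(_ d)/forallP/(_ d')/implyP/(_ b).
  exists (h f); last by rewrite hK.
  rewrite inE; apply/forallP => d; apply/forallP => d'; apply/implyP => b.
  rewrite E //; have /forallP/(_ (foot d'))/implyP := H (foot d); apply.
  by apply/existsP; exists d; apply/existsP; exists d'; rewrite !eqxx.
apply/eqP; rewrite cards_eq0; apply/eqP/setP => f; rewrite !inE.
apply/negP => /forallP H; suff : surf_orientable F A by rewrite nor.
(* This marks one of the two elements of each orbit of sigma. *)
pose s u := (enum_rank u < enum_rank (sigma u))%N.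
have sN u : s (sigma u) = ~~ s u.
  by rewrite /s sigmaK -leqNgt [RHS]leq_eqVlt val_eqE (inj_eq enum_rank_inj)
    (negPf (sfree u)).
apply/existsP; exists [ffun x => s (f x)]; apply/forallP => d; apply/forallP => d'.
apply/implyP => b; have /forallP/(_ d')/implyP/(_ b)/eqP := H d.
by rewrite !ffunE => ->; rewrite /flip; case: odd_bars; rewrite ?sN; case: (s _).
Qed.

End Orientation.

(** * The state sum of a pure diagram *)

(* [entry x u] is the matrix of the basis element x in the component u of the
   tuple, and [swap] is the involution of the components in the action of a bar. *)
Record flag_model (K : fieldType) (X : finType) (y z w : K) (A : frobenius X y) :=
  FlagModel {
  bcol : finType;
  dcol : finType;
  entry : X -> dcol -> bcol -> bcol -> K;
  swap : dcol -> dcol;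
  kappa : K;
  swapK : involutive swap;
  swap_w : (forall u, swap u = u) /\ w = 1 \/ (forall u, swap u != u) /\ w = 0;
  fsign_sq : forall x, fsign A x * fsign A x = 1;
  sum_fsign : \sum_x fsign A x = - 1 - y * z * w;
  kappaE : kappa * (y * z) = 1;
  card_bcol : z * #|bcol|%:R = 1;
  card_dcol : - (y * z * z) = #|dcol|%:R;
  vertex_entries : forall n (f : 'I_n -> X), vertex_wt A (codom f)
    = kappa * #|bcol|%:R ^+ (n == 0) * \sum_u \sum_(i : {ffun 'I_n -> bcol})
        \prod_j entry (f j) u (i (ord_pred j)) (i j);
  sum_entries : forall s u u' i j i' j',
    \sum_x fsign A x ^+ nat_of_bool s * (entry x u i j * entry x u' i' j')
    = y * z * [&& u == flip swap s u', j == (if s then j' else i')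
                & i == (if s then i' else j')]%:R
      + ((i == j) && (i' == j'))%:R
}.

Section SurfaceTerm.

Variables (K : fieldType) (X : finType) (y z w : K) (A : frobenius X y).
Variable M : flag_model z w A.
Variables (L : finType) (F : code L).
Hypothesis two_endsF : two_ends F.
Hypothesis pureF : crossings F = [::].

Local Notation D := (edge_end F).
Local Notation I := (bcol M).
Local Notation G := (dcol M).

Lemma surface_term (B : {set {set L}}) : B \subset edges F ->
  kappa M ^+ size (vertices F) * #|I|%:R ^+ count (@nilp L) (vertices F)
  * ((y * z) ^+ #|B|
     * (#|[set f | disk_colouring (F := F) B (@swap _ _ _ _ _ _ M) f]|%:R
        * #|[set g : {ffun D -> I} | boundary_colouring B g]|%:R))
  = Mpoly F B y z w.
Proof.
move=> BF; rewrite card_boundary_colouring natrX.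
have -> : #|[set f | disk_colouring (F := F) B (@swap _ _ _ _ _ _ M) f]|%:R
    = #|G|%:R ^+ surf_components F B * w ^+ (~~ surf_orientable F B) :> K.
  case: (swap_w M) => [[sw wE]|[sw wE]].
    have -> : w ^+ (~~ surf_orientable F B) = 1 by rewrite wE expr1n.
    by rewrite card_disk_colouring_id // natrX mulr1.
  have -> : w ^+ (~~ surf_orientable F B) = (surf_orientable F B)%:R.
    by rewrite wE; case: surf_orientable.
  rewrite card_disk_colouring_free //; last exact: swapK.
  by case: surf_orientable; rewrite ?natrX /= ?mulr1 ?mulr0.
have bl := boundaries_leq two_endsF pureF BF.
have bE := betti1E two_endsF pureF BF.
rewrite /Mpoly -card_dcol.
exact: euler_char_exponents (kappaE M) (card_bcol M) bE bl.
Qed.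

End SurfaceTerm.

Section StateSum.

Variables (K : fieldType) (X : finType) (y z w : K) (A : frobenius X y).
Variable M : flag_model z w A.
Variables (L : finType) (F : code L) (a : K).
Hypothesis two_endsF : two_ends F.
Hypothesis pureF : crossings F = [::].

Local Notation D := (edge_end F).
Local Notation V := 'I_(size (vertices F)).
Local Notation I := (bcol M).
Local Notation G := (dcol M).
Local Notation sg := (fsign A).
Local Notation swap := (@swap _ _ _ _ _ _ M).
Local Notation kappa := (kappa M).
Local Notation entry := (@entry _ _ _ _ _ _ M).

Let strands : {set {set L}} := [set strand F l | l : L].
Let ST := {s : {set L} | s \in strands}.

Let strP l : strand F l \in strands.
Proof. exact: imset_f. Qed.

Let str (l : L) : ST := exist _ (strand F l) (strP l).

(** Colourings of the arcs that respect all links are colourings of the strands. *)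
Lemma sum_compat (V' : nmodType) (H : (L -> X) -> V') :
  (forall c c', c =1 c' -> H c = H c') ->
  \sum_(c : {ffun L -> X} | all (fun l => c l.1 == c l.2) (links F)) H c
  = \sum_(g : {ffun ST -> X}) H (fun l => g (str l)).
Proof.
move=> Hext.
have lab (s : ST) : {l : L | str l = s}.
  suff [l /eqP sl] : {l | str l == s} by exists l.
  apply: sigW; case: s => s sS; have /imsetP[l _ sl] := sS.
  by exists l; apply/eqP/val_inj.
pose rep s := sval (lab s).
have repK s : str (rep s) = s by rewrite /rep; case: (lab s).
rewrite (reindex_onto (fun g : {ffun ST -> X} => [ffun l => g (str l)])
  (fun c => [ffun s => c (rep s)])) /=.
  apply: eq_big => [g|g _]; last by apply: Hext => l; rewrite ffunE.
  apply/andP; split; last by apply/eqP/ffunP => s; rewrite !ffunE repK.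
  apply/compatP => l l' ll'; rewrite !ffunE; congr (g _); apply: val_inj.
  by apply/eqP; rewrite /= eq_strand.
move=> c /compatP cc; apply/ffunP => l; rewrite !ffunE; apply/esym/cc.
by have /(congr1 val)/= E := repK (str l); rewrite -E strand_refl.
Qed.

Lemma wt_pure (c : L -> X) :
  wt A a (relabel c F)
  = if all (fun l => c l.1 == c l.2) (links F) then
      \prod_(b <- bars F) sg (c b.1) * \prod_(v <- vertices F) vertex_wt A (map c v)
    else 0.
Proof.
have pts (ls : seq (L * L)) : \prod_(p <- map (pair_map c) ls) point_wt K p
    = (all (fun l => c l.1 == c l.2) ls)%:R.
  elim: ls => [|l ls IH]; rewrite ?big_nil //= big_cons IH /point_wt /delta /=.
  by case: (_ == _); rewrite ?mul1r ?mul0r.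
have vts (qs : seq (quad L)) : \prod_(q <- map (quad_map c) qs) virtual_wt K q
    = (all (fun l => c l.1 == c l.2) (flatten [seq (let: (sw, se, ne, nw) := q in
         [:: (sw, ne); (se, nw)]) | q <- qs]))%:R.
  elim: qs => [|[[[sw se] ne] nw] qs IH]; rewrite ?big_nil //= big_cons IH /=.
  by rewrite /virtual_wt /delta; do 2![case: (_ == _)]; rewrite ?mul1r ?mul0r.
have bts (ls : seq (L * L)) : \prod_(p <- map (pair_map c) ls) bar_wt A p
    = \prod_(b <- ls) sg (c b.1) * (all (fun l => c l.1 == c l.2) ls)%:R.
  elim: ls => [|l ls IH]; rewrite ?big_nil /= ?mulr1 // !big_cons IH /bar_wt /point_wt /delta /=.
  by case: (_ == _); rewrite ?mulr1 ?mulr0 ?mul0r ?mulrA.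
rewrite /wt /= pureF /= big_nil mulr1 pts vts bts /links !all_cat big_map.
case: (all _ (bars F)); case: (all _ (points F)); case: (all _ (flatten _)) => /=;
  rewrite ?mulr0 ?mul0r ?mulr1 //; exact: mulrC.
Qed.

Lemma prod_bars (g : {ffun ST -> X}) :
  \prod_(b <- bars F) sg (g (str b.1)) = \prod_(s : ST) sg (g s) ^+ odd_bars F (val s).
Proof.
rewrite (partition_big (fun b : L * L => str b.1) xpredT) //=.
apply: eq_bigr => s _.
have sgE n : sg (g s) ^+ n = sg (g s) ^+ odd n.
  rewrite -{1}(odd_double_half n) exprD -mul2n exprM expr2 (fsign_sq M) expr1n.
  by rewrite mulr1.
rewrite (eq_bigr (fun _ => sg (g s))) => [|b /eqP->//].
rewrite -big_filter big_const_seq count_predT iter_mulr_1 sgE size_filter.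
rewrite /odd_bars; congr (_ ^+ nat_of_bool (odd _)); apply: eq_count => b /=.
have /imsetP[l _ sl] := valP s; rewrite -val_eqE /= sl eq_sym eq_strand.
by [].
Qed.

(** The matrix indices summed in the traces at the single vertices are collected into one index u
    per disk and one index g per arc between consecutive ends. *)
Lemma prod_vertices (c : L -> X) :
  \prod_(v <- vertices F) vertex_wt A (map c v)
  = kappa ^+ size (vertices F) * #|I|%:R ^+ count (@nilp L) (vertices F)
    * \sum_(u : {ffun V -> G}) \sum_(g : {ffun D -> I})
        \prod_(d : D) entry (c (label d)) (u (foot d)) (g (prev_end d)) (g d).
Proof.
have codE (v : seq L) : map c v = codom (fun j => c (tnth (in_tuple v) j)).
  transitivity (map c (map (tnth (in_tuple v)) (enum 'I_(size v)))).
    by rewrite map_tnth_enum.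
  by rewrite -(map_comp c).
rewrite big_tnth.
under eq_bigr => x _ do rewrite codE (vertex_entries M).
rewrite big_split big_split /= prodr_const card_ord; congr (_ * _ * _).
  rewrite -expr_sum; congr (_ ^+ _); rewrite -sum1_count [RHS]big_tnth [RHS]big_mkcond.
  by apply: eq_bigr => x _; rewrite /nilp; case: eqP.
rewrite bigA_distr_bigA; apply: eq_bigr => u _ /=.
rewrite (prod_sum_tagged (fun x (f : {ffun 'I_(size (vertex_at x)) -> I}) =>
  \prod_j entry (c (tnth (in_tuple (vertex_at x)) j)) (u x) (f (ord_pred j)) (f j))).
apply: eq_bigr => g _.
have E := @sig_big_dep K 1 *%R V (fun x => 'I_(size (vertex_at x))) xpredT
  (fun _ _ => true) (fun x j => entry (c (tnth (in_tuple (vertex_at x)) j)) (u x)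
    (g (Tagged (fun x => 'I_(size (vertex_at x))) (ord_pred j)))
    (g (Tagged (fun x => 'I_(size (vertex_at x))) j))).
transitivity (\prod_(x : V) \prod_(j < size (vertex_at x))
  entry (c (tnth (in_tuple (vertex_at x)) j)) (u x)
    (g (Tagged (fun x => 'I_(size (vertex_at x))) (ord_pred j)))
    (g (Tagged (fun x => 'I_(size (vertex_at x))) j))).
  by apply: eq_bigr => x _; apply: eq_bigr => j _; rewrite !ffunE.
by rewrite E; apply: eq_big => // -[x j] _.
Qed.

(** The contribution of one strand, an edge or a circle, for fixed matrix indices: the sum over its
    colour. *)
Let crossing_weight (s : {set L}) (u : {ffun V -> G}) (g : {ffun D -> I}) : K :=
  \sum_x sg x ^+ odd_bars F s
    * \prod_(d : D | edge_of d == s) entry x (u (foot d)) (g (prev_end d)) (g d).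

(** For fixed indices each factor involves the colour of a single strand, so the sum over colours
    factorises. *)
Lemma Zsum_strands :
  Zsum A a F = kappa ^+ size (vertices F) * #|I|%:R ^+ count (@nilp L) (vertices F)
    * \sum_(u : {ffun V -> G}) \sum_(g : {ffun D -> I})
        \prod_(s in strands) crossing_weight s u g.
Proof.
rewrite /Zsum; under eq_bigr do rewrite wt_pure.
rewrite -big_mkcond (sum_compat (H := fun c : L -> X =>
  \prod_(b <- bars F) sg (c b.1) * \prod_(v <- vertices F) vertex_wt A (map c v)));
  last first.
  move=> c c' cc; congr (_ * _); apply: eq_bigr => v _; first by rewrite cc.
  by rewrite (eq_map cc).
under eq_bigr do rewrite prod_bars prod_vertices mulrCA.
rewrite -mulr_sumr; congr (_ * _).
under eq_bigr do rewrite mulr_sumr; rewrite exchange_big; apply: eq_bigr => u _ /=.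
under eq_bigr do rewrite mulr_sumr; rewrite exchange_big; apply: eq_bigr => g _ /=.
rewrite [RHS]big_sub /crossing_weight /= bigA_distr_bigA; apply: eq_bigr => h _ /=.
rewrite big_split /=; congr (_ * _).
rewrite (partition_big (fun d : D => str (label d)) xpredT) //=.
by apply: eq_bigr => s _; apply: eq_big => [d|d /eqP->].
Qed.

Lemma edges_strands : edges F \subset strands.
Proof. by apply/subsetP => e /imsetP[d _ ->]; apply: imset_f. Qed.

Lemma circle_weight s u g : s \in circles F ->
  crossing_weight s u g = if odd_bars F s then - 1 - y * z * w else - 1 - y.
Proof.
rewrite inE => /andP[sE _]; rewrite /crossing_weight.
have sd : (fun d : D => edge_of d == s) =1 xpred0.
  by move=> d; apply/eqP => ds; case/negP: sE; rewrite -ds; apply: imset_f.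
under eq_bigr do rewrite (eq_bigl _ _ sd) big_pred0_eq mulr1.
case: odd_bars => /=; first by rewrite -(sum_fsign M); apply: eq_bigr.
have := congr1 (ftr A) (fbasis_sq A); rewrite raddf_sum /= ftr_iota.
rewrite opprD addrC => <-; apply: eq_bigr => x _.
by rewrite expr0 fbasis_on eqxx.
Qed.

(** The condition for a band along s: component indices agree up to the involution, and matrix
    indices continue along both sides of the band. The alternative [absent] continues them along the
    disk. *)
Let present (s : {set L}) (u : {ffun V -> G}) (g : {ffun D -> I}) : bool :=
  [forall d : D, forall d' : D, band [set s] d d' ==>
    [&& u (foot d) == flip swap (odd_bars F s) (u (foot d')),
        g d == flag_colour g (d', odd_bars F s)
      & g (prev_end d) == flag_colour g (d', ~~ odd_bars F s)]].

Let absent (s : {set L}) (g : {ffun D -> I}) : bool :=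
  [forall d : D, (edge_of d == s) ==> (g (prev_end d) == g d)].

Lemma edge_weight s u g : s \in edges F ->
  crossing_weight s u g = y * z * (present s u g)%:R + (absent s g)%:R.
Proof.
move=> sE.
have sE1 : [set s] \subset edges F by rewrite sub1set.
have [d1 [d2 [d12 E _ b]]] := band_ends two_endsF pureF sE1 (set11 s).
have e1 : edge_of d1 = s by apply/eqP; rewrite E eqxx.
rewrite /crossing_weight; under eq_bigr => x _.
  rewrite (eq_bigl _ _ E) (bigD1 d1) ?eqxx //= (bigD1 d2) /=; last first.
    by rewrite eqxx orbT eq_sym.
  rewrite big1 ?mulr1 => [|d]; last by case: eqP; case: eqP.
  over.
rewrite sum_entries; congr (_ * (nat_of_bool _)%:R + (nat_of_bool _)%:R).
  rewrite /present; apply/idP/forallP => [H d|/(_ d1)/forallP/(_ d2)/implyP/(_ b)]; last first.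
    by rewrite /flag_colour /=; case: odd_bars.
  apply/forallP => d'; apply/implyP => /and3P[dd' /eqP ed ds].
  have := E d; have := E d'; rewrite -ed; move: ds; rewrite inE => ->.
  case/esym/orP=> /eqP d'E /esym/orP[]/eqP dE; move: dd' H;
    rewrite dE d'E ?eqxx // /flag_colour => _ /and3P[/eqP u12 /eqP g12 /eqP p12].
    rewrite u12 p12 /= -[g d2]/(g d2) in g12 *; move: g12 p12 u12.
    by case: odd_bars => /= g12 p12 u12; rewrite /flip ?swapK ?g12 ?p12 ?eqxx.
  move: u12 g12 p12; rewrite /=.
  by case: odd_bars => /= -> -> ->; rewrite !eqxx.
rewrite /absent; apply/andP/forallP => [[H1 H2] d|H].
  by rewrite E; apply/implyP => /orP[]/eqP->.
by have := H d1; have := H d2; rewrite !E !eqxx orbT.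
Qed.

(** Expanding the product over the edges, the term of B counts pairs of a disk colouring and a
    boundary colouring of the surface of B, which [surface_term] evaluates. *)
Lemma Qpoly_Zsum : Qpoly F y z w = Zsum A a F.
Proof.
rewrite Zsum_strands; symmetry.
have circ (u : {ffun V -> G}) (g : {ffun D -> I}) :
    \prod_(s in circles F) crossing_weight s u g
    = (- 1 - y) ^+ #|[set c in circles F | ~~ odd_bars F c]|
      * (- 1 - y * z * w) ^+ #|[set c in circles F | odd_bars F c]|.
  under eq_bigr => s sc do rewrite circle_weight //.
  rewrite (bigID (odd_bars F)) /= mulrC; congr (_ * _).
    rewrite (eq_bigr (fun _ => - 1 - y)) => [|s /andP[_ /negPf->]//].
    by rewrite -prodr_const; apply: eq_bigl => s; rewrite !inE.
  rewrite (eq_bigr (fun _ => - 1 - y * z * w)) => [|s /andP[_ ->]//].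
  by rewrite -prodr_const; apply: eq_bigl => s; rewrite !inE.
under eq_bigr => u _ do under eq_bigr => g _ do
  rewrite (big_setID (edges F)) /= (setIidPr edges_strands) -/(circles F) circ mulrC.
under eq_bigr do rewrite -mulr_sumr.
rewrite -mulr_sumr mulrCA /Qpoly; congr (_ * _).
under eq_bigr => u _ do under eq_bigr => g _ do
  rewrite (eq_bigr _ (fun s sE => edge_weight u g sE)) prodD_subset.
under eq_bigr do rewrite exchange_big.
rewrite exchange_big mulr_sumr; apply: eq_bigr => B BF /=.
rewrite -(surface_term M two_endsF pureF BF); congr (_ * _).
have cardE (T : finType) (P : pred T) : #|[set x | P x]|%:R = \sum_x (P x)%:R :> K.
  rewrite -sum1dep_card natr_sum [LHS]big_mkcond.
  by apply: eq_bigr => x _; case: (P x).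
rewrite !cardE mulr_suml mulr_sumr; apply: eq_bigr => u _.
rewrite mulr_sumr mulr_sumr; apply: eq_bigr => g _.
rewrite big_split prodr_const /= !prod_nat_bool -mulrA; congr (_ * _).
rewrite -!natrM !mulnb; congr (nat_of_bool _)%:R.
apply/andP/andP => [[/forall_inP H1 /forall_inP H2]|[/forallP H1 /boundary_colouringP[H2 H3]]].
  have H d d' : band B d d' ->
      [&& u (foot d) == flip swap (odd_bars F (edge_of d)) (u (foot d')),
          g d == flag_colour g (d', odd_bars F (edge_of d))
        & g (prev_end d) == flag_colour g (d', ~~ odd_bars F (edge_of d))].
    move=> /and3P[dd' ed dB]; have /forallP/(_ d)/forallP/(_ d')/implyP := H1 _ dB.
    by apply; rewrite /band dd' ed set11.
  split.
    apply/forallP => d; apply/forallP => d'; apply/implyP => b.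
    by case/and3P: (H _ _ b).
  apply/boundary_colouringP; split=> [d dB|d d' /H/and3P[_ /eqP ? /eqP ?]] //.
  have dE : edge_of d \in edges F :\: B by rewrite inE dB; apply: imset_f.
  by have /forallP/(_ d) := H2 _ dE; rewrite eqxx => /eqP.
split; apply/forall_inP => s sB; apply/forallP => d.
  apply/forallP => d'; apply/implyP => /and3P[dd' ed]; rewrite inE => /eqP ds.
  have b : band B d d' by rewrite /band dd' ed ds.
  have [-> ->] := H3 _ _ b; rewrite ds !eqxx /= andbT.
  by have /forallP/(_ d')/implyP/(_ b) := H1 d; rewrite ds.
apply/implyP => /eqP ds; apply/eqP/H2; rewrite ds.
by move: sB; rewrite inE => /andP[].
Qed.

End StateSum.

(** * States, and R as a state sum *)

Lemma sum_tuple_nsum (V : nmodType) (T : finType) n (H : seq T -> V) :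
  \sum_(s : n.-tuple T) H s = nsum n H.
Proof.
rewrite -sum_ffun_nsum (reindex (fun f : {ffun 'I_n -> T} => mktuple f)).
  by apply: eq_bigr.
exists (fun s : n.-tuple T => [ffun j => tnth s j]) => [f|s] _.
  by apply/ffunP => j; rewrite ffunE tnth_mktuple.
by apply: eq_from_tnth => j; rewrite tnth_mktuple ffunE.
Qed.

Lemma two_ends_state (L : finType) (E : code L) s :
  two_ends E -> two_ends (@state L E s).
Proof.
move=> /forallP H; apply/forallP => l; rewrite -(eqP (H l)) /nodes /=.
have sE : size s = size (crossings E) by rewrite size_tuple.
have cE (t : seq spin) (cs : seq (quad L)) : size t = size cs ->
    count_mem l (flatten [seq quad_seq i | i <- cs])
    = (count_mem l (flatten (flatten [seq spin_vertices i | i <- zip t cs]))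
       + count_mem l (flatten [seq pair_seq i | i <- flatten [seq spin_arcs i | i <- zip t cs]]))%N.
  elim: t cs => [|x t IH] [|c cs] //= [/IH E'].
  rewrite !count_cat E' flatten_cat !map_cat !flatten_cat !count_cat.
  by case: c => [[[sw se] ne] nw]; case: x => [[]|] /=; lia.
rewrite !flatten_cat !map_cat !flatten_cat !count_cat (cE _ _ sE).
by do 6![set n := count_mem l _; move: n => ?]; apply/eqP; lia.
Qed.

Section Rpoly.

Variables (K : fieldType) (X : finType) (z w a : K).
Variable A : frobenius X (- a - 2 - a^-1).
Hypothesis a0 : a != 0.

(** The three terms of [crossing_wt] correspond to the three spins. *)
Lemma prod_crossing_wt (cs : seq (quad X)) :
  \prod_(q <- cs) crossing_wt A a q
  = nsum (size cs) (fun s : seq spin =>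
      a ^ ((count_mem (Some true) s)%:Z - (count_mem (Some false) s)%:Z)
      * (\prod_(v <- flatten (map (@spin_vertices X) (zip s cs))) vertex_wt A v
         * \prod_(p <- flatten (map (@spin_arcs X) (zip s cs))) point_wt K p)).
Proof.
elim: cs => [|q cs IH] /=; first by rewrite !big_nil subrr expr0z !mulr1.
rewrite big_cons IH.
have -> : crossing_wt A a q = \sum_(x : spin)
    a ^ ((Some true == x)%:Z - (Some false == x)%:Z)
    * (\prod_(v <- spin_vertices (x, q)) vertex_wt A v
       * \prod_(p <- spin_arcs (x, q)) point_wt K p).
  case: q => [[[sw se] ne] nw].
  rewrite (bigD1 None) // (bigD1 (Some true)) // (bigD1 (Some false)) //=.
  rewrite [X in _ = _ + (_ + (_ + X))]big1; last by case=> [[]|].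
  rewrite addr0 !big_cons !big_nil /point_wt /=.
  rewrite expr0z subr0 sub0r expr1z exprN1.
  by rewrite /crossing_wt; ring.
rewrite mulr_suml; apply: eq_bigr => x _; rewrite mulr_nsumr.
apply: eq_nsum => s _; rewrite !big_cat /= !PoszD.
rewrite (_ : _ + _ - _ = ((Some true == x)%:Z - (Some false == x)%:Z)
   + ((count_mem (Some true) s)%:Z - (count_mem (Some false) s)%:Z)); last first.
  by rewrite !(eq_sym x); ring.
by rewrite [in RHS]expfzDr //; ring.
Qed.

Lemma wt_state (L : finType) (E : code L) (c : L -> X) :
  wt A a (relabel c E)
  = \sum_(s : (size (crossings E)).-tuple (option bool))
      a ^ ((count_mem (Some true) s)%:Z - (count_mem (Some false) s)%:Z)
      * wt A a (relabel c (state s)).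
Proof.
rewrite /wt /= prod_crossing_wt size_map.
rewrite -sum_tuple_nsum.
rewrite mulr_sumr !mulr_suml; apply: eq_bigr => s _.
have zE (t : seq spin) (cs : seq (quad L)) :
   (map (map c) (flatten (map (@spin_vertices L) (zip t cs)))
      = flatten (map (@spin_vertices X) (zip t (map (quad_map c) cs)))) *
   (map (pair_map c) (flatten (map (@spin_arcs L) (zip t cs)))
      = flatten (map (@spin_arcs X) (zip t (map (quad_map c) cs)))).
  elim: t cs => [|x t IH] [|[[[sw se] ne] nw] cs] //=.
  by rewrite !map_cat !IH; case: x => [[]|].
rewrite !map_cat !big_cat !zE /= big_nil.
by ring.
Qed.

Lemma Rpoly_Zsum (L : finType) (E : code L) (M : flag_model z w A) : two_ends E ->
  Rpoly E a z w = Zsum A a E.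
Proof.
move=> tE; rewrite /Zsum; under [RHS]eq_bigr do rewrite wt_state.
rewrite exchange_big; apply: eq_bigr => s _ /=.
rewrite -mulr_sumr; congr (_ * _); apply: Qpoly_Zsum => //.
exact: two_ends_state.
Qed.

End Rpoly.

(** * Pauli matrices *)

Section TraceProduct.

Variables (R : comPzRingType) (n : nat).
Implicit Types (Ms : seq 'M[R]_n) (p : seq 'I_n).

Fixpoint path_wt (i : 'I_n) Ms p : R :=
  match Ms, p with
  | B :: Ms', j :: p' => B i j * path_wt j Ms' p'
  | _, _ => 1
  end.

Lemma prod_mx_path Ms i k :
  (\prod_(B <- Ms) B) i k
  = nsum (size Ms) (fun p => (last i p == k)%:R * path_wt i Ms p).
Proof.
elim: Ms i => [|B Ms IH] i; first by rewrite big_nil /= mxE mulr1.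
rewrite big_cons -mulmxE mxE; apply: eq_bigr => j _.
rewrite IH mulr_nsumr; apply: eq_nsum => p _ /=; ring.
Qed.

Lemma path_wtE x0 i Ms p m : size Ms = m -> size p = m ->
  path_wt i Ms p
  = \prod_(j < m) (nth 0 Ms j) (nth x0 (i :: p) j) (nth x0 p j).
Proof.
elim: m i Ms p => [|m IH] i [|B Ms] [|j p] //=; first by rewrite big_ord0.
by move=> [sM] [sp]; rewrite big_ord_recl /= IH.
Qed.

(** The trace is a sum over closed paths of indices. For m = 0 the sum has one term, the empty
    function, while the trace of 1 is n; hence the extra factor. *)
Lemma trace_prod m (f : 'I_m -> 'M[R]_n) :
  \tr (\prod_(B <- codom f) B)
  = n%:R ^+ (m == 0)%N
    * \sum_(i : {ffun 'I_m -> 'I_n}) \prod_j (f j) (i (ord_pred j)) (i j).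
Proof.
case: m f => [|m] f.
  have -> : codom f = [::] by apply: size0nil; rewrite size_codom card_ord.
  rewrite big_nil mxtrace1 (eq_bigr (fun _ => 1)) => [|i _]; last by rewrite big_ord0.
  by rewrite sumr_const card_ffun !card_ord expn0 mulr1.
rewrite mul1r /mxtrace (eq_bigr _ (fun i _ => prod_mx_path (codom f) i i)).
rewrite exchange_nsum size_codom card_ord.
transitivity (nsum m.+1 (fun p => if p is i :: _ then
    \prod_(j < m.+1) (f j) (nth i p (ord_pred j)) (nth i p j) else 0)); last first.
  rewrite -sum_ffun_nsum; apply: eq_bigr => c _.
  case E : (codom c) => [|i p]; last first.
    by apply: eq_bigr => j _; rewrite -E !nth_codom.
  by have := size_codom c; rewrite E card_ord.
apply: eq_nsum => -[//|i p] [sp].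
rewrite (bigD1 (last i p)) //= eqxx mul1r big1 => [|k]; last first.
  by rewrite eq_sym => /negPf->; rewrite mul0r.
rewrite addr0 (path_wtE i _ (m := m.+1)) ?size_codom ?card_ord //=; last by rewrite sp.
apply: eq_bigr => j _; rewrite nth_codom; congr (f j _ _).
case: j => -[|j] jm /=.
  by rewrite modn_small // (last_nth i) sp.
by rewrite modnDr modn_small // ltnW.
Qed.

End TraceProduct.

(** * Characters of an elementary abelian 2-group *)

Section Characters.

Variables (K : fieldType) (r : nat).
Local Notation B := {ffun 'I_r -> bool}.
Implicit Types f g h : B.

Definition xorf f g : B := [ffun i => f i (+) g i].
Definition zerof : B := [ffun=> false].
Definition chi f g : K := \prod_i (-1) ^+ (f i && g i).

Lemma chiDl f g h : chi (xorf f g) h = chi f h * chi g h.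
Proof.
rewrite -big_split; apply: eq_bigr => i _ /=; rewrite ffunE -signr_addb.
by case: (f i); case: (g i); case: (h i).
Qed.

Lemma chiC f g : chi f g = chi g f.
Proof. by apply: eq_bigr => i _; rewrite andbC. Qed.

Lemma chiDr f g h : chi f (xorf g h) = chi f g * chi f h.
Proof. by rewrite !(chiC f) chiDl. Qed.

Lemma chi_sq f g : chi f g * chi f g = 1.
Proof. by rewrite -big_split big1 // => i _ /=; rewrite -signr_addb addbb. Qed.

Lemma chi0 f : chi zerof f = 1.
Proof. by rewrite /chi big1 // => i _; rewrite ffunE. Qed.

Lemma sum_chi f : \sum_g chi f g = #|B|%:R * (f == zerof)%:R.
Proof.
rewrite -(bigA_distr_bigA (fun i c => (-1) ^+ (f i && c))).
case: eqP => [->|/eqP f0].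
  rewrite (eq_bigr (fun _ => 2)) => [|i _]; last by rewrite big_bool ffunE.
  by rewrite prodr_const card_ffun card_bool natrX mulr1.
have /existsP[i fi] : [exists i, f i].
  apply: contraNT f0; rewrite negb_exists => /forallP H; apply/eqP/ffunP => i.
  by rewrite [RHS]ffunE; apply: negbTE; apply: (H i).
by rewrite (bigD1 i) //= big_bool /= fi expr1 expr0 addNr mul0r mulr0.
Qed.

Lemma xorfA : associative xorf.
Proof. by move=> f g h; apply/ffunP => i; rewrite !ffunE addbA. Qed.

Lemma xorfC : commutative xorf.
Proof. by move=> f g; apply/ffunP => i; rewrite !ffunE addbC. Qed.

Lemma xorff f : xorf f f = zerof.
Proof. by apply/ffunP => i; rewrite !ffunE addbb. Qed.

Lemma xorf0 f : xorf f zerof = f.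
Proof. by apply/ffunP => i; rewrite !ffunE addbF. Qed.

Lemma xor0f f : xorf zerof f = f.
Proof. by rewrite xorfC xorf0. Qed.

Lemma xorfK f : involutive (xorf^~ f).
Proof. by move=> g; rewrite -xorfA xorff xorf0. Qed.

Lemma xorf_eq f g h : (xorf f g == h) = (f == xorf h g).
Proof. by rewrite -(inj_eq (can_inj (xorfK g))) xorfK. Qed.

Lemma xorf_eq0 f g : (xorf f g == zerof) = (f == g).
Proof. by rewrite xorf_eq xorfC xorf0. Qed.

End Characters.

Arguments zerof {r}.

Section Pauli.

Variables (r m : nat) (g0 : {ffun 'I_m -> bool}).
Local Notation K := algC.
Local Notation B := {ffun 'I_r -> bool}.
Local Notation C := {ffun 'I_m -> bool}.
Local Notation chi := (chi K).
Local Notation N := (#|B|%:R : K).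
Local Notation q := (#|C|%:R : K).

Let Y := (B * B * C)%type.
Implicit Types (x : Y) (u v s t : B) (c d : C).

(* The phase is chosen so that the matrices below square to -1, which has trace 1. *)
Definition phase u v : K := if chi u v == 1 then 'i else 1.

Lemma chi_pm n (f g : {ffun 'I_n -> bool}) : chi f g = 1 \/ chi f g = -1.
Proof.
have /eqP := chi_sq K f g; rewrite -expr2 sqrf_eq1.
by case/orP=> /eqP; auto.
Qed.

Lemma phase_sq u v : phase u v * phase u v = - chi u v.
Proof.
rewrite /phase; case: (chi_pm u v) => ->; first by rewrite eqxx -expr2 sqrCi.
have -> : (-1 == 1 :> K) = false by apply/negbTE; rewrite eqNr oner_eq0.
by rewrite mulr1 opprK.
Qed.

(** For x = (u, v, d): the entry (s, t) in the component c of translation by u followed by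
    multiplication with the character v, weighted with the character d of the components. *)
Definition pauli x c s t : K :=
  phase x.1.1 x.1.2 * chi x.2 c * (t == xorf s x.1.1)%:R * chi x.1.2 t.

(** Transposing the matrix multiplies it by [chi u v], and moving from the component c to c + g0 by
    [chi d g0]; the sign is the eigenvalue of both together. *)
Definition pauli_sign x : K := chi x.1.1 x.1.2 * chi x.2 g0.

Lemma pauli_sign_sq x : pauli_sign x * pauli_sign x = 1.
Proof. by rewrite /pauli_sign mulrACA !chi_sq mulr1. Qed.

Lemma natr_andb (a b : bool) : (a && b)%:R = a%:R * b%:R :> K.
Proof. by case: a; rewrite ?mul1r ?mul0r. Qed.

Lemma sum_eq_xorf (F : B -> K) s t : \sum_u (t == xorf s u)%:R * F u = F (xorf s t).
Proof.
rewrite (bigD1 (xorf s t)) //= big1 ?addr0 => [|u].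
  by rewrite xorfA xorff xorfC xorf0 eqxx mul1r.
rewrite eq_sym [_ == xorf s u]eq_sym (xorfC s u) xorf_eq (xorfC t) => ut.
by rewrite eq_sym (negPf ut) mul0r.
Qed.

(** Completeness of the Pauli matrices. The sums over the two characters give Kronecker deltas, and
    the sign transposes one factor and shifts its component. *)
Lemma sum_pauli (b : bool) c c' s t s' t' :
  \sum_(x : Y) pauli_sign x ^+ b * (pauli x c s t * pauli x c' s' t')
  = - (q * N) * [&& c == (if b then xorf c' g0 else c'), t == (if b then t' else s')
                  & s == (if b then s' else t')]%:R.
Proof.
(* The square of the phase leaves a factor [chi u v]; the sign cancels it if b holds, and otherwise
   it shifts the argument of the character v by u. *)
pose u0 := if b then (fun=> zerof) else id : B -> B.
have termE x : pauli_sign x ^+ b * (pauli x c s t * pauli x c' s' t')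
    = - ((t == xorf s x.1.1)%:R * (t' == xorf s' x.1.1)%:R
         * chi (xorf (u0 x.1.1) (xorf t t')) x.1.2
         * chi (xorf (xorf c c') (if b then g0 else zerof)) x.2).
  rewrite /pauli; set p := phase _ _.
  transitivity (pauli_sign x ^+ b * (p * p) * ((t == xorf s x.1.1)%:R
     * (t' == xorf s' x.1.1)%:R * (chi x.2 c * chi x.2 c')
     * (chi x.1.2 t * chi x.1.2 t'))); first by ring.
  rewrite phase_sq !chiDl /pauli_sign /u0 !(chiC _ _ x.1.2) !(chiC _ _ x.2).
  have := chi_sq K x.1.2 x.1.1.
  case: b {u0} => /= w2; last by rewrite [chi x.2 zerof]chiC chi0; ring.
  rewrite [chi x.1.2 zerof]chiC chi0; move: w2; set w := chi x.1.2 x.1.1 => w2.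
  transitivity (- (w * w) * ((t == xorf s x.1.1)%:R * (t' == xorf s' x.1.1)%:R
      * (chi x.1.2 t * chi x.1.2 t') * (chi x.2 c * chi x.2 c' * chi x.2 g0))).
    by ring.
  by rewrite w2; ring.
under eq_bigr do rewrite termE.
rewrite sumrN mulNr; congr (- _).
transitivity (\sum_u \sum_v \sum_d ((t == xorf s u)%:R * (t' == xorf s' u)%:R
         * chi (xorf (u0 u) (xorf t t')) v
         * chi (xorf (xorf c c') (if b then g0 else zerof)) d)).
  by rewrite pair_big pair_big.
transitivity (\sum_u (t == xorf s u)%:R * ((t' == xorf s' u)%:R
   * (N * (xorf (u0 u) (xorf t t') == zerof)%:R)
   * (q * (xorf (xorf c c') (if b then g0 else zerof) == zerof)%:R))).
  apply: eq_bigr => u _; rewrite -!sum_chi -[X in _ = _ * X]mulrA big_distrlr.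
  rewrite !mulr_sumr; apply: eq_bigr => v _; rewrite !mulr_sumr.
  by apply: eq_bigr => d _; rewrite /= !mulrA.
rewrite sum_eq_xorf /u0 !natr_andb.
rewrite (xorf_eq0 (xorf c c')) (xorf_eq c).
have -> : (c == xorf (if b then g0 else zerof) c') = (c == (if b then xorf c' g0 else c')).
  by clear; case: (b); rewrite xorfC ?xorf0.
set e := (c == _)%:R; move: (e); clear e; rewrite /u0; case: b {termE u0} => e.
  rewrite xor0f xorf_eq0.
  have [<-|_] := eqVneq t t'; last by rewrite /= !(mulr0, mul0r).
  have -> : (t == xorf s' (xorf s t)) = (s == s').
    by rewrite xorfA eq_sym xorf_eq xorff xorf_eq0 eq_sym.
  by rewrite /=; ring.
have -> : xorf (xorf s t) (xorf t t') = xorf s t' by rewrite -xorfA (xorfA t) xorff xor0f.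
rewrite xorf_eq0; have [<-|_] := eqVneq s t'; last by rewrite /= !(mulr0, mul0r).
have -> : (s == xorf s' (xorf s t)) = (t == s').
  by rewrite (xorfC s) xorfA eq_sym xorf_eq xorff xorf_eq0 eq_sym.
by rewrite /=; ring.
Qed.

Lemma pauli_orthogonal x x' :
  \sum_c \sum_s \sum_t pauli x c s t * pauli x' c t s = - (q * N) * (x == x')%:R.
Proof.
transitivity (\sum_c \sum_s \sum_t (t == xorf s x.1.1)%:R *
  (phase x.1.1 x.1.2 * phase x'.1.1 x'.1.2 * chi (xorf x.2 x'.2) c
   * (s == xorf t x'.1.1)%:R * (chi x.1.2 t * chi x'.1.2 s))).
  do 3![apply: eq_bigr => ? _]; rewrite chiDl /pauli; ring.
have sE s (F : B -> K) : \sum_t (t == xorf s x.1.1)%:R * F t = F (xorf s x.1.1).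
  by rewrite (bigD1 (xorf s x.1.1)) //= eqxx mul1r big1 ?addr0 // => t /negPf->;
     rewrite mul0r.
under eq_bigr do under eq_bigr do rewrite sE.
have eE s : (s == xorf (xorf s x.1.1) x'.1.1) = (x.1.1 == x'.1.1).
  by rewrite -xorfA eq_sym (xorfC s) xorf_eq xorff xorf_eq0.
transitivity (phase x.1.1 x.1.2 * phase x'.1.1 x'.1.2 * (x.1.1 == x'.1.1)%:R
   * chi x.1.2 x.1.1 * ((\sum_c chi (xorf x.2 x'.2) c)
   * (\sum_s chi (xorf x.1.2 x'.1.2) s))).
  rewrite big_distrlr mulr_sumr; apply: eq_bigr => c _; rewrite mulr_sumr.
  by apply: eq_bigr => s _; rewrite /= eE chiDr !chiDl; ring.
rewrite !sum_chi !xorf_eq0.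
case: x {sE eE} => [[u v] d]; case: x' => [[u' v'] d'] /=; rewrite !xpair_eqE.
have [<-|_] := eqVneq u u'; last by rewrite /= !(mulr0, mul0r).
have [<-|_] := eqVneq v v'; last by rewrite /= !(mulr0, mul0r).
rewrite phase_sq (chiC _ v); have := chi_sq K u v; rewrite mulr1 mulNr => ->.
by rewrite /=; ring.
Qed.

Let y0 : Y := (zerof, zerof, zerof).

Lemma pauli0 c s t : pauli y0 c s t = 'i * (s == t)%:R.
Proof.
by rewrite /pauli /= /phase !chi0 eqxx xorf0 !mulr1 (eq_sym t).
Qed.

Lemma pauli_sign0 : pauli_sign y0 = 1.
Proof. by rewrite /pauli_sign !chi0 mulr1. Qed.

(** The omitted index gives a multiple of the identity, see [pauli0]; the others span the traceless
    part. *)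
Definition pauli_index : finType := {x : B * B * C | x != (zerof, zerof, zerof)}.

Lemma sum_pauli_index (F : Y -> K) :
  \sum_(x : pauli_index) F (val x) = \sum_x F x - F y0.
Proof.
rewrite [in RHS](bigD1 y0) //= [RHS]addrAC subrr add0r.
by rewrite (big_sub (fun x => x != y0) F).
Qed.

Local Notation n := #|B|.

Definition pauli_mx x c : 'M[K]_n := \matrix_(i, j) pauli x c (enum_val i) (enum_val j).

Lemma sum_enum_val (F : B -> K) : \sum_(i < n) F (enum_val i) = \sum_s F s.
Proof. by rewrite -(big_enum_val F). Qed.

Definition pauli_alg : pzRingType := {ffun C -> 'M[K]_n}.

Definition pauli_iota (k : K) : pauli_alg := [ffun=> k%:M].

Fact pauli_iota_is_zmod : zmod_morphism pauli_iota.
Proof. by move=> k l; apply/ffunP => c; rewrite !ffunE raddfB. Qed.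

Fact pauli_iota_is_monoid : monoid_morphism pauli_iota.
Proof.
split; first by apply/ffunP => c; rewrite !ffunE.
by move=> k l; apply/ffunP => c; rewrite !ffunE /= scalar_mxM.
Qed.

HB.instance Definition _ := GRing.isZmodMorphism.Build K pauli_alg pauli_iota
  pauli_iota_is_zmod.
HB.instance Definition _ := GRing.isMonoidMorphism.Build K pauli_alg pauli_iota
  pauli_iota_is_monoid.

(** The normalisation tr 1 = -1: the traces of the q identity matrices add up to q N. *)
Let kappa : K := - (q * N)^-1.

Definition pauli_tr (f : pauli_alg) : K := kappa * \sum_c \tr (f c).

Fact pauli_tr_is_zmod : zmod_morphism pauli_tr.
Proof.
move=> f g; rewrite /pauli_tr -mulrBr -sumrB; congr (_ * _).
by apply: eq_bigr => c _; rewrite !ffunE raddfB.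
Qed.

HB.instance Definition _ := GRing.isZmodMorphism.Build pauli_alg K pauli_tr
  pauli_tr_is_zmod.

Lemma card_neq0 (T : finType) (t : T) : #|T|%:R != 0 :> K.
Proof. by rewrite pnatr_eq0 -lt0n; apply/card_gt0P; exists t. Qed.

Let N0 : N != 0 := card_neq0 zerof.
Let q0 : q != 0 := card_neq0 zerof.
Let kappaK : kappa * (q * N) = -1.
Proof. by rewrite mulNr mulVf // mulf_neq0. Qed.

Definition pauli_basis (x : pauli_index) : pauli_alg := [ffun c => pauli_mx (val x) c].

Let y : K := - (q * N * N).

Fact pauli_iotaC k (f : pauli_alg) : pauli_iota k * f = f * pauli_iota k.
Proof. by apply/ffunP => c; rewrite !ffunE /= -!mulmxE scalar_mxC. Qed.

Fact pauli_trZ k (f : pauli_alg) : pauli_tr (pauli_iota k * f) = k * pauli_tr f.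
Proof.
rewrite /pauli_tr [RHS]mulrCA; congr (_ * _); rewrite mulr_sumr.
by apply: eq_bigr => c _; rewrite !ffunE -mulmxE mul_scalar_mx mxtraceZ.
Qed.

Fact pauli_trC (f g : pauli_alg) : pauli_tr (f * g) = pauli_tr (g * f).
Proof.
by congr (_ * _); apply: eq_bigr => c _; rewrite !ffunE -!mulmxE mxtrace_mulC.
Qed.

Fact pauli_tr1 : pauli_tr 1 = -1.
Proof.
rewrite /pauli_tr -kappaK; congr (_ * _).
rewrite (eq_bigr (fun _ => N)) => [|c _]; last by rewrite ffunE mxtrace1.
by rewrite sumr_const mulr_natl.
Qed.

Lemma tr_pauli_mx x x' :
  kappa * \sum_c \tr (pauli_mx x c *m pauli_mx x' c) = (x == x')%:R.
Proof.
transitivity (kappa * (- (q * N) * (x == x')%:R)); last first.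
  by rewrite mulrA mulrN kappaK opprK mul1r.
rewrite -pauli_orthogonal; congr (_ * _); apply: eq_bigr => c _.
rewrite /mxtrace -sum_enum_val; apply: eq_bigr => i _.
rewrite mxE -sum_enum_val; apply: eq_bigr => j _.
by rewrite !mxE.
Qed.

Fact pauli_basis_on (x x' : pauli_index) :
  pauli_tr (pauli_basis x * pauli_basis x') = (x == x')%:R.
Proof.
rewrite -val_eqE -tr_pauli_mx; congr (_ * _).
by apply: eq_bigr => c _; rewrite !ffunE.
Qed.

(** Orthogonality to the omitted matrix, which is a nonzero multiple of 1. *)
Fact pauli_basis_tr (x : pauli_index) : pauli_tr (pauli_basis x) = 0.
Proof.
have := tr_pauli_mx (val x) y0; rewrite (negPf (valP x)).
have -> : \sum_c \tr (pauli_mx (val x) c *m pauli_mx y0 c)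
    = 'i * \sum_c \tr (pauli_mx (val x) c).
  rewrite mulr_sumr; apply: eq_bigr => c _.
  have -> : pauli_mx y0 c = 'i%:M.
    apply/matrixP => i j; rewrite !mxE pauli0 (inj_eq enum_val_inj).
    by rewrite mulr_natr.
  by rewrite mul_mx_scalar mxtraceZ.
rewrite mulrCA => /eqP; rewrite mulf_eq0 (negPf (neq0Ci _)) /= => /eqP E.
by rewrite /pauli_tr -[RHS]E; congr (_ * _); apply: eq_bigr => c _; rewrite ffunE.
Qed.

(** Leaving out the matrix 'i times 1 subtracts 'i ^+ 2 = -1 times a product of deltas: this is the
    term of the absent band. *)
Lemma sum_basis (b : bool) c c' (i j i' j' : 'I_n) :
  \sum_x pauli_sign (val x) ^+ b * (pauli_basis x c i j * pauli_basis x c' i' j')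
  = - (q * N) * [&& c == (if b then xorf c' g0 else c'), j == (if b then j' else i')
                  & i == (if b then i' else j')]%:R
    + ((i == j) && (i' == j'))%:R.
Proof.
under eq_bigr do rewrite !ffunE !mxE.
rewrite (sum_pauli_index (fun x => pauli_sign x ^+ b
   * (pauli x c (enum_val i) (enum_val j) * pauli x c' (enum_val i') (enum_val j')))).
rewrite sum_pauli pauli_sign0 expr1n !pauli0 !(inj_eq enum_val_inj).
congr (_ * _ + _).
  by case: b; rewrite !(inj_eq enum_val_inj).
rewrite mul1r mulrACA -expr2 sqrCi mulN1r opprK -natrM.
by case: (i == j); case: (i' == j').
Qed.

Fact pauli_basis_proj (f : pauli_alg) :
  \sum_x pauli_iota (pauli_tr (pauli_basis x * f)) * pauli_basis x
  = f + pauli_iota (pauli_tr f).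
Proof.
apply/ffunP => c; rewrite sum_ffunE !ffunE; apply/matrixP => k l.
rewrite summxE !mxE.
transitivity (\sum_x kappa * \sum_c' \sum_i \sum_j f c' j i *
    (pauli_sign (val x) ^+ false * (pauli_basis x c' i j * pauli_basis x c k l))).
  apply: eq_bigr => x _; rewrite !ffunE -mulmxE mul_scalar_mx !mxE /pauli_tr -mulrA.
  congr (_ * _); rewrite mulr_suml; apply: eq_bigr => c' _.
  rewrite /mxtrace mulr_suml; apply: eq_bigr => i _.
  rewrite !ffunE mxE mulr_suml; apply: eq_bigr => j _.
  by rewrite !mxE expr0; ring.
rewrite -mulr_sumr exchange_big /=.
transitivity (kappa * \sum_c' \sum_i \sum_j f c' j i *
  (- (q * N) * [&& c' == c, j == k & i == l]%:R + ((i == j) && (k == l))%:R)).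
  congr (_ * _); apply: eq_bigr => c' _; rewrite exchange_big; apply: eq_bigr => i _.
  rewrite exchange_big; apply: eq_bigr => j _; rewrite -mulr_sumr; congr (_ * _).
  exact: (sum_basis false).
under eq_bigr do under eq_bigr do under eq_bigr do rewrite mulrDr.
under eq_bigr do under eq_bigr do rewrite big_split.
under eq_bigr do rewrite big_split.
rewrite big_split mulrDr /=; congr (_ + _).
  rewrite (bigD1 c) //= (bigD1 l) //= (bigD1 k) //= !eqxx /=.
  rewrite big1 => [|j /negPf->]; last by rewrite /= !mulr0.
  rewrite big1 => [|i /negPf->]; last first.
    by rewrite big1 // => j _; rewrite andbF !mulr0.
  rewrite big1 => [|c' /negPf->]; last first.
    by rewrite big1 // => i _; rewrite big1 // => j _; rewrite !mulr0.
  by rewrite !addr0 mulr1 mulrCA mulrN kappaK opprK mulr1.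
case: (k == l); rewrite ?mulr0n ?mulr1n; last first.
  by rewrite big1 ?mulr0 // => c' _; rewrite big1 // => i _; rewrite big1 // => j _;
     rewrite andbF mulr0.
congr (_ * _); apply: eq_bigr => c' _; apply: eq_bigr => i _.
rewrite (bigD1 i) //= eqxx mulr1 big1 ?addr0 // => j.
by rewrite eq_sym => /negPf->; rewrite mulr0.
Qed.

Fact pauli_basis_sq : \sum_x pauli_basis x * pauli_basis x = pauli_iota (y + 1).
Proof.
apply/ffunP => c; rewrite sum_ffunE !ffunE; apply/matrixP => k l; rewrite summxE mxE.
transitivity (\sum_j \sum_x pauli_sign (val x) ^+ false
    * (pauli_basis x c k j * pauli_basis x c j l)).
  rewrite exchange_big; apply: eq_bigr => x _; rewrite ffunE -mulmxE mxE.
  by apply: eq_bigr => j _; rewrite mul1r.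
under eq_bigr do rewrite (sum_basis false) !eqxx.
rewrite big_split /= sumr_const card_ord (bigD1 k) //= eqxx big1 => [|j]; last first.
  by rewrite eq_sym => /negPf->.
rewrite /y; case: (k == l); rewrite ?mulr0n ?mulr1n ?mulr0 ?mul0rn ?addr0 // mulr1.
by rewrite -mulr_natr; ring.
Qed.

Definition pauli_frobenius : frobenius pauli_index y :=
  Frobenius (falg := pauli_alg) (iota := pauli_iota) (ftr := pauli_tr)
    (fbasis := pauli_basis) (fun x : pauli_index => pauli_sign (val x))
    pauli_iotaC pauli_trZ pauli_trC pauli_tr1 pauli_basis_tr pauli_basis_on
    pauli_basis_proj pauli_basis_sq.

Let w : K := (g0 == zerof)%:R.
Let z : K := N^-1.

Fact pauli_swap_w : (forall c, xorf c g0 = c) /\ w = 1 \/ (forall c, xorf c g0 != c) /\ w = 0.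
Proof.
rewrite /w; have [->|g00] := eqVneq g0 zerof; [left|right]; split=> // c.
  by rewrite xorf0.
by rewrite xorfC xorf_eq xorff.
Qed.

Fact pauli_sum_sign : \sum_(x : pauli_index) pauli_sign (val x) = - 1 - y * z * w.
Proof.
rewrite (sum_pauli_index pauli_sign) pauli_sign0.
transitivity (\sum_(u : B) \sum_(v : B) \sum_(d : C) chi u v * chi g0 d - 1).
  congr (_ - _); rewrite pair_big pair_big.
  by apply: eq_bigr => x _; rewrite /pauli_sign /= (chiC _ g0).
under eq_bigr do under eq_bigr do rewrite -mulr_sumr sum_chi.
under eq_bigr do rewrite -mulr_suml sum_chi.
rewrite -mulr_suml -mulr_sumr (bigD1 zerof) //= eqxx big1 => [|u /negPf->] //.
by rewrite addr0 mulr1 /y /z /w mulNr mulfK //; ring.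
Qed.

Fact pauli_entries k (f : 'I_k -> pauli_index) : vertex_wt pauli_frobenius (codom f)
  = kappa * #|'I_n|%:R ^+ (k == 0)%N * \sum_c \sum_(i : {ffun 'I_k -> 'I_n})
        \prod_j pauli_basis (f j) c (i (ord_pred j)) (i j).
Proof.
rewrite /vertex_wt /= /pauli_tr -mulrA; congr (_ * _); rewrite mulr_sumr.
apply: eq_bigr => c _; rewrite card_ord.
rewrite -(trace_prod (fun j => pauli_basis (f j) c)); congr (\tr _).
rewrite /word.
have -> : codom (fun j => pauli_basis (f j) c)
    = map (fun x : pauli_index => pauli_basis x c) (codom f).
  by rewrite /codom /image_mem -map_comp.
elim: (codom f) => [|x s IH]; first by rewrite !big_nil ffunE.
by rewrite !big_cons ffunE IH.
Qed.

Definition pauli_model : flag_model z w pauli_frobenius.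
Proof.
have yz : y * z = - (q * N) by rewrite /y /z mulNr mulfK.
apply: (@FlagModel _ _ _ _ _ _ 'I_n C (fun (x : pauli_index) c i j => pauli_basis x c i j)
  (fun c => xorf c g0) kappa).
- exact: xorfK.
- exact: pauli_swap_w.
- by move=> x; apply: pauli_sign_sq.
- exact: pauli_sum_sign.
- by rewrite yz mulrN kappaK opprK.
- by rewrite card_ord mulVf.
- by rewrite yz mulNr mulfK // opprK.
- exact: pauli_entries.
move=> b c c' i j i' j'; rewrite yz.
rewrite (sum_basis b); congr (_ * _ + _).
Defined.

End Pauli.

(** * Density of the specialisations *)

Section IdempotentSplit.

Variables (R : comUnitRingType) (w : R).
Hypothesis w_idem : w * w = w.

(** Polynomial expressions in an idempotent are determined by their values at 0 and 1; idempotency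
    enters only in the closure under products. *)
Definition splits (f : R -> R) : Prop := f w = (1 - w) * f 0 + w * f 1.

Lemma splits_cst k : splits (fun=> k).
Proof. by rewrite /splits; ring. Qed.

Lemma splits_id : splits id.
Proof. by rewrite /splits mulr0 mulr1 add0r. Qed.

Lemma splitsD f g : splits f -> splits g -> splits (fun v => f v + g v).
Proof. by rewrite /splits => -> ->; ring. Qed.

Lemma splitsM f g : splits f -> splits g -> splits (fun v => f v * g v).
Proof.
rewrite /splits => -> ->.
transitivity ((1 - w) * f 0 * g 0 + w * f 1 * g 1
  + (w * w - w) * (f 0 * g 0 + f 1 * g 1 - f 0 * g 1 - f 1 * g 0)); first by ring.
by rewrite w_idem; ring.
Qed.

Lemma splitsX f k : splits f -> splits (fun v => f v ^+ k).
Proof.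
move=> fs; elim: k => [|k IH]; first exact: splits_cst.
by rewrite /splits !exprS; apply: (splitsM fs IH).
Qed.

Lemma splits_sum (I : Type) (r : seq I) (P : pred I) (F : I -> R -> R) :
  (forall j, splits (F j)) -> splits (fun v => \sum_(j <- r | P j) F j v).
Proof.
move=> Fs; elim: r => [|j r IH]; first by rewrite /splits !big_nil; ring.
rewrite /splits !big_cons; case: (P j); last exact: IH.
exact: (splitsD (Fs j) IH).
Qed.

Lemma Rpoly_splits (L : finType) (E : code L) a z :
  Rpoly E a z w = (1 - w) * Rpoly E a z 0 + w * Rpoly E a z 1.
Proof.
have cst k : splits (fun=> k) by exact: splits_cst.
suff : splits (fun v => Rpoly E a z v) by [].
rewrite /Rpoly /Qpoly /Mpoly; apply: splits_sum => s; apply: splitsM; first exact: cst.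
apply: splitsM; first apply: splitsM.
- exact: cst.
- by apply: splitsX; rewrite /splits; ring.
apply: splits_sum => B; apply: splitsM; first exact: cst.
exact: splitsX splits_id.
Qed.

End IdempotentSplit.

Lemma Rpoly_morph (R R' : comUnitRingType) (f : {rmorphism R -> R'}) (L : finType)
    (E : code L) a z w : a \is a GRing.unit ->
  f (Rpoly E a z w) = Rpoly E (f a) (f z) (f w).
Proof.
move=> au; rewrite /Rpoly rmorph_sum; apply: eq_bigr => s _ /=.
rewrite rmorphM rmorphXz //= /Qpoly; congr (_ * _).
rewrite !rmorphM !rmorphXn !rmorphB !rmorphN !rmorphM rmorph1 /=.
rewrite !rmorphB !rmorphN rmorphV //= rmorph_nat; congr (_ * _).
rewrite rmorph_sum; apply: eq_bigr => B _; rewrite /Mpoly /= !rmorphM !rmorphXn.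
by rewrite !rmorphB !rmorphN rmorph1 rmorphV //= rmorph_nat.
Qed.

(** * Laurent polynomials in a over Z[z], uniformly in the ring *)

Definition spec_z (R : comNzRingType) (z : R) (p : {poly int}) : R := (map_poly intr p).[z].
Definition spec (R : comNzRingType) (a z : R) (p : {poly {poly int}}) : R :=
  (map_poly (spec_z z) p).[a].

Section Specialization.

Variables (R : comNzRingType) (a z : R).

Fact spec_z_zmod : zmod_morphism (spec_z z).
Proof. by move=> p q; rewrite /spec_z rmorphB hornerD hornerN. Qed.

Fact spec_z_monoid : monoid_morphism (spec_z z).
Proof. by split=> [|p q]; rewrite /spec_z ?rmorph1 ?hornerC // rmorphM hornerM. Qed.

HB.instance Definition _ := GRing.isZmodMorphism.Build {poly int} R (spec_z z) spec_z_zmod.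
HB.instance Definition _ := GRing.isMonoidMorphism.Build {poly int} R (spec_z z) spec_z_monoid.

Fact spec_zmod : zmod_morphism (spec a z).
Proof. by move=> p q; rewrite /spec rmorphB hornerD hornerN. Qed.

Fact spec_monoid : monoid_morphism (spec a z).
Proof. by split=> [|p q]; rewrite /spec ?rmorph1 ?hornerC // rmorphM hornerM. Qed.

HB.instance Definition _ := GRing.isZmodMorphism.Build {poly {poly int}} R (spec a z) spec_zmod.
HB.instance Definition _ := GRing.isMonoidMorphism.Build {poly {poly int}} R (spec a z) spec_monoid.

Lemma specX : spec a z 'X = a.
Proof. by rewrite /spec map_polyX hornerX. Qed.

Lemma specC : spec a z 'X%:P = z.
Proof. by rewrite /spec map_polyC hornerC /= /spec_z map_polyX hornerX. Qed.

End Specialization.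

(** One integral polynomial p serves all rings at once. This carries information from the algebraic
    numbers to the field of fractions. *)
Definition laurent (f : forall R : comUnitRingType, R -> R -> R) : Prop :=
  exists k p, forall (R : comUnitRingType) (a z : R), a \is a GRing.unit ->
    a ^+ k * f R a z = spec a z p.

Lemma laurent_int (c : int) : laurent (fun R _ _ => c%:~R).
Proof. by exists 0%N, c%:~R => R a z _; rewrite mul1r rmorph_int. Qed.

Lemma laurent_a : laurent (fun R a _ => a).
Proof. by exists 0%N, 'X => R a z _; rewrite mul1r specX. Qed.

Lemma laurent_z : laurent (fun R _ z => z).
Proof. by exists 0%N, 'X%:P => R a z _; rewrite mul1r specC. Qed.

Lemma laurent_inva : laurent (fun R a _ => a^-1).
Proof. by exists 1%N, 1 => R a z au; rewrite rmorph1 divrr. Qed.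

Lemma laurentM f g : laurent f -> laurent g -> laurent (fun R a z => f R a z * g R a z).
Proof.
move=> [k [p fp]] [l [q gq]]; exists (k + l)%N, (p * q) => R a z au.
by rewrite rmorphM /= -fp // -gq // exprD mulrACA.
Qed.

Lemma laurentD f g : laurent f -> laurent g -> laurent (fun R a z => f R a z + g R a z).
Proof.
move=> [k [p fp]] [l [q gq]]; exists (k + l)%N, ('X^l * p + 'X^k * q) => R a z au.
rewrite rmorphD !rmorphM !rmorphXn /= specX -fp // -gq // exprD; ring.
Qed.

Lemma laurentX f k : laurent f -> laurent (fun R a z => f R a z ^+ k).
Proof.
move=> lf; elim: k => [|k IH].
  by have [k [p fp]] := laurent_int 1; exists k, p => R a z au; rewrite -fp.
have [l [p fp]] := laurentM lf IH; exists l, p => R a z au.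
by rewrite -fp // exprS.
Qed.

Lemma laurentXz f : forall k : int,
  laurent f -> laurent (fun R a z => (f R a z)^-1) -> laurent (fun R a z => f R a z ^ k).
Proof.
move=> [k|k] lf lg; first exact: laurentX lf.
have [l [p fp]] := laurentX k.+1 lg; exists l, p => R a z au.
by rewrite -fp // exprVn.
Qed.

Lemma laurentN f : laurent f -> laurent (fun R a z => - f R a z).
Proof.
move=> lf; have [l [p fp]] := laurentM (laurent_int (-1)) lf.
by exists l, p => R a z au; rewrite -fp // rmorphN rmorph1 mulN1r.
Qed.

Lemma laurent_sum (I : Type) (r : seq I) (P : pred I)
    (F : I -> forall R : comUnitRingType, R -> R -> R) :
  (forall i, laurent (F i)) -> laurent (fun R a z => \sum_(i <- r | P i) F i R a z).
Proof.
move=> lF; elim: r => [|i r [k [p fp]]].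
  by exists 0%N, 0 => R a z _; rewrite big_nil mulr0 rmorph0.
case Pi: (P i); last by exists k, p => R a z au; rewrite big_cons Pi fp.
have [l [q fq]] := laurentD (lF i) (ex_intro _ k (ex_intro _ p fp)).
by exists l, q => R a z au; rewrite big_cons Pi -fq.
Qed.

Lemma laurent_Rpoly (L : finType) (E : code L) (b : bool) :
  laurent (fun R a z => Rpoly E a z b%:R).
Proof.
have l1 := laurent_int 1; have lN1 := laurent_int (-1).
have ly : laurent (fun R a _ => - a - 2 - a^-1).
  have [k [p fp]] := laurentD (laurentD (laurentN laurent_a) (laurent_int (-2)))
                       (laurentN laurent_inva).
  by exists k, p => R a z au; rewrite -fp // rmorphN.
have lb : laurent (fun R _ _ => b%:R).
  by have [k [p fp]] := laurent_int b; exists k, p => R a z au; rewrite -fp.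
have lm1 : laurent (fun R _ _ => -1) by have := laurentN l1.
rewrite /Rpoly /Qpoly /Mpoly; apply: laurent_sum => s; apply: laurentM.
  by apply: laurentXz laurent_a laurent_inva.
apply: laurentM; first apply: laurentM.
- by apply: laurentX; apply: laurentD lm1 (laurentN ly).
- apply: laurentX; apply: laurentD lm1 (laurentN _).
  by apply: laurentM lb; apply: laurentM ly laurent_z.
apply: laurent_sum => B; apply: laurentM (laurentX _ lb).
apply: laurentM (laurentX _ laurent_z); apply: laurentM (laurentX _ ly).
exact: laurentX.
Qed.

Lemma poly_eq0_roots (R : idomainType) (p : {poly R}) (f : nat -> R) :
  injective f -> (forall k, p.[f k] = 0) -> p = 0.
Proof.
move=> f_inj pf; apply/eqP/negPn/negP => p0.
have := max_poly_roots p0 (rs := mkseq f (size p)).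
rewrite mkseq_uniq // size_mkseq ltnn => /(_ _ isT).
suff -> : all (root p) (mkseq f (size p)) by move=> /(_ isT).
by apply/allP => _ /mapP[k _ ->]; rewrite /root pf.
Qed.

(** A root of a^2 - (t - 2) a + 1, nonzero because of the constant term. *)
Lemma skein_root (t : algC) : {a : algC | a != 0 & - a - 2 - a^-1 = - t}.
Proof.
pose s := sqrtC ((t - 2) ^+ 2 - 4); pose a := (t - 2 + s) / 2.
have aa : a * a = (t - 2) * a - 1.
  have ss : s * s = (t - 2) ^+ 2 - 4 by rewrite -expr2 sqrtCK.
  have two : (2 : algC) != 0 by rewrite pnatr_eq0.
  apply: (mulfI two); apply: (mulfI two); rewrite /a.
  transitivity ((t - 2 + s) * (t - 2 + s)); first by field.
  transitivity ((t - 2) ^+ 2 + 2 * (t - 2) * s + s * s); first by ring.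
  by rewrite ss; field.
have a0 : a != 0.
  apply/eqP => a0; move: aa; rewrite a0 !mulr0 add0r => /eqP.
  by rewrite eq_sym oppr_eq0 oner_eq0.
exists a => //; apply: (mulfI a0); rewrite !mulrBr mulfV // mulrN aa; ring.
Qed.

Lemma natr_exp2_inj (c d : nat) : injective (fun k => (2 ^ (k + c) * 2 ^ d)%:R : algC).
Proof.
move=> k l /eqP; rewrite eqr_nat eqn_pmul2r ?expn_gt0 // => /eqP.
by move=> /(expnI (isT : (1 < 2)%N)) /addIn.
Qed.

(** For fixed r infinitely many values of a occur as m varies, so p vanishes at z = 2^-r as a
    polynomial in a; then each coefficient has infinitely many roots 2^-r. *)
Lemma spec_eq0 (p : {poly {poly int}}) :
  (forall r m (a : algC), (0 < m)%N -> a != 0 ->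
     - a - 2 - a^-1 = - (2 ^ m * 2 ^ (r + r))%:R -> spec a (2 ^ r)%:R^-1 p = 0) ->
  p = 0.
Proof.
move=> vanish; apply/polyP => i; rewrite coef0.
apply: (map_inj_poly (f := intr : int -> algC) intr_inj (rmorph0 _)); rewrite map_poly0.
apply: (poly_eq0_roots (f := fun r => (2 ^ r)%:R^-1)).
  by move=> r r' /invr_inj/eqP; rewrite eqr_nat => /eqP/(expnI (isT : (1 < 2)%N)).
move=> r; suff : map_poly (spec_z (2 ^ r)%:R^-1) p = 0 :> {poly algC}.
  by move=> /(congr1 (coefp i)); rewrite /= coef_map coef0.
apply: (poly_eq0_roots
  (* The shift by 1 keeps m positive; different m give different a, because a determines - a - 2 -
     a^-1. *)
  (f := fun m => s2val (skein_root (2 ^ (m + 1) * 2 ^ (r + r))%:R))).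
  move=> m m' mm'; apply: (@natr_exp2_inj 1 (r + r)); apply: oppr_inj.
  by rewrite /= -(s2valP' (skein_root _)) -(s2valP' (skein_root (2 ^ (m' + 1) * _)%:R)) mm'.
move=> m; apply: (vanish r (m + 1)%N); first by rewrite addn1.
- by case: (skein_root _).
by case: (skein_root _).
Qed.

(** * Transfer to the coefficient ring *)

Lemma Rpoly_eq_morph (R R' : comUnitRingType) (f : {rmorphism R -> R'}) (L L' : finType)
    (E : code L) (E' : code L') (n : int) a z k : a \is a GRing.unit ->
  Rpoly E a z k%:R = (- a) ^ n * Rpoly E' a z k%:R ->
  Rpoly E (f a) (f z) k%:R = (- f a) ^ n * Rpoly E' (f a) (f z) k%:R.
Proof.
move=> au /(congr1 f); rewrite rmorphM rmorphXz ?unitrN //= rmorphN.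
by rewrite !Rpoly_morph // rmorph_nat.
Qed.

Lemma Rpoly_eq_idem (R : comUnitRingType) (L L' : finType) (E : code L) (E' : code L')
    (a z w c : R) : w * w = w ->
  (forall b : bool, Rpoly E a z b%:R = c * Rpoly E' a z b%:R) ->
  Rpoly E a z w = c * Rpoly E' a z w.
Proof.
move=> ww EE'; rewrite !(Rpoly_splits ww).
have := EE' true; have := EE' false; rewrite /= => -> ->; ring.
Qed.

Section Invariance.

Variables (E E' : twisted_diagram) (n : int).
Hypothesis Zsum_eq : forall (K : fieldType) (X : finType) (a : K)
  (A : frobenius X (- a - 2 - a^-1)), a != 0 -> Zsum A a E = (- a) ^ n * Zsum A a E'.

Lemma Rpoly_pauli r m (g0 : {ffun 'I_m -> bool}) (a : algC) : a != 0 ->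
  - a - 2 - a^-1 = - (2 ^ m * 2 ^ (r + r))%:R ->
  Rpoly E a (2 ^ r)%:R^-1 (g0 == zerof)%:R
    = (- a) ^ n * Rpoly E' a (2 ^ r)%:R^-1 (g0 == zerof)%:R.
Proof.
move=> a0; rewrite expnD !natrM mulrA => ya.
have := pauli_model r g0; move: (pauli_frobenius r g0).
rewrite !card_ffun card_bool !card_ord -ya => A M.
by rewrite (Rpoly_Zsum a0 M (arc_two_ends E)) (Rpoly_Zsum a0 M (arc_two_ends E')) Zsum_eq.
Qed.

(** Up to a power of a, the difference of the two sides is given by one integral polynomial. It
    vanishes at all values of the model, hence is zero, hence vanishes at the generic a and z. *)
Lemma Rpoly_ratfun (b : bool) :
  let a := tofrac 'X : ratfun_az in let z := tofrac 'X%:P : ratfun_az in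
  Rpoly E a z b%:R = (- a) ^ n * Rpoly E' a z b%:R.
Proof.
move=> a z.
have [k [p fp]] : laurent (fun R a z => Rpoly E a z b%:R - (- a) ^ n * Rpoly E' a z b%:R).
  apply: laurentD (laurent_Rpoly _ _) (laurentN _); apply: laurentM (laurent_Rpoly _ _).
  apply: laurentXz; first exact: laurentN laurent_a.
  have [l [q gq]] := laurentN laurent_inva.
  by exists l, q => R c d cu; rewrite -gq // invrN.
have p0 : p = 0.
  apply: spec_eq0 => r m c m0 c0 ya; rewrite -fp ?unitfE //.
  (* For w = 0 the shift g0 must be nonzero; the constant function true is, as m > 0. *)
  have -> : b%:R = ([ffun=> ~~ b] == zerof :> {ffun 'I_m -> bool})%:R :> algC.
    congr (nat_of_bool _)%:R; apply/idP/eqP => [b1|/ffunP/(_ (Ordinal m0))].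
      by apply/ffunP => i; rewrite !ffunE b1.
    by rewrite !ffunE; case: (b).
  by rewrite Rpoly_pauli // subrr mulr0.
have a0 : a != 0 by rewrite tofrac_eq0 polyX_eq0.
apply/subr0_eq/(mulfI (expf_neq0 k a0)); rewrite mulr0.
by rewrite (fp _ a z) ?unitfE // p0 rmorph0.
Qed.

Lemma R_of_eq : R_of E = (- var_a) ^ n * R_of E'.
Proof.
have w_idem : var_w * var_w = var_w.
  apply/eqP; rewrite -subr_eq0 /var_w -rmorphM -rmorphB -expr2 /=.
  have h2 : size idempotent_poly = 3 by rewrite size_polyDl size_polyXn // size_polyN size_polyX.
  have hm : idempotent_poly \is monic.
    by rewrite monicE lead_coefDl ?lead_coefXn // size_polyN size_polyX size_polyXn.
  (* Since the modulus is monic of size 3, [mk_monic] returns it unchanged. *)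
  apply/eqP/val_inj => /=; rewrite /mk_monic h2 hm /=.
  exact: Pdiv.RingMonic.rmodpp.
pose i := qpolyC idempotent_poly : {rmorphism ratfun_az -> Rring}.
have a0 : tofrac 'X \is a @GRing.unit ratfun_az.
  by rewrite unitfE tofrac_eq0 polyX_eq0.
apply: Rpoly_eq_idem w_idem _ => b.
exact: (Rpoly_eq_morph i a0 (Rpoly_ratfun b)).
Qed.

End Invariance.

Theorem proposition6p9 (E E' : twisted_diagram) :
  ((move_II E E' \/ move_III E E' \/ move_IV E E') -> R_of E = R_of E') /\
  ((move_I E E' \/ move_V E E') ->
     exists n : int, R_of E = (((- var_a) ^ n) * R_of E')%R).
Proof.
split=> [EE'|/Zsum_unit_invariant[n Zn]]; last by exists n; apply: R_of_eq.
(* Moves II, III and IV are the case of exponent 0. *)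
rewrite (@R_of_eq E E' 0) ?mul1r // => K X a A a0.
by rewrite mul1r (Zsum_invariant EE').
Qed.
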